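(* Let $\nu,\mu$ be normal weights on $\mathbb D$, let $\alpha>-1$ and let $\omega$ be a weight function such that $\{\nu,\omega\}$ is a normal pair with $\nu(r)\omega(r)=(1-r^2)^\alpha$ for $0\le r<1$. Let $g\in\mathcal B^0_{(1-|z|^2)\mu(z)}$ and let $\phi$ be an analytic self-map of $\mathbb D$ such that $T_g^\phi:\mathcal H^\infty_\nu\to\mathcal H^\infty_\mu$ is bounded. Then the following statements are equivalent. (a) $T_g^\phi:\mathcal H^0_\nu\to\mathcal H^\infty_\mu$ is nuclear. (b) $T_g^\phi:\mathcal H^\infty_\nu\to\mathcal H^\infty_\mu$ is nuclear. (c) $T_g^\phi:\mathcal H^0_\nu\to\mathcal H^0_\mu$ is nuclear. (d) $T_g^\phi:\mathcal H^\infty_\nu\to\mathcal H^0_\mu$ is nuclear. (e) $$\int_{\mathbb D}\left[\sup_{z\in\mathbb D}\frac{(1-|z|^2)\mu(z)|g'(z)|}{|1-\bar\zeta\phi(z)|^{\alpha+2}}\right]\frac{(1-|\zeta|^2)^\alpha}{\nu(\zeta)}\,dA(\zeta)<\infty.$$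
   Context: $\mathbb D$ is the open unit disk in $\mathbb C$, $H(\mathbb D)$ the space of analytic functions on $\mathbb D$, and $dA$ normalized Lebesgue measure on $\mathbb D$. For $g\in H(\mathbb D)$ and an analytic map $\phi:\mathbb D\to\mathbb D$, $(T_g^\phi f)(z)=\int_0^z f(\phi(\zeta))g'(\zeta)\,d\zeta$ for $f\in H(\mathbb D)$, $z\in\mathbb D$. A radial weight is a continuous positive function $\nu$ on $\mathbb D$ with $\nu(z)=\nu(|z|)$, non-increasing in $|z|$. It is normal if: (I) there is $\beta>0$ such that $r\mapsto\nu(r)/(1-r^2)^\beta$ is almost increasing on $[0,1)$; and (II) there is $\gamma>0$ such that $r\mapsto\nu(r)/(1-r^2)^\gamma$ is almost decreasing on $[0,1)$. (A function $h$ is almost increasing if there is $C>0$ with $h(r)\le C h(s)$ for all $r\le s$; almost decreasing if $h(s)\le C h(r)$ for all $r\le s$.) $\{\nu,\omega\}$ is a normal pair if $\nu$ is normal, $\omega$ is radial, positive and continuous with $\int_0^1\omega(r)\,dr<\infty$, and $\nu(r)\omega(r)=(1-r^2)^\alpha$, $0\le r<1$, for some $\alpha>\beta-1$, where $\beta>0$ is an exponent as in (I) for $\nu$. $\mathcal H^\infty_\nu=\{f\in H(\mathbb D):\|f\|_{\mathcal H^\infty_\nu}=\sup_{z\in\mathbb D}\nu(z)|f(z)|<\infty\}$ and $\mathcal H^0_\nu=\{f\in H(\mathbb D):\lim_{|z|\to1^-}\nu(z)|f(z)|=0\}$, with the norm of $\mathcal H^\infty_\nu$. $\mathcal B^0_{(1-|z|^2)\mu(z)}=\{f\in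 H(\mathbb D):\lim_{|z|\to1^-}(1-|z|^2)\mu(z)|f'(z)|=0\}$. A linear operator $T:X\to Y$ between Banach spaces is nuclear if there are sequences $(x_k')\subset X'$ (the dual of $X$) and $(y_k)\subset Y$ with $\sum_k\|x_k'\|\|y_k\|<\infty$ and $Tx=\sum_k x_k'(x)y_k$ for all $x\in X$. *)

(* Defs.v *)
From HB Require Import structures.
From mathcomp Require Import all_boot all_order all_algebra complex.
From mathcomp Require Import all_classical all_reals all_analysis.

Set Implicit Arguments.
Unset Strict Implicit.
Unset Printing Implicit Defensive.

Import Order.TTheory GRing.Theory Num.Theory.
Import numFieldNormedType.Exports.

Local Open Scope classical_set_scope.
Local Open Scope ring_scope.
Local Open Scope complex_scope.

(* The topology and norm of R[i]^o, made available on R[i] itself, so that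
   [derivable f z 1] is complex differentiability for f : R[i] -> R[i]. *)
HB.instance Definition _ (R : rcfType) := NormedModule.copy R[i] R[i]^o.

(* The library norm of a normed space over R[i] takes its (real, nonnegative)
   values in R[i]; [rnorm] is the same norm with values in R. *)
Definition rnorm (R : rcfType) (V : normedModType R[i]) (x : V) : R := complex.Re `|x|.

Section disk.
Context {R : realType}.
Implicit Types (f g phi w : R[i] -> R[i]) (h : R[i] -> R).

Definition disk : set R[i] := [set z | `|z| < 1].

Definition analytic_on_disk f := forall z, disk z -> derivable f z 1.

Definition analytic_self_map phi :=
  analytic_on_disk phi /\ forall z, disk z -> disk (phi z).

(* H(D), each function on the disk being represented by its extension by 0,
   so that two elements are equal as soon as they agree on the disk. *)
Definition holomorphic : set (R[i] -> R[i]) :=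
  [set f | analytic_on_disk f /\ forall z, ~ disk z -> f z = 0].

(* h z tends to 0 as |z| tends to 1 from below *)
Definition vanishes_at_boundary h :=
  forall e : R, 0 < e -> exists2 r : R, r < 1 &
    forall z, r < rnorm z < 1 -> `|h z| < e.

Definition little_bloch h g := analytic_on_disk g /\
  vanishes_at_boundary (fun z => h z * rnorm (derive1 g z)).

Definition continuous_on_disk h := {in disk, continuous h}.
Definition positive_on_disk h := forall z, disk z -> 0 < h z.
Definition radial_on_disk h := forall z, disk z -> h z = h `|z|.

(* Integral of f along the segment from 0 to z, parametrized by t |-> t z. *)
Definition segment_integral f (z : R[i]) : R[i] :=
  let F t := f (t%:C * z) * z in
  (\int[lebesgue_measure]_(t in `[0, 1]) complex.Re (F t))%R +i*
  (\int[lebesgue_measure]_(t in `[0, 1]) complex.Im (F t))%R.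

(* The value 0 off the disk matches the representation in [holomorphic]. *)
Definition T_op g phi f (z : R[i]) : R[i] :=
  if z \in disk then
    segment_integral (fun zeta => f (phi zeta) * derive1 g zeta) z
  else 0.

(* Integral over the disk against area measure normalized to total mass 1. *)
Definition area_integral (F : R[i] -> \bar R) : \bar R :=
  ((pi^-1)%:E * \int[lebesgue_measure \x lebesgue_measure]_(p in
      [set p : R * R | disk (p.1 +i* p.2)]) F (p.1 +i* p.2))%E.

End disk.

Record radial_weight (R : realType) := RadialWeight {
  weight_fun :> R[i] -> R ;
  weight_continuous : continuous_on_disk weight_fun ;
  weight_gt0 : positive_on_disk weight_fun ;
  weight_radial : radial_on_disk weight_fun ;
  weight_ninc : forall z w : R[i], disk z -> disk w -> `|z| <= `|w| ->
    weight_fun w <= weight_fun z }.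

Section normal_weights.
Context {R : realType}.
Implicit Types (nu : radial_weight R) (omega : R[i] -> R).

Definition almost_increasing (h : R -> R) := exists2 C : R, 0 < C &
  forall r s, 0 <= r -> r <= s -> s < 1 -> h r <= C * h s.

Definition almost_decreasing (h : R -> R) := exists2 C : R, 0 < C &
  forall r s, 0 <= r -> r <= s -> s < 1 -> h s <= C * h r.

Definition exponent_I nu (beta : R) :=
  0 < beta /\ almost_increasing (fun r => nu r%:C / (1 - r ^+ 2) `^ beta).

Definition exponent_II nu (gamma : R) :=
  0 < gamma /\ almost_decreasing (fun r => nu r%:C / (1 - r ^+ 2) `^ gamma).

Definition normal_weight nu :=
  (exists beta, exponent_I nu beta) /\ (exists gamma, exponent_II nu gamma).

Definition normal_pair nu omega (alpha : R) := [/\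
  normal_weight nu,
  [/\ radial_on_disk omega, positive_on_disk omega & continuous_on_disk omega],
  (\int[lebesgue_measure]_(r in `[0%R, 1%R[) (omega r%:C)%:E < +oo)%E,
  forall r : R, 0 <= r < 1 -> nu r%:C * omega r%:C = (1 - r ^+ 2) `^ alpha &
  exists2 beta, exponent_I nu beta & beta - 1 < alpha].

End normal_weights.

Section weighted_norm.
Context {R : realType} (nu : radial_weight R).
Implicit Types f : R[i] -> R[i].

Definition weighted_norm f : \bar R :=
  ereal_sup [set (nu z * rnorm (f z))%:E | z in disk].

Definition Hinf_set := [set f | holomorphic f /\ (weighted_norm f < +oo)%E].

Definition H0_set :=
  [set f | holomorphic f /\ vanishes_at_boundary (fun z => nu z * rnorm (f z))].

Definition Hinf_pred : {pred R[i] -> R[i]} := mem Hinf_set.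
Definition H0_pred : {pred R[i] -> R[i]} := mem H0_set.

End weighted_norm.

Section lemmas.
Context {R : realType}.
Implicit Types (nu : radial_weight R) (f g : R[i] -> R[i]).

Lemma normE (V : normedModType R[i]) (x : V) : `|x| = (rnorm x)%:C.
Proof. by rewrite /rnorm RRe_real// normr_real. Qed.

Lemma rnorm_ge0 (V : normedModType R[i]) (x : V) : 0 <= rnorm x.
Proof. by rewrite -ler0c -normE. Qed.

Lemma rnormD (V : normedModType R[i]) (x y : V) :
  rnorm (x + y) <= rnorm x + rnorm y.
Proof. by rewrite -lecR rmorphD /= -!normE ler_normD. Qed.

Lemma rnormZ (V : normedModType R[i]) (a : R[i]) (x : V) :
  rnorm (a *: x) = rnorm a * rnorm x.
Proof. by apply: complexI; rewrite rmorphM /= -!normE normrZ. Qed.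

Lemma rnorm_eq0 (V : normedModType R[i]) (x : V) : rnorm x = 0 -> x = 0.
Proof. by move=> x0; apply/eqP; rewrite -normr_eq0 normE x0. Qed.

Lemma disk_rnorm (z : R[i]) : disk z <-> rnorm z < 1.
Proof. by rewrite /disk /= normE -ltcR. Qed.

Lemma disk0 : disk (0 : R[i]).
Proof. by rewrite /disk /= normr0. Qed.

Lemma holomorphic0 : holomorphic (0 : R[i] -> R[i]).
Proof. by split=> [z _|//]; exact: derivable_cst. Qed.

Lemma holomorphicZD (a : R[i]) f g :
  holomorphic f -> holomorphic g -> holomorphic (a *: f + g).
Proof.
move=> [df f0] [dg g0]; split=> z Dz.
  by apply: derivableD; [apply: derivableZ; exact: df|exact: dg].
by rewrite !fctE f0// g0// scaler0 addr0.
Qed.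

Lemma weighted_norm_ub nu f z : disk z ->
  ((nu z * rnorm (f z))%:E <= weighted_norm nu f)%E.
Proof. by move=> Dz; apply: ereal_sup_ubound; exists z. Qed.

Lemma weighted_norm_ge0 nu f : (0 <= weighted_norm nu f)%E.
Proof.
apply: le_trans (weighted_norm_ub nu f disk0).
by rewrite lee_fin mulr_ge0 ?rnorm_ge0// ltW// weight_gt0//; exact: disk0.
Qed.

Lemma weighted_normD nu f g :
  (weighted_norm nu (f + g)%R <= weighted_norm nu f + weighted_norm nu g)%E.
Proof.
apply: ge_ereal_sup => _ [z Dz <-].
apply: (@le_trans _ _ (nu z * rnorm (f z) + nu z * rnorm (g z))%:E).
  by rewrite lee_fin -mulrDr ler_wpM2l ?rnormD// ltW// weight_gt0.
by rewrite EFinD leeD// weighted_norm_ub.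
Qed.

Lemma weighted_norm_leZ nu (a : R[i]) f :
  (weighted_norm nu (a *: f)%R <= (rnorm a)%:E * weighted_norm nu f)%E.
Proof.
apply: ge_ereal_sup => _ [z Dz <-].
rewrite [X in rnorm X](_ : _ = a *: f z)// rnormZ mulrCA EFinM.
by rewrite lee_wpmul2l ?lee_fin ?rnorm_ge0// weighted_norm_ub.
Qed.

Lemma weighted_normZ nu (a : R[i]) f :
  weighted_norm nu (a *: f) = ((rnorm a)%:E * weighted_norm nu f)%E.
Proof.
have [->|a0] := eqVneq a 0.
  apply/eqP; rewrite eq_le weighted_norm_leZ/= [rnorm 0](_ : _ = 0).
    by rewrite mul0e weighted_norm_ge0.
  by rewrite /rnorm normr0.
have ra : rnorm a != 0 by apply: contra a0 => /eqP/rnorm_eq0 ->.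
apply/eqP; rewrite eq_le weighted_norm_leZ/=.
have := weighted_norm_leZ nu a^-1 (a *: f).
rewrite scalerA mulVf// scale1r => h.
have {}h := lee_wpmul2l (_ : (0 <= (rnorm a)%:E)%E) h.
apply: le_trans (h _) _; first by rewrite lee_fin rnorm_ge0.
rewrite muleA -EFinM -rnormZ.
rewrite [_ *: _](_ : _ = 1); first by rewrite /rnorm normr1 mul1e.
exact: mulfV.
Qed.

Lemma weighted_norm_eq0 nu f : holomorphic f -> weighted_norm nu f = 0%E -> f = 0.
Proof.
move=> [_ f0] nf0; apply/funext => z.
have [Dz|/f0//] := pselect (disk z).
apply: rnorm_eq0; apply/eqP; rewrite eq_le rnorm_ge0 andbT.
have := weighted_norm_ub nu f Dz; rewrite nf0 lee_fin.
by rewrite pmulr_rle0// weight_gt0.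
Qed.

Lemma fin_weighted_norm nu f :
  (weighted_norm nu f < +oo)%E -> weighted_norm nu f \is a fin_num.
Proof. by move=> h; rewrite ge0_fin_numE// weighted_norm_ge0. Qed.

Lemma rnorm_continuous (V : normedModType R[i]) : continuous (@rnorm R V).
Proof.
move=> x; apply/cvgrPdist_lt => e e0.
have e0' : 0 < e%:C by rewrite ltcR.
have /cvgrPdist_lt/(_ _ e0') : (fun y : V => y) @ x --> x by exact: cvg_id.
apply: filterS => y; rewrite normE ltcR; apply: le_lt_trans.
have N (u : V) : rnorm (- u) = rnorm u by rewrite /rnorm normrN.
rewrite ler_norml lerNl opprB !lerBlDr -{1}(N (x - y)) opprB.
by rewrite -{1}(subrK x y) rnormD/= -{1}(subrK y x) rnormD.
Qed.

Lemma mkC_continuous : continuous (fun p : R * R => p.1 +i* p.2).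
Proof.
move=> [a b]; apply/cvgrPdist_lt => e; rewrite ltcE/= => /andP[/eqP ei er].
have e2 : 0 < complex.Re e / 2 by rewrite divr_gt0.
near=> p.
have h1 : `|a - p.1| < complex.Re e / 2.
  near: p.
  have /cvgrPdist_lt/(_ _ e2) : p.1 @[p --> (a, b)] --> a by exact: cvg_fst.
  exact.
have h2 : `|b - p.2| < complex.Re e / 2.
  near: p.
  have /cvgrPdist_lt/(_ _ e2) : p.2 @[p --> (a, b)] --> b by exact: cvg_snd.
  exact.
rewrite normE ltcE/= -ei eqxx/=.
rewrite [X in rnorm X](_ : _ = (a - p.1)%:C + (b - p.2)%:C * 'i%C); last first.
  by apply/eqP; rewrite eq_complex/= !(mulr0, mul0r, subr0, addr0, mulr1, add0r) !eqxx.
rewrite (le_lt_trans (rnormD _ _))//.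
rewrite -[X in rnorm X + _]mulr1 -[X in rnorm X + _]/(_ *: _) -[X in _ + rnorm X]/(_ *: _) !rnormZ.
have rC (x : R) : rnorm x%:C = `|x|.
  by rewrite /rnorm normc_def/= expr0n addr0 sqrtr_sqr.
have ri : rnorm ('i%C : R[i]) = 1.
  by rewrite /rnorm normc_def/= expr0n add0r expr1n sqrtr1.
rewrite !rC ri normr1 !mulr1 (splitr (complex.Re e)).
exact: ltrD.
Unshelve. all: by end_near. Qed.

Lemma holomorphic_bounded f (r : R) : holomorphic f -> 0 <= r -> r < 1 ->
  exists M, forall z, rnorm z <= r -> rnorm (f z) <= M.
Proof.
move=> [df _] r0 r1.
pose mk (p : R * R) := p.1 +i* p.2.
pose A := (`[- r, r] `*` `[- r, r]) `&` [set p : R * R | rnorm (mk p) <= r].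
have cA : compact A.
  apply: compact_closedI; first by apply: compact_setX; exact: segment_compact.
  apply: (@closed_comp _ _ (@rnorm R R[i] \o mk) [set x | x <= r]).
    move=> p _; apply: continuous_comp; first exact: mkC_continuous.
    exact: rnorm_continuous.
  exact: closed_le.
have A0 : A !=set0.
  exists (0, 0); split; first by split; rewrite /= in_itv/= oppr_le0 r0.
  by rewrite /= /mk/= (_ : 0 +i* 0 = 0)// /rnorm normr0.
have [|c _ cP] := compact_EVT_max (f := fun p => rnorm (f (mk p))) A0 cA.
  apply: continuous_in_subspaceT => p /[1!inE] -[_ /= pr].
  apply: (@continuous_comp _ _ _ mk (fun z => rnorm (f z))).
    exact: mkC_continuous.
  apply: (@continuous_comp _ _ _ f (@rnorm R R[i])); last exact: rnorm_continuous.
  apply: differentiable_continuous; apply/derivable1_diffP; apply: df.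
  by apply/disk_rnorm; exact: le_lt_trans r1.
exists (rnorm (f (mk c))) => -[a b] abr.
apply: (cP (a, b)); rewrite inE; split=> //; split; rewrite /= in_itv/= -ler_norml.
  by rewrite (le_trans _ abr)// /rnorm normc_def/= -[leLHS]sqrtr_sqr ler_wsqrtr// lerDl sqr_ge0.
by rewrite (le_trans _ abr)// /rnorm normc_def/= -[leLHS]sqrtr_sqr ler_wsqrtr// lerDr sqr_ge0.
Qed.

Lemma H0_sub_Hinf nu : H0_set nu `<=` Hinf_set nu.
Proof.
move=> f [hf /(_ 1 ltr01)[r r1 fr]]; split=> //.
have [M fM] : exists M, forall z, rnorm z <= Num.max 0 r -> rnorm (f z) <= M.
  by apply: holomorphic_bounded => //; rewrite ?le_max ?lexx// gt_max ltr01.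
apply: (@le_lt_trans _ _ (Num.max 1 (nu 0 * M))%:E); last exact: ltry.
apply: ge_ereal_sup => _ [z Dz <-]; rewrite lee_fin le_max.
have nuz : 0 < nu z by exact: weight_gt0.
have [zr|rz] := leP (rnorm z) (Num.max 0 r).
  apply/orP; right; apply: ler_pM; [exact: ltW|exact: rnorm_ge0| |exact: fM].
  by apply: weight_ninc; rewrite ?normr0//; exact: disk0.
apply/orP; left; rewrite (le_trans (ler_norm _))// ltW//; apply: fr.
by move: rz; rewrite gt_max => /andP[_ ->]/=; exact/disk_rnorm.
Qed.

Lemma Hinf_submod nu : submod_closed (Hinf_pred nu).
Proof.
split; first rewrite inE; first split; first exact: holomorphic0.
  by rewrite -(scale0r (0 : R[i] -> R[i])) weighted_normZ /rnorm normr0 mul0e.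
move=> a f g; rewrite !inE => -[hf nf] [hg ng]; split.
  exact: holomorphicZD.
apply: le_lt_trans (weighted_normD _ _ _) _; rewrite lte_add_pinfty//.
by rewrite weighted_normZ lte_mul_pinfty// ?lee_fin ?rnorm_ge0.
Qed.

Lemma H0_submod nu : submod_closed (H0_pred nu).
Proof.
split; first rewrite inE; first split; first exact: holomorphic0.
  move=> e e0; exists 0 => // z _.
  by rewrite [X in rnorm X](_ : _ = 0)// /rnorm normr0 mulr0 normr0.
move=> a f g; rewrite !inE => -[hf vf] [hg vg]; split.
  exact: holomorphicZD.
move=> e e0.
have a1 : 0 < rnorm a + 1 by rewrite ltr_wpDl ?rnorm_ge0.
have [r r1 fr] := vf _ (divr_gt0 (divr_gt0 e0 (ltr0n _ 2)) a1).
have [s s1 gs] := vg _ (divr_gt0 e0 (ltr0n _ 2)).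
exists (Num.max r s); first by rewrite gt_max r1.
move=> z; rewrite gt_max => /andP[/andP[rz sz] z1].
have nuz : 0 < nu z by apply: weight_gt0; apply/disk_rnorm.
have := fr z; rewrite rz z1 => /(_ isT).
have := gs z; rewrite sz z1 => /(_ isT).
rewrite !ger0_norm ?mulr_ge0 ?rnorm_ge0 ?ltW// => gz fz.
rewrite (splitr e) (@le_lt_trans _ _
  (rnorm a * (nu z * rnorm (f z)) + nu z * rnorm (g z)))//.
  by rewrite mulrCA -rnormZ -mulrDr; apply: ler_wpM2l; [exact: ltW|exact: rnormD].
rewrite ler_ltD// (@le_trans _ _ ((rnorm a + 1) * (nu z * rnorm (f z))))//.
  by apply: ler_wpM2r; rewrite ?lerDl// mulr_ge0 ?rnorm_ge0// ltW.
by rewrite mulrC -ler_pdivlMr// ltW.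
Qed.

End lemmas.

HB.instance Definition _ (R : realType) (nu : radial_weight R) :=
  GRing.isSubmodClosed.Build _ _ (Hinf_pred nu) (Hinf_submod nu).
HB.instance Definition _ (R : realType) (nu : radial_weight R) :=
  GRing.isSubmodClosed.Build _ _ (H0_pred nu) (H0_submod nu).

Section spaces.
Context {R : realType} (nu : radial_weight R).

(* [Hinf] and [H0] are the spaces H^infty_nu and H^0_nu over R[i], both normed by
   [weighted_norm], which is finite on the latter by [H0_sub_Hinf]. *)
Record Hinf := MkHinf { Hinf_val :> R[i] -> R[i] ; _ : Hinf_val \in Hinf_pred nu }.

HB.instance Definition _ := [isSub for Hinf_val].
HB.instance Definition _ := [Choice of Hinf by <:].
HB.instance Definition _ := [SubChoice_isSubLmodule of Hinf by <:].

Record H0 := MkH0 { H0_val :> R[i] -> R[i] ; _ : H0_val \in H0_pred nu }.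

HB.instance Definition _ := [isSub for H0_val].
HB.instance Definition _ := [Choice of H0 by <:].
HB.instance Definition _ := [SubChoice_isSubLmodule of H0 by <:].

Lemma HinfP (f : Hinf) : Hinf_set nu f.
Proof. by case: f => f /= /[1!inE]. Qed.

Lemma H0P (f : H0) : H0_set nu f.
Proof. by case: f => f /= /[1!inE]. Qed.

Definition Hinf_norm (f : Hinf) : R[i] := (fine (weighted_norm nu f))%:C.
Definition H0_norm (f : H0) : R[i] := (fine (weighted_norm nu f))%:C.

Lemma fine_weighted_normD f g : Hinf_set nu f -> Hinf_set nu g ->
  (fine (weighted_norm nu (f + g)))%:C <=
  (fine (weighted_norm nu f))%:C + (fine (weighted_norm nu g))%:C.
Proof.
move=> [_ /fin_weighted_norm nf] [_ /fin_weighted_norm ng].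
rewrite -rmorphD lecR -fineD// fine_le ?fin_numD ?nf ?ng//; last first.
  exact: weighted_normD.
rewrite fin_weighted_norm// (le_lt_trans (weighted_normD _ _ _))//.
by rewrite ltey_eq fin_numD nf ng.
Qed.

Lemma fine_weighted_normZ (a : R[i]) f : Hinf_set nu f ->
  (fine (weighted_norm nu (a *: f)))%:C =
  `|a| * (fine (weighted_norm nu f))%:C.
Proof.
move=> [_ /fin_weighted_norm nf].
by rewrite weighted_normZ fineM// rmorphM/= -normE.
Qed.

Lemma fine_weighted_norm_eq0 f : Hinf_set nu f ->
  (fine (weighted_norm nu f))%:C = 0 -> f = 0.
Proof.
move=> [hf /fin_weighted_norm nf] /complexI nf0.
by apply: (@weighted_norm_eq0 _ nu) => //; rewrite -(fineK nf) nf0.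
Qed.

Lemma Hinf_normD f g : Hinf_norm (f + g) <= Hinf_norm f + Hinf_norm g.
Proof. by apply: fine_weighted_normD; exact: HinfP. Qed.

Lemma Hinf_normZ (a : R[i]) f : Hinf_norm (a *: f) = `|a| * Hinf_norm f.
Proof. by apply: fine_weighted_normZ; exact: HinfP. Qed.

Lemma Hinf_norm_eq0 f : Hinf_norm f = 0 -> f = 0.
Proof.
by move=> /(fine_weighted_norm_eq0 (HinfP f)) f0; exact: val_inj.
Qed.

HB.instance Definition _ :=
  Lmodule_isNormed.Build R[i] Hinf Hinf_normD Hinf_normZ Hinf_norm_eq0.

Lemma H0_normD f g : H0_norm (f + g) <= H0_norm f + H0_norm g.
Proof. by apply: fine_weighted_normD; apply: H0_sub_Hinf; exact: H0P. Qed.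

Lemma H0_normZ (a : R[i]) f : H0_norm (a *: f) = `|a| * H0_norm f.
Proof. by apply: fine_weighted_normZ; apply: H0_sub_Hinf; exact: H0P. Qed.

Lemma H0_norm_eq0 f : H0_norm f = 0 -> f = 0.
Proof.
move=> /(fine_weighted_norm_eq0 (H0_sub_Hinf (H0P f))) f0; exact: val_inj.
Qed.

HB.instance Definition _ :=
  Lmodule_isNormed.Build R[i] H0 H0_normD H0_normZ H0_norm_eq0.

End spaces.

Section nuclear_operators.
Context {R : realType}.
Implicit Types X Y : normedModType R[i].

Definition dual_norm X (x' : X -> R[i]) : \bar R :=
  ereal_sup [set (rnorm (x' x))%:E | x in [set x | rnorm x <= 1]].

Definition bounded_operator X Y (T : X -> Y) :=
  exists M : R, forall x, rnorm (T x) <= M * rnorm x.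

Definition nuclear X Y (T : X -> Y) :=
  exists (x' : nat -> {linear X -> R[i]}) (y : nat -> Y), [/\
    forall k, continuous (x' k),
    (\sum_(0 <= k <oo) dual_norm (x' k) * (rnorm (y k))%:E < +oo)%E &
    forall x, series (fun k => x' k x *: y k) @ \oo --> T x].

End nuclear_operators.

(* An operator S on functions on the disk, viewed as an operator X -> Y between
   function spaces X and Y embedded by iX and iY in the functions; in
   particular S maps X into Y. *)
Section between.
Context {R : realType} {X Y : normedModType R[i]}.
Variables (iX : X -> R[i] -> R[i]) (iY : Y -> R[i] -> R[i]).
Variable S : (R[i] -> R[i]) -> R[i] -> R[i].

Definition bounded_between :=
  exists2 T : {linear X -> Y}, (forall f, iY (T f) = S (iX f)) &
    bounded_operator T.

Definition nuclear_between :=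
  exists2 T : {linear X -> Y}, (forall f, iY (T f) = S (iX f)) & nuclear T.

End between.

(* Main.v *)
Require Import Defs.
From HB Require Import structures.
From mathcomp Require Import all_boot all_order all_algebra complex.
From mathcomp Require Import all_classical all_reals all_analysis.
From mathcomp Require Import measurable_realfun ring lra.

Set Implicit Arguments.
Unset Strict Implicit.
Unset Printing Implicit Defensive.

Import Order.TTheory GRing.Theory Num.Theory.
Import numFieldNormedType.Exports.

Local Open Scope classical_set_scope.
Local Open Scope ring_scope.
Local Open Scope complex_scope.

(** Write k_zeta(w) = (1 - conj(zeta) w)^-(N+2) for a large integer N and D for the density
    (1 - |z|^2) mu(z) |g'(z)|. Since (T f)' = (f o phi) g' and mu is normal, the norm of T f in
    H^infty_mu is comparable to the supremum of D(z) |f(phi(z))|. Everything is read off the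
    reproducing formula c_N f(w) = int f(zeta) (1 - |zeta|^2)^N (1 - conj(zeta) w)^-(N+2), after
    partitioning the disk into countably many hyperbolically small cells with centers a_i and
    masses m_i = int_(cell i) (1 - |zeta|^2)^N / nu(zeta). Condition (e) amounts to the finiteness
    of sum_i m_i b_i with b_i = sup_z D(z) |k_(a_i)(phi(z))|; a cell average and the Forelli-Rudin
    estimate allow the real exponent alpha to be replaced by the integer N.

    If T is nuclear on H^0_nu, then it maps the sequence m_i k_(a_i), which is weakly summable by
    the Forelli-Rudin estimate, to an absolutely summable one, that is, sum_i m_i b_i < oo.
    Conversely, expanding the kernel on each cell into a power series in conj(zeta - a_i) gives
    f = sum_(i, m) x'_(i, m)(f) w^m (1 - conj(a_i) w)^-(N+2+m), where the cells are so small that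
    the coefficients decay geometrically in m. Applying T term by term yields a nuclear
    representation of T with values in H^0_mu, because every kernel function is bounded and g is in
    the little Bloch-type space. The remaining implications compose with H^0 -> H^infty. *)

(** * Complex-valued calculus *)

(** The integer exponent makes every kernel a rational function, so no branch of a complex power
    occurs: [alpha] only appears as an exponent of moduli. No contour integration is involved
    either. The integrand of the reproducing formula, after subtraction of the value at [w], is the
    [conj z]-derivative of a function that extends by 0 beyond the unit circle; Green's formula on
    one large square, proved by bisection, makes its integral vanish. The Cauchy estimates are then
    read off the case [N = 1]. Analyticity of [T_op g phi f] is not derived from the segment
    integral: boundedness of the operator places the image in H^infty_mu, and only then is the
    derivative identified along rays. The obstacle in (e) is the supremum over [z] under the
    integral sign. The numbers b_i, one supremum for each cell, remove it, because kernels with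
    parameters in one cell are comparable uniformly in [z]. The step from (a) to these numbers is
    the fact that nuclear operators are absolutely summing. *)

Lemma rnormM (R : realType) (a b : R[i]) : rnorm (a * b) = rnorm a * rnorm b.
Proof. exact: (@rnormZ R R[i] a b). Qed.

Lemma rnorm_real (R : realType) (x : R) : rnorm x%:C = `|x|.
Proof. by rewrite /rnorm normc_def/= expr0n addr0 sqrtr_sqr. Qed.

Lemma rnorm1 (R : realType) : rnorm (1 : R[i]) = 1.
Proof. by rewrite (rnorm_real 1) normr1. Qed.

Lemma rnorm0 (R : realType) (V : normedModType R[i]) : rnorm (0 : V) = 0.
Proof. by rewrite /rnorm normr0. Qed.

Lemma rnormN (R : realType) (V : normedModType R[i]) (x : V) : rnorm (- x) = rnorm x.
Proof. by rewrite /rnorm normrN. Qed.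

Lemma rnormBC (R : realType) (V : normedModType R[i]) (x y : V) :
  rnorm (x - y) = rnorm (y - x).
Proof. by rewrite -rnormN opprB. Qed.

Lemma rnormB (R : realType) (V : normedModType R[i]) (x y : V) :
  rnorm (x - y) <= rnorm x + rnorm y.
Proof. by rewrite -(rnormN y) rnormD. Qed.

Lemma rnorm_sub (R : realType) (V : normedModType R[i]) (x y : V) :
  rnorm x - rnorm y <= rnorm (x - y).
Proof. by rewrite lerBlDr -{1}(subrK y x) rnormD. Qed.

Lemma rnormX (R : realType) (a : R[i]) n : rnorm (a ^+ n) = rnorm a ^+ n.
Proof. by elim: n => [|n ih]; rewrite ?expr0 ?rnorm1// !exprS rnormM ih. Qed.

Lemma rnorm_eq0P (R : realType) (V : normedModType R[i]) (x : V) :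
  (rnorm x == 0) = (x == 0).
Proof. by apply/eqP/eqP => [/rnorm_eq0//|->]; rewrite rnorm0. Qed.

Lemma rnorm_gt0 (R : realType) (V : normedModType R[i]) (x : V) :
  (0 < rnorm x) = (x != 0).
Proof. by rewrite lt_def rnorm_eq0P rnorm_ge0 andbT. Qed.

Lemma rnormV (R : realType) (a : R[i]) : rnorm a^-1 = (rnorm a)^-1.
Proof.
have [->|a0] := eqVneq a 0; first by rewrite invr0 rnorm0 invr0.
apply: (mulIf (_ : rnorm a != 0)); first by rewrite rnorm_eq0P.
by rewrite -rnormM !mulVf ?rnorm_eq0P// rnorm1.
Qed.

Lemma rnorm_conj (R : realType) (a : R[i]) : rnorm (conjc a) = rnorm a.
Proof. by rewrite /rnorm normcJ. Qed.

Lemma rnorm_sqr (R : realType) (z : R[i]) :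
  rnorm z ^+ 2 = complex.Re z ^+ 2 + complex.Im z ^+ 2.
Proof. by rewrite /rnorm normc_def/= sqr_sqrtr// addr_ge0 ?sqr_ge0. Qed.

Lemma Re_le_rnorm (R : realType) (z : R[i]) : `|complex.Re z| <= rnorm z.
Proof.
rewrite -(ler_pXn2r (_ : 0 < 2)%N)// ?nnegrE ?rnorm_ge0//.
by rewrite rnorm_sqr real_normK ?num_real// lerDl sqr_ge0.
Qed.

Lemma Im_le_rnorm (R : realType) (z : R[i]) : `|complex.Im z| <= rnorm z.
Proof.
rewrite -(ler_pXn2r (_ : 0 < 2)%N)// ?nnegrE ?rnorm_ge0//.
by rewrite rnorm_sqr real_normK ?num_real// lerDr sqr_ge0.
Qed.

Lemma rnorm_le_ReIm (R : realType) (z : R[i]) :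
  rnorm z <= `|complex.Re z| + `|complex.Im z|.
Proof.
rewrite -(ler_pXn2r (_ : 0 < 2)%N)// ?nnegrE ?rnorm_ge0// ?addr_ge0//.
rewrite rnorm_sqr sqrrD !real_normK ?num_real// -addrA lerD2l lerDr.
by rewrite mulrn_wge0// mulr_ge0.
Qed.

Lemma rnorm_conjM (R : realType) (z : R[i]) : conjc z * z = (rnorm z ^+ 2)%:C.
Proof.
by rewrite mulrC -sqr_normc normE -rmorphXn.
Qed.

Lemma conjcB (R : realType) (x y : R[i]) : conjc (x - y) = conjc x - conjc y.
Proof. by case: x y => [a b] [c d]; apply/eqP; rewrite eq_complex/= opprD !eqxx. Qed.

Lemma conjcM (R : realType) (x y : R[i]) : conjc (x * y) = conjc x * conjc y.
Proof. exact: rmorphM. Qed.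

Lemma diskE (R : realType) (z : R[i]) : disk z = (rnorm z < 1).
Proof. by apply/propext; exact: disk_rnorm. Qed.

(** * Wirtinger derivatives *)

Section wirtinger.
Context {R : realType}.
Implicit Types (f g u v : R[i] -> R[i]) (z w a b : R[i]).

(* Real differentiability of u at z, with d u / d z = a and d u / d (conj z) = b. *)
Definition wdiff u z a b := forall e : R, 0 < e -> exists2 d : R, 0 < d &
  forall w, rnorm (w - z) < d ->
    rnorm (u w - u z - a * (w - z) - b * conjc (w - z)) <= e * rnorm (w - z).

Definition ccont u z := forall e : R, 0 < e -> exists2 d : R, 0 < d &
  forall w, rnorm (w - z) < d -> rnorm (u w - u z) < e.

(** A positive radius in [R[i]] is real by the definition of the order, so neighbourhoods can be
    tested with real radii. *)
Lemma nbhs_rnormP (z : R[i]) (P : set R[i]) :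
  nbhs z P <-> exists2 d : R, 0 < d & forall w, rnorm (w - z) < d -> P w.
Proof.
split.
  move/nbhs_ballP => [e /= e0 he].
  have er : e = (complex.Re e)%:C by rewrite RRe_real// realE ltW.
  exists (complex.Re e); first by rewrite -ltcR -er.
  move=> w wz; apply: he; rewrite -ball_normE/= distrC er normE ltcR.
  exact: wz.
move=> [d d0 hd]; apply/nbhs_ballP; exists d%:C; first by rewrite /= ltcR.
move=> w; rewrite -ball_normE/= distrC normE ltcR => /hd; exact.
Qed.

Lemma wdiff_cont u z a b : wdiff u z a b -> ccont u z.
Proof.
move=> du e e0; have [d d0 hd] := du _ ltr01.
pose K := 1 + rnorm a + rnorm b.
have K0 : 0 < K by rewrite /K -addrA ltr_wpDr// addr_ge0// rnorm_ge0.
exists (Num.min d (e / K)); first by rewrite lt_min d0 divr_gt0.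
move=> w; rewrite lt_min => /andP[/hd wd]; rewrite ltr_pdivlMr// => we.
apply: le_lt_trans we; rewrite mulrC /K -addrA mulrDl.
rewrite -[X in rnorm X <= _](subrK (a * (w - z) + b * conjc (w - z))).
rewrite (le_trans (rnormD _ _))// lerD//; first by rewrite opprD addrA.
by rewrite (le_trans (rnormD _ _))// !rnormM rnorm_conj mulrDl.
Qed.

Lemma derivable_wdiff f z : derivable f z 1 -> wdiff f z (derive1 f z) 0.
Proof.
move=> df e e0.
have : h^-1 *: ((f \o shift z) h%:A - f z) @[h --> 0^'] --> derive1 f z.
  by rewrite derive1E; exact: df.
move=> /(_ [set y | rnorm (y - derive1 f z) < e]) [|d d0 hd].
  by apply/nbhs_rnormP; exists e.
have /nbhs_rnormP[d' d'0 hd'] : nbhs (0 : R[i]) (ball_ Num.norm 0 d).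
  by apply/nbhs_ballP; exists d => //; rewrite -ball_normE.
exists d' => // w wz; rewrite mul0r subr0.
have [->|nwz] := eqVneq w z; first by rewrite !subrr mulr0 subr0 rnorm0 mulr0.
have wz0 : w - z != 0 by rewrite subr_eq0.
have := hd (w - z) (hd' _ _); rewrite subr0 => /(_ wz wz0) /=.
rewrite [_%:A]mulr1 subrK => h.
rewrite -ler_pdivrMr ?rnorm_gt0// mulrC -rnormV -rnormM mulrBr.
by rewrite mulrCA mulVf// mulr1 ltW.
Qed.

(** A vanishing [conj z]-derivative is the Cauchy-Riemann equation: the linear part is complex
    linear, and dividing by [h] gives a limit independent of the direction. *)
Lemma wdiff_derivable f z a : wdiff f z a 0 -> is_derive z 1 f a.
Proof.
move=> df.
have cf : h^-1 *: ((f \o shift z) h%:A - f z) @[h --> 0^'] --> a.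
  move=> A /nbhs_rnormP[e e0 eA].
  have [d d0 hd] := df _ (divr_gt0 e0 (ltr0n _ 2)).
  have : nbhs (0 : R[i]) [set h | h != 0 -> A (h^-1 *: ((f \o shift z) h%:A - f z))].
    apply/nbhs_rnormP; exists d => // h; rewrite subr0 => hd0 h0.
    apply: eA; rewrite /= [h%:A]mulr1.
    have := hd (h + z); rewrite addrK mul0r subr0 => /(_ hd0).
    rewrite -ler_pdivrMr ?rnorm_gt0// mulrC -rnormV -rnormM mulrBr.
    rewrite mulrCA mulVf// mulr1 => /le_lt_trans; apply.
    by rewrite ltr_pdivrMr// ltr_pMr// ltr1n.
  by [].
apply: DeriveDef; first by apply/cvg_ex; exists a.
by apply/cvg_lim => //; exact: norm_hausdorff.
Qed.

Lemma wdiff_eq u z a b a' b' : wdiff u z a b -> a = a' -> b = b' -> wdiff u z a' b'.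
Proof. by move=> + <- <-. Qed.

Lemma wdiff_near u v z a b : (exists2 d : R, 0 < d &
    forall w, rnorm (w - z) < d -> u w = v w) ->
  wdiff u z a b -> wdiff v z a b.
Proof.
move=> [d d0 uv] du e /du[d' d'0 h]; exists (Num.min d d'); first by rewrite lt_min d0.
by move=> w; rewrite lt_min => /andP[wd wd']; rewrite -!uv ?h// subrr rnorm0.
Qed.

Lemma wdiff_cst z b : wdiff (fun=> b) z 0 0.
Proof.
move=> e e0; exists 1 => // w _.
by rewrite subrr !mul0r !subr0 rnorm0 mulr_ge0 ?rnorm_ge0// ltW.
Qed.

Lemma wdiff_id z : wdiff id z 1 0.
Proof.
move=> e e0; exists 1 => // w _.
by rewrite mul1r mul0r subr0 subrr rnorm0 mulr_ge0 ?rnorm_ge0// ltW.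
Qed.

Lemma wdiff_conj u z a b : wdiff u z a b -> wdiff (fun w => conjc (u w)) z (conjc b) (conjc a).
Proof.
move=> du e /du[d d0 h]; exists d => // w /h; apply: le_trans.
rewrite [X in rnorm X <= _](_ : _ = conjc (u w - u z - a * (w - z) - b * conjc (w - z))).
  by rewrite rnorm_conj.
rewrite (conjcB _ (b * _)) (conjcB _ (a * _)) (conjcB (u w)).
by rewrite (conjcM b) conjcK (conjcM a) addrAC.
Qed.

Lemma wdiffB u v z a b a' b' : wdiff u z a b -> wdiff v z a' b' ->
  wdiff (fun w => u w - v w) z (a - a') (b - b').
Proof.
move=> du dv e e0.
have [d d0 hu] := du _ (divr_gt0 e0 (ltr0n _ 2)).
have [d' d'0 hv] := dv _ (divr_gt0 e0 (ltr0n _ 2)).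
exists (Num.min d d'); first by rewrite lt_min d0.
move=> w; rewrite lt_min => /andP[/hu {}hu /hv {}hv].
rewrite [X in rnorm X](_ : _ = (u w - u z - a * (w - z) - b * conjc (w - z)) -
  (v w - v z - a' * (w - z) - b' * conjc (w - z))); last by ring.
by rewrite (le_trans (rnormB _ _))// (splitr e) mulrDl lerD.
Qed.

Lemma wdiffM u v z a b a' b' : wdiff u z a b -> wdiff v z a' b' ->
  wdiff (fun w => u w * v w) z (a * v z + u z * a') (b * v z + u z * b').
Proof.
move=> du dv e e0.
pose K := 1 + rnorm (v z) + rnorm (u z) + (rnorm a + rnorm b).
have K1 : 1 <= K by rewrite /K -!addrA lerDl !addr_ge0// rnorm_ge0.
have K0 : 0 < K by rewrite (lt_le_trans ltr01).
have eK := divr_gt0 e0 K0.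
have [d1 d10 h1] := du _ eK; have [d2 d20 h2] := dv _ eK.
have [d3 d30 h3] := wdiff_cont dv eK; have [d4 d40 h4] := wdiff_cont dv ltr01.
exists (Num.min (Num.min d1 d2) (Num.min d3 d4)).
  by rewrite !lt_min d10 d20 d30.
move=> w; rewrite !lt_min => /andP[/andP[/h1 {}h1 /h2 {}h2] /andP[/h3 {}h3 /h4 {}h4]].
set h := w - z in h1 h2 *.
(* The errors of [u] and of [v] enter linearly; the third summand is a product of increments, small
   because [v] is continuous at [z]. *)
rewrite [X in rnorm X](_ : _ = (u w - u z - a * h - b * conjc h) * v w +
  u z * (v w - v z - a' * h - b' * conjc h) +
  (a * h + b * conjc h) * (v w - v z)); last by ring.
have h5 : rnorm (v w) <= 1 + rnorm (v z).
  by rewrite -lerBlDr (le_trans (rnorm_sub _ _))// ltW.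
have h6 : rnorm (a * h + b * conjc h) <= (rnorm a + rnorm b) * rnorm h.
  by rewrite (le_trans (rnormD _ _))// !rnormM rnorm_conj mulrDl.
have -> : e * rnorm h = e / K * rnorm h * (1 + rnorm (v z)) +
  rnorm (u z) * (e / K * rnorm h) + (rnorm a + rnorm b) * rnorm h * (e / K).
  rewrite [LHS](_ : _ = e / K * rnorm h * K); last by field; rewrite gt_eqF.
  by rewrite /K; ring.
rewrite (le_trans (rnormD _ _))// lerD//; last first.
  by rewrite rnormM ler_pM ?rnorm_ge0// ltW.
rewrite (le_trans (rnormD _ _))// lerD//; rewrite rnormM ler_pM ?rnorm_ge0//.
Qed.

Lemma wdiffV u z a b : u z != 0 -> wdiff u z a b ->
  wdiff (fun w => (u w)^-1) z (- a / u z ^+ 2) (- b / u z ^+ 2).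
Proof.
move=> u0 du e e0.
have c0 : 0 < rnorm (u z) by rewrite rnorm_gt0.
set c := rnorm (u z) in c0.
pose K := 1 + rnorm a + rnorm b.
have K0 : 0 < K by rewrite /K -addrA ltr_wpDr// addr_ge0// rnorm_ge0.
have e10 : 0 < e * c ^+ 2 / 2 by rewrite divr_gt0// mulr_gt0// exprn_gt0.
have e20 : 0 < e * c ^+ 3 / (4 * K) by rewrite divr_gt0// mulr_gt0// exprn_gt0.
have [d1 d10 h1] := du _ e10; have [d2 d20 h2] := wdiff_cont du e20.
have [d3 d30 h3] := wdiff_cont du (divr_gt0 c0 (ltr0n _ 2)).
have [d4 d40 h4] := du _ ltr01.
exists (Num.min (Num.min d1 d2) (Num.min d3 d4)).
  by rewrite !lt_min d10 d20 d30.
move=> w; rewrite !lt_min => /andP[/andP[/h1 {}h1 /h2 {}h2] /andP[/h3 {}h3 /h4 {}h4]].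
set h := w - z in h1 h4 *.
have uw : c / 2 < rnorm (u w).
  have := le_lt_trans (rnorm_sub (u z) (u w)).
  rewrite rnormBC => /(_ _ h3); rewrite -/c; lra.
have uw0 : u w != 0 by rewrite -rnorm_gt0 (lt_trans _ uw)// divr_gt0.
(* The first summand carries the first-order error of [u]. The second is quadratic in [u w - u z]:
   one factor is at most [K * rnorm h], the other is arbitrarily small. *)
rewrite [X in rnorm X](_ : _ = - (u w - u z - a * h - b * conjc h) * (u z ^+ 2)^-1 +
  (u w - u z) * (u w - u z) * ((u z ^+ 2) * u w)^-1); last first.
  by field; rewrite ?u0 ?uw0.
have h5 : rnorm (u w - u z) <= K * rnorm h.
  rewrite [X in rnorm X <= _](_ : _ = (u w - u z - a * h - b * conjc h) +
    (a * h + b * conjc h)); last by ring.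
  rewrite /K -(addrA 1) mulrDl (le_trans (rnormD _ _))// lerD//.
  by rewrite (le_trans (rnormD _ _))// !rnormM rnorm_conj mulrDl.
rewrite (le_trans (rnormD _ _))// (splitr e) [leRHS]mulrDl lerD//.
  rewrite rnormM rnormN rnormV rnormX -/c ler_pdivrMr ?exprn_gt0//.
  by rewrite (le_trans h1)// le_eqVlt; apply/orP; left; apply/eqP; ring.
rewrite !rnormM rnormV rnormM rnormX -/c.
have q0 : 0 < c ^+ 2 * rnorm (u w) by rewrite mulr_gt0 ?exprn_gt0// rnorm_gt0.
rewrite ler_pdivrMr//.
apply: (@le_trans _ _ (K * rnorm h * (e * c ^+ 3 / (4 * K)))).
  by rewrite ler_pM ?rnorm_ge0// ltW.
rewrite [leLHS](_ : _ = e / 2 * rnorm h * (c ^+ 2 * (c / 2))); last first.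
  by field; rewrite gt_eqF.
rewrite ler_wpM2l ?mulr_ge0 ?rnorm_ge0 ?ler_wpM2l ?sqr_ge0 ?(ltW uw)//.
exact: ltW.
Qed.

Lemma wdiffX u z a b n : wdiff u z a b ->
  wdiff (fun w => u w ^+ n) z (n%:R * u z ^+ n.-1 * a) (n%:R * u z ^+ n.-1 * b).
Proof.
move=> du; elim: n => [|n ih].
  by rewrite !mul0r; apply: wdiff_near (wdiff_cst z 1); exists 1.
have h := wdiffM du ih.
apply: (@wdiff_near (fun w => u w * u w ^+ n)).
  by exists 1 => // w _; rewrite exprS.
apply: wdiff_eq h _ _; rewrite -natr1/=; case: n {ih} => [|n] /=; rewrite ?expr0 ?exprS -?natr1; ring.
Qed.

End wirtinger.

(** * Green's formula *)

Lemma geometric_half_small (R : realType) (c e : R) : 0 < e -> exists n, c / 2 ^+ n < e.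
Proof.
move=> e0; have h2 : `|2^-1 : R| < 1 by rewrite ger0_norm ?invr_ge0// invf_lt1// ltr1n.
have /cvgrPdist_lt/(_ _ e0)[n _ /(_ n (leqnn n))] := cvg_geometric c h2.
rewrite /geometric/= sub0r normrN exprVn => h; exists n.
by rewrite (le_lt_trans (ler_norm _)).
Qed.

Section bisection.
Context {R : realType}.
Context (Phi : R -> R -> R -> R).
Context (Phi_add : forall x y s, 0 < s -> Phi x y s =
  Phi x y (s / 2) + Phi (x + s / 2) y (s / 2) +
  Phi x (y + s / 2) (s / 2) + Phi (x + s / 2) (y + s / 2) (s / 2)).

(** The squares need only contain the point: the nested squares of the bisection are not centered at
    it. *)
Definition locally_small (p q : R) := forall e : R, 0 < e ->
  exists2 d : R, 0 < d & forall x y s, 0 < s < d ->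
    x <= p <= x + s -> y <= q <= y + s -> `|Phi x y s| <= e * s ^+ 2.

(* The argument of Goursat: halving a square on which [Phi] does not vanish produces nested
   squares on which [Phi] is not small relative to the area. *)
Lemma bisection_eq0 x0 y0 s0 : 0 < s0 ->
  (forall p q, x0 <= p <= x0 + s0 -> y0 <= q <= y0 + s0 -> locally_small p q) ->
  Phi x0 y0 s0 = 0.
Proof.
move=> s0_gt0 small; apply: contrapT => /eqP Phi0.
pose k := `|Phi x0 y0 s0| / s0 ^+ 2.
have k0 : 0 < k by rewrite divr_gt0 ?normr_gt0 ?exprn_gt0.
pose big (t : R * R * R) := k * t.2 ^+ 2 <= `|Phi t.1.1 t.1.2 t.2|.
(* The last quarter is taken without a test: if the other three are not big, additivity of [Phi]
   forces it to be. *)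
pose step (t : R * R * R) : R * R * R :=
  let h := t.2 / 2 in
  if big (t.1.1, t.1.2, h) then (t.1.1, t.1.2, h)
  else if big (t.1.1 + h, t.1.2, h) then (t.1.1 + h, t.1.2, h)
  else if big (t.1.1, t.1.2 + h, h) then (t.1.1, t.1.2 + h, h)
  else (t.1.1 + h, t.1.2 + h, h).
have step_big t : 0 < t.2 -> big t -> big (step t).
  move=> t0 bt; rewrite /step.
  case: ifPn => // b1; case: ifPn => // b2; case: ifPn => // b3.
  apply: contrapT => b4; move: bt; rewrite /big Phi_add//; apply/negP; rewrite -ltNge.
  rewrite /big/= in b1 b2 b3 b4; move/negP in b4.
  move: b1 b2 b3 b4; rewrite -!ltNge => b1 b2 b3 b4.
  apply: (le_lt_trans (ler_normD _ _)).
  apply: (le_lt_trans (lerD (ler_normD _ _) (lexx _))).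
  apply: (le_lt_trans (lerD (lerD (ler_normD _ _) (lexx _)) (lexx _))).
  apply: (lt_le_trans (ltrD (ltrD (ltrD b1 b2) b3) b4)).
  by rewrite le_eqVlt; apply/orP; left; apply/eqP; field.
pose T n := iter n step (x0, y0, s0).
have T2 n : (T n).2 = s0 / 2 ^+ n.
  elim: n => [|n ih]; first by rewrite divr1.
  have -> : (T n.+1).2 = (T n).2 / 2.
    by rewrite /T iterS -/(T n) /step; do 3?case: ifP.
  by rewrite ih exprS invfM mulrA mulrAC.
have Tpos n : 0 < (T n).2 by rewrite T2 divr_gt0// exprn_gt0.
have Tbig n : big (T n).
  elim: n => [|n ih]; first by rewrite /big/= /k divfK// gt_eqF// exprn_gt0.
  by rewrite /T iterS; exact: step_big (Tpos n) ih.
have stepXY t : 0 < t.2 -> [/\ t.1.1 <= (step t).1.1,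
    (step t).1.1 + (step t).2 <= t.1.1 + t.2, t.1.2 <= (step t).1.2 &
    (step t).1.2 + (step t).2 <= t.1.2 + t.2].
  by move=> h; rewrite /step; do 3?case: ifP => _ /=; split; lra.
have stepX n : (T n).1.1 <= (T n.+1).1.1 /\
    (T n.+1).1.1 + (T n.+1).2 <= (T n).1.1 + (T n).2.
  by have [] := stepXY _ (Tpos n).
have stepY n : (T n).1.2 <= (T n.+1).1.2 /\
    (T n.+1).1.2 + (T n.+1).2 <= (T n).1.2 + (T n).2.
  by have [] := stepXY _ (Tpos n).
have nested (f : nat -> R) : (forall n, f n <= f n.+1 /\
    f n.+1 + (T n.+1).2 <= f n + (T n).2) ->
  exists p, forall n, f n <= p <= f n + (T n).2.
  move=> hf.
  have inc m n : f m <= f (m + n)%N.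
    by elim: n => [|n ih]; rewrite ?addn0// addnS (le_trans ih)// (hf _).1.
  have dec m n : f (m + n)%N + (T (m + n)%N).2 <= f m + (T m).2.
    by elim: n => [|n ih]; rewrite ?addn0// addnS (le_trans _ ih)// (hf _).2.
  have ub m : ubound (range f) (f m + (T m).2).
    move=> _ [n _ <-]; have [/subnKC <-|/ltnW/subnKC <-] := leqP m n.
      by rewrite (le_trans _ (dec m (n - m)%N))// lerDl ltW.
    by rewrite (le_trans (inc n (m - n)%N))// lerDl ltW.
  exists (sup (range f)) => n; apply/andP; split.
    by apply: ub_le_sup; [exists (f 0%N + (T 0%N).2); exact: ub|exists n].
  by apply: ge_sup; [exists (f 0%N), 0%N|exact: ub].
have [p pP] := nested (fun n => (T n).1.1) stepX.
have [q qP] := nested (fun n => (T n).1.2) stepY.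
have [d d0 hd] := small p q (pP 0%N) (qP 0%N) (k / 2) (divr_gt0 k0 (ltr0n _ 2)).
have [n] := geometric_half_small s0 d0; rewrite -T2 => nd.
have := hd (T n).1.1 (T n).1.2 (T n).2; rewrite Tpos nd => /(_ isT (pP n) (qP n)).
apply/negP; rewrite -ltNge; apply: lt_le_trans (Tbig n).
by rewrite ltr_pM2r ?exprn_gt0// ltr_pdivrMr// ltr_pMr// ltr1n.
Qed.

(** A single exceptional point is harmless when [Phi] is at most linear in the side. Only the four
    squares with a corner at that point matter, and halving replaces each of them by the half-size
    square at the same corner, where [Phi] is at most [C * s / 2 ^+ n]. *)
Lemma bisection_punctured_eq0 (w1 w2 s C : R) : 0 < s ->
  (forall p q, (p, q) != (w1, w2) -> locally_small p q) ->
  (forall x y t, 0 < t <= s -> `|Phi x y t| <= C * t) ->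
  Phi (w1 - s) (w2 - s) (2 * s) = 0.
Proof.
move=> s_gt0 small bnd.
have zero x y t : 0 < t -> ~ (x <= w1 <= x + t /\ y <= w2 <= y + t) -> Phi x y t = 0.
  move=> t0 nw; apply: bisection_eq0 => // p q px qy; apply: small.
  by apply: contra_notN nw => /eqP[<- <-].
(* [x] and [y], each 0 or 1, tell which corner of the square is the exceptional point; among the
   four quarters only the one at that corner contains it. *)
have corner x y : (x = 0 \/ x = 1) -> (y = 0 \/ y = 1) ->
    Phi (w1 - x * s) (w2 - y * s) s = 0.
  move=> hx hy.
  have half t : 0 < t -> Phi (w1 - x * t) (w2 - y * t) t =
      Phi (w1 - x * (t / 2)) (w2 - y * (t / 2)) (t / 2).
    move=> t0; have h0 : 0 < t / 2 by rewrite divr_gt0.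
    rewrite Phi_add//.
    case: hx => ->; case: hy => ->; rewrite ?mul0r ?mul1r ?subr0.
    - rewrite (zero (w1 + t / 2))//; last by lra.
      rewrite (zero w1 (w2 + t / 2))//; last by lra.
      by rewrite (zero (w1 + t / 2))// ?addr0//; lra.
    - rewrite (zero (w1 + t / 2))//; last by lra.
      rewrite (zero (w1 + t / 2))//; last by lra.
      rewrite (zero w1 (w2 - t))//; last by lra.
      by rewrite add0r addr0 add0r; congr Phi; lra.
    - rewrite (zero (w1 - t) w2)//; last by lra.
      rewrite (zero (w1 - t))//; last by lra.
      rewrite (zero (w1 - t + t / 2) (w2 + t / 2))//; last by lra.
      by rewrite add0r !addr0; congr Phi; lra.
    - rewrite (zero (w1 - t) (w2 - t))//; last by lra.
      rewrite (zero (w1 - t + t / 2) (w2 - t))//; last by lra.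
      rewrite (zero (w1 - t) (w2 - t + t / 2))//; last by lra.
      by rewrite !add0r; congr Phi; lra.
  have halves n : Phi (w1 - x * s) (w2 - y * s) s =
      Phi (w1 - x * (s / 2 ^+ n)) (w2 - y * (s / 2 ^+ n)) (s / 2 ^+ n).
    elim: n => [|n ->]; first by rewrite divr1.
    have -> : s / 2 ^+ n.+1 = s / 2 ^+ n / 2 by rewrite exprSr invfM mulrA.
    by rewrite half// divr_gt0// exprn_gt0.
  apply/eqP; rewrite -normr_le0; apply/ler_addgt0Pl => e e0; rewrite addr0.
  have [n /ltW] := geometric_half_small (C * s) e0; apply: le_trans.
  by rewrite (halves n) -mulrA; apply: bnd; rewrite divr_gt0 ?exprn_gt0//= ler_pdivrMr ?exprn_gt0// ler_pMr//
    exprn_ege1// ler1n.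
rewrite Phi_add ?mulr_gt0// (_ : 2 * s / 2 = s); last by field.
rewrite !subrK.
have := corner 1 1 (or_intror erefl) (or_intror erefl).
have := corner 1 0 (or_intror erefl) (or_introl erefl).
have := corner 0 1 (or_introl erefl) (or_intror erefl).
have := corner 0 0 (or_introl erefl) (or_introl erefl).
by rewrite !mul0r !mul1r !subr0 => -> -> -> ->; rewrite !addr0.
Qed.

End bisection.

(** * Measurability in the plane *)

Section plane.
Context {R : realType}.
Local Notation leb := (@lebesgue_measure R).
Local Notation leb2 := (leb \x leb)%E.

Definition mkC (p : R * R) : R[i] := p.1 +i* p.2.
Definition disk2 : set (R * R) := [set p | disk (mkC p)].

Lemma mkCB p q : mkC p - mkC q = (p.1 - q.1) +i* (p.2 - q.2).
Proof. by []. Qed.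

(** Openness in [R * R] is measured by the modulus of [R[i]], so that complex estimates give
    measurability directly. *)
Definition open2 (U : set (R * R)) := forall p, U p ->
  exists2 d : R, 0 < d & forall q, rnorm (mkC q - mkC p) < d -> U q.

(** An open set is the countable union of the boxes with rational centers and sides [2 / n.+1] that
    it contains, and boxes belong to the product sigma-algebra. *)
Lemma open2_measurable U : open2 U -> measurable U.
Proof.
move=> oU.
pose box (a b : R) (n : nat) : set (R * R) :=
  `]a - n.+1%:R^-1, a + n.+1%:R^-1[%classic `*` `]b - n.+1%:R^-1, b + n.+1%:R^-1[%classic.
have -> : U = \bigcup_(a : rat) \bigcup_(b : rat) \bigcup_n
    (if `[< box (ratr a) (ratr b) n `<=` U >] then box (ratr a) (ratr b) n else set0).
  apply/seteqP; split=> [p Up|p [a _] [b _] [n _]]; last first.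
    by case: ifPn => // /asboolP; exact.
  have [d d0 dU] := oU p Up.
  (* Two points of a box of half-side [i] differ by less than [2 * i] in each coordinate, hence by
     less than [4 * i < d] in modulus. *)
  have [i [n iE] nd] : exists2 i : R, exists n, i = n.+1%:R^-1 & i < d / 4.
    have [n _ /(_ n (leqnn n)) nd] := near_infty_natSinv_lt (PosNum (divr_gt0 d0 (ltr0n _ 4))).
    by exists (n.+1%:R^-1) => //; exists n.
  have n0 : 0 < i by rewrite iE invr_gt0.
  have rat_near (x : R) : exists a : rat, `|x - ratr a| < i.
    have : x - i < x + i by lra.
    move=> /rat_in_itvoo[a]; rewrite in_itv/= => /andP[h1 h2]; exists a.
    by rewrite ltr_distlC h1 h2.
  have [a pa] := rat_near p.1; have [b pb] := rat_near p.2.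
  move: pa pb; rewrite !ltr_norml => /andP[a1 a2] /andP[b1 b2].
  exists a => //; exists b => //; exists n => //; rewrite /box -iE.
  rewrite ifT; first by split; rewrite /= in_itv/=; apply/andP; split; lra.
  apply/asboolP => q [] /=; rewrite !in_itv/= => /andP[q1 q2] /andP[q3 q4].
  apply: dU; rewrite mkCB (le_lt_trans (rnorm_le_ReIm _))//=.
  apply: (@lt_trans _ _ (2 * (2 * i))); last by lra.
  by rewrite mulr_natl mulr2n ltrD// ltr_norml; apply/andP; split; lra.
do 2 (apply: bigcupT_measurable_rat => ?).
apply: bigcupT_measurable => n; case: ifP => _ //.
by apply: measurableX; exact: measurable_itv.
Qed.

Lemma continuous_measurable2 (D : set (R * R)) (F : R * R -> R) : open2 D ->
  (forall p, D p -> forall e, 0 < e -> exists2 d : R, 0 < d &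
     forall q, rnorm (mkC q - mkC p) < d -> `|F q - F p| < e) ->
  measurable_fun D F.
Proof.
move=> oD cF; apply: (measurability _ (measurable_realfun.RGenOpens.measurableE R)).
move=> _ [_ [a [b ->] <-]]; apply: open2_measurable => p [Dp] /=.
rewrite in_itv/= => /andP[ap pb].
have [d1 d10 h1] := oD p Dp.
have e0 : 0 < Num.min (F p - a) (b - F p) by rewrite lt_min !subr_gt0 ap.
have [d2 d20 h2] := cF p Dp _ e0.
exists (Num.min d1 d2); first by rewrite lt_min d10.
move=> q; rewrite lt_min => /andP[/h1 Dq /h2 Fq]; split=> //=.
move: Fq; rewrite lt_min !ltr_norml in_itv/= => /andP[/andP[? _] /andP[_ ?]].
by apply/andP; split; lra.
Qed.

Lemma open2T : open2 setT.
Proof. by move=> p _; exists 1. Qed.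

Lemma disk2_open2 : open2 disk2.
Proof.
move=> p; rewrite /disk2/= diskE => p1; exists (1 - rnorm (mkC p)).
  by rewrite subr_gt0.
move=> q; rewrite diskE ltrBrDr => /(le_lt_trans _); apply.
by rewrite -lerBlDr rnorm_sub.
Qed.

Lemma disk2_measurable : measurable disk2.
Proof. exact: open2_measurable disk2_open2. Qed.

Definition ccont_on (D : set R[i]) (u : R[i] -> R[i]) := forall z, D z -> ccont u z.

(** The 1-Lipschitz function [f] stands for the real part, the imaginary part or the modulus. *)
Lemma ccont_measurable D (f : R[i] -> R) (u : R[i] -> R[i]) :
  (forall a b, `|f a - f b| <= rnorm (a - b)) ->
  open2 (mkC @^-1` D) -> ccont_on D u ->
  measurable_fun (mkC @^-1` D) (fun p => f (u (mkC p))).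
Proof.
move=> fL oD cu; apply: continuous_measurable2 => // p Dp e e0.
have [d d0 h] := cu _ Dp e e0; exists d => // q /h; exact: le_lt_trans.
Qed.

Lemma Re_lipschitz (a b : R[i]) : `|complex.Re a - complex.Re b| <= rnorm (a - b).
Proof. by case: a b => [a1 a2] [b1 b2]; exact: (Re_le_rnorm ((a1 +i* a2) - (b1 +i* b2))). Qed.

Lemma Im_lipschitz (a b : R[i]) : `|complex.Im a - complex.Im b| <= rnorm (a - b).
Proof. by case: a b => [a1 a2] [b1 b2]; exact: (Im_le_rnorm ((a1 +i* a2) - (b1 +i* b2))). Qed.

Lemma rnorm_lipschitz (a b : R[i]) : `|rnorm a - rnorm b| <= rnorm (a - b).
Proof. by rewrite ler_norml rnorm_sub andbT lerNl opprB rnormBC rnorm_sub. Qed.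

Lemma leb2_box (x y s t : R) : 0 <= s -> 0 <= t ->
  leb2 (`]x, (x + s)] `*` `]y, (y + t)]) = (s * t)%:E.
Proof.
move=> s0 t0; rewrite product_measure1E; try exact: measurable_itv.
have len (a r : R) : 0 <= r -> leb `]a, (a + r)]%classic = r%:E.
  move=> r0; rewrite [LHS](lebesgue_measure_itv `]a, (a + r)])/= lte_fin ltrDl.
  have [->|r_gt0] := eqVneq r 0; first by rewrite ltxx.
  by rewrite lt_def r_gt0 r0/= -EFinD addrAC subrr add0r.
by rewrite [X in (X * _)%E]len// [X in (_ * X)%E]len.
Qed.

Lemma disk2_finite : (leb2 disk2 < +oo)%E.
Proof.
apply: (@le_lt_trans _ _ (leb2 (`](-1), (-1 + 2)] `*` `](-1), (-1 + 2)]))).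
  apply: le_measure; rewrite ?inE.
  - exact: disk2_measurable.
  - by apply: measurableX; exact: measurable_itv.
  - move=> p; rewrite /disk2/= diskE => p1; split; rewrite /= in_itv/=.
      by have := le_lt_trans (Re_le_rnorm _) p1; rewrite ltr_norml/= => /andP[? ?]; lra.
    by have := le_lt_trans (Im_le_rnorm _) p1; rewrite ltr_norml/= => /andP[? ?]; lra.
by rewrite leb2_box ?ltry.
Qed.

End plane.

Section integral_lemmas.
Context d (T : measurableType d) (R : realType) (mu : {measure set T -> \bar R}).

(* No measurability is required, since the integral of a nonnegative function is the
   supremum of the integrals of the simple functions below it. *)
Lemma ge0_le_integral_nonmeasurable (D : set T) (f g : T -> \bar R) :
  (forall x, D x -> (0 <= f x)%E) -> (forall x, D x -> (f x <= g x)%E) ->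
  (\int[mu]_(x in D) f x <= \int[mu]_(x in D) g x)%E.
Proof.
move=> f0 fg; have g0 x : D x -> (0 <= g x)%E.
  by move=> Dx; exact: le_trans (f0 x Dx) (fg x Dx).
rewrite !ge0_integralE//; apply: le_ereal_sup => _ [h /= hf <-].
exists h => // x; apply: le_trans (hf x) _.
by rewrite !patchE; case: ifPn => //; rewrite inE => /fg.
Qed.

Lemma integrableB_EFin (D : set T) (f g : T -> R) : measurable D ->
  mu.-integrable D (EFin \o f) -> mu.-integrable D (EFin \o g) ->
  mu.-integrable D (EFin \o (fun x => f x - g x)).
Proof.
move=> mD fi gi; rewrite (_ : _ \o _ = (EFin \o f) \- (EFin \o g))%E; last exact/funext.
exact: integrableB.
Qed.

Lemma Rintegral_near_cst (D : set T) (f : T -> R) (k e c : R) :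
  measurable D -> mu D = c%:E -> mu.-integrable D (EFin \o f) ->
  (forall x, D x -> `|f x - k| <= e) ->
  `|\int[mu]_(x in D) f x - k * c| <= e * c.
Proof.
move=> mD muD fi fk.
have ki (r : R) : mu.-integrable D (EFin \o cst r).
  apply: measurable_bounded_integrable => //; first by rewrite muD ltry.
  by exists `|r|; split; [exact: num_real|move=> M rM x _ /=; exact: ltW].
have -> : k * c = \int[mu]_(x in D) k by rewrite Rintegral_cst// muD.
have -> : e * c = \int[mu]_(x in D) e by rewrite Rintegral_cst// muD.
rewrite -RintegralB//; last exact: ki.
have fki : mu.-integrable D (EFin \o (fun x => f x - k)).
  by apply: integrableB_EFin => //; exact: ki.
apply: (le_trans (le_normr_Rintegral _ _)) => //.
by apply: le_Rintegral => //; [exact: integrable_norm|exact: ki].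
Qed.

End integral_lemmas.

Section green.
Context {R : realType}.
Local Notation leb := (@lebesgue_measure R).
Local Notation leb2 := (leb \x leb)%E.
Context (u v : R[i] -> R[i]) (M : R) (w : R[i]).
Context (u_bnd : forall z, rnorm (u z) <= M) (v_bnd : forall z, rnorm (v z) <= M).
Context (u_cont : forall z, ccont u z) (v_cont : forall z, ccont v z).
Context (u_diff : forall z, z != w -> exists a, wdiff u z a (v z)).

(** The real part of [u dz] is [P dx + Q dy], and the integrand [Q_x - P_y] of Green's formula is
    [V], minus twice the imaginary part of [d u / d (conj z)]. *)
Let P (t y : R) := complex.Re (u (t +i* y)).
Let Q (x t : R) := - complex.Im (u (x +i* t)).
Let V (p : R * R) := - (2 * complex.Im (v (mkC p))).
(** Half-open boxes split into disjoint quarters of the same kind, which makes the area term exactly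
    additive. *)
Let ocbox (x y s : R) : set (R * R) := `]x, (x + s)] `*` `]y, (y + s)].

Let oc_integrable (f : R -> R) (x s : R) : (forall t, `|f t| <= M) -> continuous f ->
  0 < s -> leb.-integrable `]x, (x + s)] (EFin \o f).
Proof.
move=> fM cf s0; apply: measurable_bounded_integrable => //.
- rewrite [X in (X < _)%E](lebesgue_measure_itv `]x, (x + s)])/=.
  by rewrite lte_fin ltrDl s0 -EFinD ltry.
- by apply: measurable_funTS; exact: continuous_measurable_fun.
- by exists M; split; [exact: num_real|move=> y My t _ /=; exact: le_trans (fM t) (ltW My)].
Qed.

Let continuous_slice (f : R -> R[i]) : (forall s t, rnorm (f s - f t) <= `|s - t|) ->
  continuous (fun t => complex.Re (u (f t))) /\ continuous (fun t => complex.Im (u (f t))).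
Proof.
move=> fL; split=> t; apply/cvgrPdist_lt => e e0.
  have [d d0 h] := u_cont (f t) e0; apply/nbhs_ballP; exists d => //= s ts.
  rewrite distrC (le_lt_trans (Re_lipschitz _ _))//; apply: h.
  by rewrite (le_lt_trans (fL _ _))// distrC.
have [d d0 h] := u_cont (f t) e0; apply/nbhs_ballP; exists d => //= s ts.
rewrite distrC (le_lt_trans (Im_lipschitz _ _))//; apply: h.
by rewrite (le_lt_trans (fL _ _))// distrC.
Qed.

Let horizontal_lip (y s t : R) : rnorm ((s +i* y) - (t +i* y)) <= `|s - t|.
Proof.
rewrite [X in rnorm X](_ : _ = (s - t)%:C) ?rnorm_real//.
by apply/eqP; rewrite eq_complex/= subrr !eqxx.
Qed.

Let vertical_lip (x s t : R) : rnorm ((x +i* s) - (x +i* t)) <= `|s - t|.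
Proof.
by rewrite (le_trans (rnorm_le_ReIm _))//= subrr normr0 add0r.
Qed.

Let P_int x y s : 0 < s -> leb.-integrable `]x, (x + s)] (EFin \o P^~ y).
Proof.
apply: oc_integrable; last by have [] := continuous_slice (horizontal_lip y).
by move=> t; exact: le_trans (Re_le_rnorm _) (u_bnd _).
Qed.

Let Q_int x y s : 0 < s -> leb.-integrable `]y, (y + s)] (EFin \o Q x).
Proof.
apply: oc_integrable.
  by move=> t; rewrite normrN; exact: le_trans (Im_le_rnorm _) (u_bnd _).
move=> t; have [_ /(_ t)] := continuous_slice (vertical_lip x).
exact: cvgN.
Qed.

Let V_meas : measurable_fun setT V.
Proof.
apply: measurable_funN; apply: measurable_funM => //.
apply: (@ccont_measurable R setT) => //; [exact: Im_lipschitz|exact: open2T].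
Qed.

Let V_bnd p : `|V p| <= 2 * M.
Proof.
rewrite normrN normrM ger0_norm// ler_wpM2l//.
exact: le_trans (Im_le_rnorm _) (v_bnd _).
Qed.

Let ocbox_measurable x y s : measurable (ocbox x y s).
Proof. by apply: measurableX; exact: measurable_itv. Qed.

Lemma V_integrable D : measurable D -> (leb2 D < +oo)%E -> leb2.-integrable D (EFin \o V).
Proof.
move=> mD finD; apply: measurable_bounded_integrable => //.
  exact: measurable_funTS V_meas.
by exists (2 * M); split; [exact: num_real|move=> y My t _ /=; exact: le_trans (V_bnd t) (ltW My)].
Qed.

Let ocbox_measure x y s : 0 < s -> leb2 (ocbox x y s) = (s * s)%:E.
Proof. by move=> s0; exact: (leb2_box x y (ltW s0) (ltW s0)). Qed.

Let V_int x y s : 0 < s -> leb2.-integrable (ocbox x y s) (EFin \o V).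
Proof.
move=> s0; apply: V_integrable; first exact: ocbox_measurable.
by rewrite ocbox_measure// ltry.
Qed.

Let IP x y s := \int[leb]_(t in `]x, (x + s)]) P t y.
Let IQ x y s := \int[leb]_(t in `]y, (y + s)]) Q x t.
Let IV x y s := \int[leb2]_(p in ocbox x y s) V p.

Let oc_split (f : R -> R) x s : 0 < s -> leb.-integrable `]x, (x + s)] (EFin \o f) ->
  \int[leb]_(t in `]x, (x + s)]) f t = \int[leb]_(t in `]x, (x + s / 2)]) f t +
    \int[leb]_(t in `](x + s / 2), (x + s / 2 + s / 2)]) f t.
Proof.
move=> s0 fi; rewrite -[in RHS](addrA x) -splitr.
have h1 : (BRight x <= BRight (x + s / 2))%O.
  by rewrite bnd_simp lerDl divr_ge0// ltW.
have h2 : (BRight (x + s / 2) <= BRight (x + s))%O.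
  by rewrite bnd_simp lerD2l ler_pdivrMr// ler_pMr// ler1n.
by rewrite -(Rintegral_itvB fi h1 h2) [RHS]addrC subrK.
Qed.

Let IP_split x y s : 0 < s -> IP x y s = IP x y (s / 2) + IP (x + s / 2) y (s / 2).
Proof. by move=> s0; apply: oc_split => //; exact: P_int. Qed.

Let IQ_split x y s : 0 < s -> IQ x y s = IQ x y (s / 2) + IQ x (y + s / 2) (s / 2).
Proof. by move=> s0; apply: oc_split => //; exact: Q_int. Qed.

Let IV_split x y s : 0 < s -> IV x y s = IV x y (s / 2) + IV (x + s / 2) y (s / 2) +
  (IV x (y + s / 2) (s / 2) + IV (x + s / 2) (y + s / 2) (s / 2)).
Proof.
move=> s0; have h0 : 0 < s / 2 by rewrite divr_gt0.
have [L1 L2] : (x + s = x + s / 2 + s / 2) /\ (y + s = y + s / 2 + s / 2).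
  by split; lra.
have cutX y' : ocbox x y' (s / 2) `|` ocbox (x + s / 2) y' (s / 2) =
    `]x, (x + s)] `*` `]y', (y' + s / 2)].
  apply/seteqP; split=> [p [|] [] /=|p [] /=]; rewrite /ocbox/= !in_itv/= => /andP[a b] h.
  - by split=> //; apply/andP; split; lra.
  - by split=> //; apply/andP; split; lra.
  - have [pl|pg] := leP p.1 (x + s / 2); [left|right]; split=> //; apply/andP; split; lra.
have cutY : (`]x, (x + s)] `*` `]y, (y + s / 2)]) `|`
    (`]x, (x + s)] `*` `](y + s / 2), (y + s / 2 + s / 2)]) = ocbox x y s.
  apply/seteqP; split=> [p [|] [] /=|p [] /=]; rewrite /ocbox/= !in_itv/= => h /andP[a b].
  - by split=> //; apply/andP; split; lra.
  - by split=> //; apply/andP; split; lra.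
  - have [pl|pg] := leP p.2 (y + s / 2); [left|right]; split=> //; apply/andP; split; lra.
have mX y' : measurable (`]x, (x + s)] `*` `]y', (y' + s / 2)] : set (R * R)).
  by apply: measurableX; exact: measurable_itv.
have cut y' : y <= y' -> y' + s / 2 <= y + s ->
    \int[leb2]_(p in `]x, (x + s)] `*` `]y', (y' + s / 2)]) V p =
    IV x y' (s / 2) + IV (x + s / 2) y' (s / 2).
  move=> yy' y's; rewrite -cutX Rintegral_setU//; try exact: ocbox_measurable.
    rewrite cutX; apply: integrableS (V_int x y s0); [exact: ocbox_measurable|exact: mX|].
    move=> p [/= h]; rewrite !in_itv/= => /andP[? ?]; split=> //=.
    by rewrite in_itv/=; apply/andP; split; lra.
  apply/disj_setPS => p [[/= + _] [/= + _]].
  by rewrite !in_itv/= => /andP[_ a] /andP[b _]; lra.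
rewrite {1}/IV -cutY Rintegral_setU; [|exact: mX|exact: mX| |].
- by rewrite !cut//; lra.
- by rewrite cutY; exact: V_int.
- apply/disj_setPS => p [[_ /=]]; rewrite in_itv/= => /andP[_ a] [_ /=].
  by rewrite in_itv/= => /andP[b _]; lra.
Qed.

(** The defect in Green's formula: the counterclockwise circulation of [P dx + Q dy] around the
    square minus the integral of [V] over it. The contributions of the inner edges cancel when the
    square is quartered. *)
Let Phi x y s := IP x y s - IP x (y + s) s + IQ (x + s) y s - IQ x y s - IV x y s.

Let Phi_add x y s : 0 < s -> Phi x y s =
  Phi x y (s / 2) + Phi (x + s / 2) y (s / 2) +
  Phi x (y + s / 2) (s / 2) + Phi (x + s / 2) (y + s / 2) (s / 2).
Proof.
move=> s0; rewrite /Phi (IP_split x y s0) (IP_split x (y + s) s0).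
rewrite (IQ_split (x + s) y s0) (IQ_split x y s0) (IV_split x y s0).
have -> : x + s / 2 + s / 2 = x + s by lra.
have -> : y + s / 2 + s / 2 = y + s by lra.
ring.
Qed.

Let leb_oc (x s : R) : 0 < s -> leb `]x, (x + s)]%classic = s%:E.
Proof.
move=> s0; rewrite [LHS](lebesgue_measure_itv `]x, (x + s)])/= lte_fin ltrDl s0 -EFinD.
by congr EFin; lra.
Qed.

(** Each of the four edges contributes at most [M * s], and the area term [2 * M * s ^+ 2] is at
    most [8 * M * s] because [s <= 4]. *)
Let Phi_bnd x y s : 0 < s <= 4 -> `|Phi x y s| <= (4 * M + 8 * M) * s.
Proof.
move=> /andP[s0 s4].
have M0 : 0 <= M := le_trans (rnorm_ge0 _) (u_bnd 0).
have hP y' : `|IP x y' s| <= M * s.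
  have := @Rintegral_near_cst _ _ R leb `]x, (x + s)]%classic (P^~ y') 0 M s.
  rewrite mul0r subr0; apply => //; [exact: leb_oc|exact: P_int|move=> t _].
  by rewrite subr0; exact: le_trans (Re_le_rnorm _) (u_bnd _).
have hQ x' : `|IQ x' y s| <= M * s.
  have := @Rintegral_near_cst _ _ R leb `]y, (y + s)]%classic (Q x') 0 M s.
  rewrite mul0r subr0; apply => //; [exact: leb_oc|exact: Q_int|move=> t _].
  by rewrite subr0 normrN; exact: le_trans (Im_le_rnorm _) (u_bnd _).
have hV : `|IV x y s| <= 2 * M * (s * s).
  have := @Rintegral_near_cst _ _ R leb2 (ocbox x y s) V 0 (2 * M) (s * s).
  rewrite mul0r subr0; apply; [exact: ocbox_measurable|exact: ocbox_measure|exact: V_int|].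
  by move=> t _; rewrite subr0.
have hV' : `|IV x y s| <= 8 * M * s.
  apply: (le_trans hV); have -> : 8 * M * s = 2 * M * (s * 4) by ring.
  by rewrite !ler_wpM2l// ?mulr_ge0// ltW.
have := hP y; have := hP (y + s); have := hQ x; have := hQ (x + s).
move: hV'; rewrite /Phi !ler_norml => /andP[? ?] /andP[? ?] /andP[? ?] /andP[? ?] /andP[? ?].
by apply/andP; split; lra.
Qed.

(** Replacing [u] by its linear part at the point costs an error [e * s] on each edge. For the
    linear part, opposite edges differ by the constants [kP] and [kQ], and their sum
    [- 2 * Im (v z) * s] is exactly matched by the area term, since [v] is continuous. *)
Let Phi_small p q : (p, q) != (complex.Re w, complex.Im w) -> locally_small Phi p q.
Proof.
move=> pq e e0; have zw : p +i* q != w.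
  by apply: contra pq => /eqP <-.
have [a ua] := u_diff zw; set z := p +i* q in zw ua.
have e'0 : 0 < e / 12 by rewrite divr_gt0.
have [d1 d10 h1] := ua _ e'0; have [d2 d20 h2] := v_cont z e'0.
exists (Num.min d1 d2 / 3); first by rewrite divr_gt0// lt_min d10.
move=> x y s /andP[s0 sd] /andP[px pxs] /andP[qy qys].
have near_z (x' y' : R) : x <= x' <= x + s -> y <= y' <= y + s ->
    rnorm ((x' +i* y') - z) <= 2 * s.
  move=> /andP[? ?] /andP[? ?]; apply: (le_trans (rnorm_le_ReIm _)) => /=.
  by rewrite mulr_natl mulr2n lerD// ler_norml; apply/andP; split; lra.
have lt_d (x' y' : R) : x <= x' <= x + s -> y <= y' <= y + s ->
    rnorm ((x' +i* y') - z) < d1 /\ rnorm ((x' +i* y') - z) < d2.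
  move=> hx hy; have := near_z _ _ hx hy.
  move: sd; rewrite ltr_pdivlMr// lt_min => /andP[? ?] ?.
  by split; lra.
pose lin (h : R[i]) : R[i] := a * h + v z * conjc h.
have u_lin (x' y' : R) : x <= x' <= x + s -> y <= y' <= y + s ->
    rnorm (u (x' +i* y') - u z - lin ((x' +i* y') - z)) <= e / 6 * s.
  move=> hx hy; have [hd _] := lt_d _ _ hx hy.
  rewrite /lin opprD addrA (le_trans (h1 _ hd))//.
  have -> : e / 6 * s = e / 12 * (2 * s) by field.
  by rewrite ler_wpM2l ?near_z// ltW.
have u_inc (x1 y1 x2 y2 : R) : x <= x1 <= x + s -> y <= y1 <= y + s ->
    x <= x2 <= x + s -> y <= y2 <= y + s ->
    rnorm (u (x1 +i* y1) - u (x2 +i* y2) - lin ((x1 - x2) +i* (y1 - y2))) <= e / 3 * s.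
  move=> hx1 hy1 hx2 hy2.
  rewrite [X in rnorm X](_ : _ = (u (x1 +i* y1) - u z - lin ((x1 +i* y1) - z)) -
     (u (x2 +i* y2) - u z - lin ((x2 +i* y2) - z))).
    apply: (le_trans (rnormB _ _)).
    have -> : e / 3 * s = e / 6 * s + e / 6 * s by field.
    by rewrite lerD// u_lin.
  have -> : (x1 - x2) +i* (y1 - y2) = ((x1 +i* y1) - z) - ((x2 +i* y2) - z).
    by apply/eqP; rewrite eq_complex/=; apply/andP; split; apply/eqP; ring.
  rewrite /lin (conjcB ((x1 +i* y1) - z)).
  by move: (conjc (_ - _)) (conjc (_ - _)) => c1 c2; ring.
have sub_oc (x' : R) t : t \in `]x', (x' + s)] -> x' <= t <= x' + s.
  by rewrite in_itv/= => /andP[/ltW -> ->].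
pose kP := - (s * complex.Re ('i * (a - v z))).
pose kQ := s * complex.Re ('i * (a + v z)).
have SP : `|IP x y s - IP x (y + s) s - kP * s| <= e / 3 * s * s.
  rewrite /IP -RintegralB//; [|exact: P_int..].
  apply: Rintegral_near_cst => //; first exact: leb_oc.
    by apply: integrableB_EFin => //; exact: P_int.
  move=> t /sub_oc ht; rewrite /P.
  have hy0 : y <= y <= y + s by rewrite lexx lerDl ltW.
  have hy1 : y <= y + s <= y + s by rewrite lexx lerDl ltW.
  have := le_trans (Re_le_rnorm _) (u_inc t y t (y + s) ht hy0 ht hy1).
  apply: le_trans; rewrite le_eqVlt; apply/orP; left; apply/eqP; congr `| _ |.
  rewrite /kP /lin; move: (u (t +i* y)) (u (t +i* (y + s))) => [u1 u2] [u3 u4].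
  by case: (a) (v z) => [a1 a2] [b1 b2] /=; ring.
have SQ : `|IQ (x + s) y s - IQ x y s - kQ * s| <= e / 3 * s * s.
  rewrite /IQ -RintegralB//; [|exact: Q_int..].
  apply: Rintegral_near_cst => //; first exact: leb_oc.
    by apply: integrableB_EFin => //; exact: Q_int.
  move=> t /sub_oc ht; rewrite /Q.
  have hy0 : x <= x <= x + s by rewrite lexx lerDl ltW.
  have hy1 : x <= x + s <= x + s by rewrite lexx lerDl ltW.
  have := le_trans (Im_le_rnorm _) (u_inc (x + s) t x t hy1 ht hy0 ht).
  rewrite -normrN.
  apply: le_trans; rewrite le_eqVlt; apply/orP; left; apply/eqP; congr `| _ |.
  rewrite /kQ /lin; move: (u (x +i* t)) (u ((x + s) +i* t)) => [u1 u2] [u3 u4].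
  by case: (a) (v z) => [a1 a2] [b1 b2] /=; ring.
have SV : `|IV x y s - - (2 * complex.Im (v z)) * (s * s)| <= e / 6 * (s * s).
  apply: Rintegral_near_cst; [exact: ocbox_measurable|exact: ocbox_measure|exact: V_int|].
  move=> [x' y'] [/= /sub_oc hx /sub_oc hy]; rewrite /V.
  have [_ /h2 h] := lt_d _ _ hx hy.
  have := le_lt_trans (Im_lipschitz _ _) h; rewrite /mkC/=.
  move: (complex.Im _) (complex.Im _) => i1 i2.
  by rewrite !ltr_norml ler_norml => /andP[? ?]; apply/andP; split; lra.
have kPQ : kP + kQ = - (2 * complex.Im (v z)) * s.
  by rewrite /kP /kQ; case: (a) (v z) => [a1 a2] [b1 b2] /=; ring.
rewrite (_ : Phi x y s = (IP x y s - IP x (y + s) s - kP * s) +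
  (IQ (x + s) y s - IQ x y s - kQ * s) - (IV x y s - - (2 * complex.Im (v z)) * (s * s))).
  apply: (le_trans (ler_normB _ _)); apply: (le_trans (lerD (ler_normD _ _) (lexx _))).
  apply: (le_trans (lerD (lerD SP SQ) SV)).
  have : 0 <= e * (s * s) by rewrite !mulr_ge0// ltW.
  by rewrite expr2; lra.
by rewrite /Phi mulrA -kPQ; ring.
Qed.

(** The edge integrals vanish together with [u], which leaves the area term alone. This concerns the
    imaginary part of [v]; multiplying [u] and [v] by ['i] yields the real part. *)
Lemma green_Im_eq0 (s : R) : 0 < s <= 2 ->
  (forall z, s <= `|complex.Re z - complex.Re w| \/ s <= `|complex.Im z - complex.Im w| ->
    u z = 0) ->
  \int[leb2]_(p in ocbox (complex.Re w - s) (complex.Im w - s) (2 * s)) V p = 0.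
Proof.
move=> /andP[s0 s2] u0; set w1 := complex.Re w in u0 *; set w2 := complex.Im w in u0 *.
have P2s : Phi (w1 - s) (w2 - s) (2 * s) = 0.
  apply: (@bisection_punctured_eq0 _ Phi Phi_add w1 w2 s (4 * M + 8 * M) s0 Phi_small).
  by move=> x y t /andP[t0 ts]; apply: Phi_bnd; rewrite t0/=; lra.
have ss : - s + 2 * s = s by ring.
have edgeP y x r : `|y - w2| = s -> IP x y r = 0.
  move=> ys; rewrite /IP (@eq_Rintegral _ _ _ _ _ (cst 0)).
    by rewrite Rintegral_cst ?mul0r//; exact: measurable_itv.
  by move=> t _; rewrite /P u0//=; right; rewrite ys.
have edgeQ x y r : `|x - w1| = s -> IQ x y r = 0.
  move=> xs; rewrite /IQ (@eq_Rintegral _ _ _ _ _ (cst 0)).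
    by rewrite Rintegral_cst ?mul0r//; exact: measurable_itv.
  by move=> t _; rewrite /Q u0//= ?oppr0//; left; rewrite xs.
have e1 (a : R) : `|a - s - a| = s by rewrite addrAC subrr add0r normrN gtr0_norm.
have e2 (a : R) : `|a - s + 2 * s - a| = s.
  by rewrite (_ : a - s + 2 * s - a = s) ?gtr0_norm//; ring.
move: P2s; rewrite /Phi !edgeP ?edgeQ// !subr0 addr0 sub0r => /eqP.
by rewrite oppr_eq0 => /eqP.
Qed.

End green.

(** * The reproducing formula *)

Section complex_integral.
Context d (T : measurableType d) (R : realType) (mu : {measure set T -> \bar R}).
Implicit Types (A : set T) (F G : T -> R[i]) (B : T -> R).

Definition cint A F : R[i] :=
  (\int[mu]_(x in A) complex.Re (F x)) +i* (\int[mu]_(x in A) complex.Im (F x)).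

Definition cmeasurable A F := measurable_fun A (fun x => complex.Re (F x)) /\
  measurable_fun A (fun x => complex.Im (F x)).

Definition cintegrable A F := mu.-integrable A (EFin \o (fun x => complex.Re (F x))) /\
  mu.-integrable A (EFin \o (fun x => complex.Im (F x))).

Lemma cintegrable_dom A F B : measurable A -> cmeasurable A F ->
  mu.-integrable A (EFin \o B) -> (forall x, A x -> rnorm (F x) <= B x) ->
  cintegrable A F.
Proof.
move=> mA [mR mI] iB FB; split; apply: le_integrable iB => //; try exact/measurable_EFinP.
  move=> x Ax; rewrite /= lee_fin (le_trans (Re_le_rnorm _))// (le_trans (FB x Ax))//.
  exact: ler_norm.
move=> x Ax; rewrite /= lee_fin (le_trans (Im_le_rnorm _))// (le_trans (FB x Ax))//.
exact: ler_norm.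
Qed.

Lemma eq_cint A F G : (forall x, A x -> F x = G x) -> cint A F = cint A G.
Proof.
by move=> FG; congr (_ +i* _); apply: eq_Rintegral => x; rewrite inE => /FG ->.
Qed.

Lemma cintB A F G : measurable A -> cintegrable A F -> cintegrable A G ->
  cint A (fun x => F x - G x) = cint A F - cint A G.
Proof.
move=> mA [F1 F2] [G1 G2]; rewrite /cint -[RHS]/(_ +i* _) -!RintegralB//.
by congr (_ +i* _); apply: eq_Rintegral => x _; case: (F x) (G x) => [? ?] [? ?].
Qed.

Lemma cintegrableB A F G : measurable A -> cintegrable A F -> cintegrable A G ->
  cintegrable A (fun x => F x - G x).
Proof.
move=> mA [F1 F2] [G1 G2]; split.
  rewrite (_ : (fun x => _) = (fun x => complex.Re (F x) - complex.Re (G x))).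
    exact: integrableB_EFin.
  by apply/funext => x; case: (F x) (G x) => [? ?] [? ?].
rewrite (_ : (fun x => _) = (fun x => complex.Im (F x) - complex.Im (G x))).
  exact: integrableB_EFin.
by apply/funext => x; case: (F x) (G x) => [? ?] [? ?].
Qed.

Lemma integrableZ_EFin A (k : R) (f : T -> R) : measurable A ->
  mu.-integrable A (EFin \o f) -> mu.-integrable A (EFin \o (fun x => k * f x)).
Proof.
by move=> mA fi; have := @integrableZl _ _ _ mu A mA k _ fi.
Qed.

Lemma cintZ A F (c : R[i]) : measurable A -> cintegrable A F ->
  cint A (fun x => c * F x) = c * cint A F.
Proof.
case: c => a b mA [F1 F2]; rewrite /cint -[RHS]/(_ +i* _).
rewrite -!RintegralZl// -RintegralB; [|by []|exact: integrableZ_EFin..].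
rewrite -RintegralD; [|by []|exact: integrableZ_EFin..].
congr (_ +i* _); apply: eq_Rintegral => x _; case: (F x) => [? ?] //=.
Qed.

Lemma cintegrableZ A F (c : R[i]) : measurable A -> cintegrable A F ->
  cintegrable A (fun x => c * F x).
Proof.
case: c => a b mA [F1 F2]; split.
  rewrite (_ : (fun x => _) = (fun x => a * complex.Re (F x) - b * complex.Im (F x))).
    by apply: integrableB_EFin => //; exact: integrableZ_EFin.
  by apply/funext => x; case: (F x) => [? ?].
rewrite (_ : (fun x => _) = (fun x => a * complex.Im (F x) - - b * complex.Re (F x))).
  by apply: integrableB_EFin => //; exact: integrableZ_EFin.
by apply/funext => x; case: (F x) => [? ?] /=; rewrite mulNr opprK.
Qed.

Lemma cint_conj A F : measurable A -> cintegrable A F ->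
  cint A (fun x => conjc (F x)) = conjc (cint A F).
Proof.
move=> mA [F1 F2]; rewrite /cint -[RHS]/(_ +i* _); congr (_ +i* _).
  by apply: eq_Rintegral => x _; case: (F x).
rewrite -mulN1r -RintegralZl//; apply: eq_Rintegral => x _.
by rewrite mulN1r; case: (F x).
Qed.

(** The factor 2 comes from bounding the real and the imaginary part separately. *)
Lemma rnorm_cint_le A F B : measurable A -> cmeasurable A F ->
  mu.-integrable A (EFin \o B) -> (forall x, A x -> rnorm (F x) <= B x) ->
  rnorm (cint A F) <= 2 * \int[mu]_(x in A) B x.
Proof.
move=> mA mF iB FB; have [F1 F2] := cintegrable_dom mA mF iB FB.
apply: (le_trans (rnorm_le_ReIm _)); rewrite mulr_natl mulr2n /= lerD//.
  apply: (le_trans (le_normr_Rintegral _ _)) => //.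
  apply: le_Rintegral => //; first exact: integrable_norm.
  by move=> x Ax; exact: le_trans (Re_le_rnorm _) (FB x Ax).
apply: (le_trans (le_normr_Rintegral _ _)) => //.
apply: le_Rintegral => //; first exact: integrable_norm.
by move=> x Ax; exact: le_trans (Im_le_rnorm _) (FB x Ax).
Qed.

Lemma cmeasurableS A A' F : measurable A' -> A `<=` A' -> cmeasurable A' F -> cmeasurable A F.
Proof. by move=> mA' AA' [F1 F2]; split; apply: measurable_funS mA' AA' _. Qed.

Lemma Rintegral_dominated A (f_ : nat -> T -> R) (f : T -> R) B : measurable A ->
  (forall n, measurable_fun A (f_ n)) -> mu.-integrable A (EFin \o B) ->
  (forall x, A x -> f_ n x @[n --> \oo] --> f x) ->
  (forall n x, A x -> `|f_ n x| <= B x) ->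
  \int[mu]_(x in A) f_ n x @[n --> \oo] --> \int[mu]_(x in A) f x.
Proof.
move=> mA mf iB ff fB.
have mf' : measurable_fun A f by exact: measurable_fun_cvg mf ff.
have [] := @dominated_convergence _ _ _ mu A mA (fun n => EFin \o f_ n) (EFin \o f) (EFin \o B).
- by move=> n; exact/measurable_EFinP.
- exact/measurable_EFinP.
- apply: aeW => x Ax; apply: cvg_EFin; last exact: ff.
  by near=> n.
- by [].
- by apply: aeW => x n Ax; rewrite lee_fin fB.
move=> fi _ cv; apply: fine_cvg.
rewrite /Rintegral fineK//; first exact: integrable_fin_num.
Unshelve. all: by end_near. Qed.

Lemma ccvgP (z_ : nat -> R[i]) (z : R[i]) :
  (complex.Re (z_ n) @[n --> \oo] --> complex.Re z) ->
  (complex.Im (z_ n) @[n --> \oo] --> complex.Im z) ->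
  rnorm (z_ n - z) @[n --> \oo] --> (0 : R).
Proof.
move=> h1 h2; apply/cvgrPdist_lt => e e0; near=> n.
rewrite sub0r normrN ger0_norm ?rnorm_ge0// (le_lt_trans (rnorm_le_ReIm _))//.
have -> : complex.Re (z_ n - z) = complex.Re (z_ n) - complex.Re z.
  by case: (z_ n) (z) => [? ?] [? ?].
have -> : complex.Im (z_ n - z) = complex.Im (z_ n) - complex.Im z.
  by case: (z_ n) (z) => [? ?] [? ?].
rewrite (splitr e) ltrD// distrC; near: n.
  by move/cvgrPdist_lt: h1; apply; rewrite divr_gt0.
by move/cvgrPdist_lt: h2; apply; rewrite divr_gt0.
Unshelve. all: by end_near. Qed.

Lemma cint_dominated A (F_ : nat -> T -> R[i]) F B : measurable A ->
  (forall n, cmeasurable A (F_ n)) -> mu.-integrable A (EFin \o B) ->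
  (forall x, A x -> rnorm (F_ n x - F x) @[n --> \oo] --> (0 : R)) ->
  (forall n x, A x -> rnorm (F_ n x) <= B x) ->
  rnorm (cint A (F_ n) - cint A F) @[n --> \oo] --> (0 : R).
Proof.
move=> mA mF iB FF FB.
have cvg_of (f : R[i] -> R) x : (forall a b, `|f a - f b| <= rnorm (a - b)) -> A x ->
    f (F_ n x) @[n --> \oo] --> f (F x).
  move=> fL Ax; apply/cvgrPdist_lt => e e0.
  have /cvgrPdist_lt/(_ _ e0) := FF x Ax; apply: filterS => n.
  rewrite sub0r normrN ger0_norm ?rnorm_ge0// distrC; exact: le_lt_trans.
apply: ccvgP; apply: (@Rintegral_dominated A _ _ B) => //.
- by move=> n; have [] := mF n.
- by move=> x Ax; apply: cvg_of => //; exact: Re_lipschitz.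
- by move=> n x Ax; exact: le_trans (Re_le_rnorm _) (FB n x Ax).
- by move=> n; have [] := mF n.
- by move=> x Ax; apply: cvg_of => //; exact: Im_lipschitz.
- by move=> n x Ax; exact: le_trans (Im_le_rnorm _) (FB n x Ax).
Qed.

End complex_integral.

Section kernel.
Context {R : realType}.
Local Notation leb := (@lebesgue_measure R).
Local Notation leb2 := (leb \x leb)%E.
Implicit Types (f : R[i] -> R[i]) (w z : R[i]).

(** In what follows [w] is the point of evaluation and [z] the variable of integration. [jac] takes
    values in [R[i]] so that [wdiff] applies to it. *)
Definition jac z : R[i] := 1 - z * conjc z.
Definition kden w z : R[i] := 1 - conjc z * w.
(** The Bergman kernel of the weight [(1 - |z|^2)^N], with the weight included and without the
    normalizing constant. *)
Definition bergman N w z : R[i] := jac z ^+ N / kden w z ^+ N.+2.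

Lemma jacE z : jac z = (1 - rnorm z ^+ 2)%:C.
Proof. by rewrite /jac mulrC rnorm_conjM rmorphB. Qed.

Lemma conj_jac z : conjc (jac z) = jac z.
Proof. by rewrite jacE conjc_real. Qed.

Lemma conjcX z n : conjc (z ^+ n) = conjc z ^+ n.
Proof. by elim: n => [|n ih]; rewrite ?expr0 ?conjc1// !exprS conjcM ih. Qed.

Lemma rnorm_nat n : rnorm (n%:R : R[i]) = n%:R.
Proof. by rewrite -(rmorph_nat (@real_complex R)) rnorm_real ger0_norm. Qed.

Lemma sqr_rnorm_lt1 z : disk z -> rnorm z ^+ 2 < 1.
Proof. by rewrite diskE => z1; rewrite expr_lt1// rnorm_ge0. Qed.

Lemma rnorm_jac z : disk z -> rnorm (jac z) = 1 - rnorm z ^+ 2.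
Proof. by move=> Dz; rewrite jacE rnorm_real ger0_norm// subr_ge0 ltW// sqr_rnorm_lt1. Qed.

Lemma jac_real_gt0 z : disk z -> 0 < 1 - rnorm z ^+ 2.
Proof. by move=> Dz; rewrite subr_gt0 sqr_rnorm_lt1. Qed.

Lemma kden_ge_l w z : disk z -> 1 - rnorm w <= rnorm (kden w z).
Proof.
rewrite diskE => z1; rewrite -(rnorm1 R) (le_trans _ (rnorm_sub _ _))// lerD2l lerN2.
by rewrite rnormM rnorm_conj ler_piMl ?rnorm_ge0// ltW.
Qed.

Lemma kden_ge_r w z : disk w -> 1 - rnorm z <= rnorm (kden w z).
Proof.
rewrite diskE => w1; rewrite -(rnorm1 R) (le_trans _ (rnorm_sub _ _))// lerD2l lerN2.
by rewrite rnormM rnorm_conj ler_piMr ?rnorm_ge0// ltW.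
Qed.

Lemma kden_gt0 w z : disk w -> disk z -> 0 < rnorm (kden w z).
Proof. by rewrite (diskE w) => w1 Dz; rewrite (lt_le_trans _ (kden_ge_l w Dz))// subr_gt0. Qed.

Lemma kden_neq0 w z : disk w -> disk z -> kden w z != 0.
Proof. by move=> Dw Dz; rewrite -rnorm_gt0 kden_gt0. Qed.

Lemma wdiff_jac z : wdiff jac z (- conjc z) (- z).
Proof.
have h := wdiffB (wdiff_cst z 1) (wdiffM (wdiff_id z) (wdiff_conj (wdiff_id z))).
by apply: wdiff_eq h _ _; rewrite ?conjc1 ?conjc0 /=; ring.
Qed.

Lemma wdiff_kden w z : wdiff (kden w) z 0 (- w).
Proof.
have h := wdiffB (wdiff_cst z 1) (wdiffM (wdiff_conj (wdiff_id z)) (wdiff_cst z w)).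
by apply: wdiff_eq h _ _; rewrite ?conjc1 ?conjc0 /=; ring.
Qed.

(** The numerator of the [conj z]-derivative of the quotient is
    [- z * kden w z + w * jac z = w - z]. This zero will cancel the pole at [w] of a divided
    difference. *)
Lemma wdiff_ratio w z : kden w z != 0 -> exists a,
  wdiff (fun z => jac z / kden w z) z a ((w - z) / kden w z ^+ 2).
Proof.
move=> k0; have h := wdiffM (wdiff_jac z) (wdiffV k0 (wdiff_kden w z)).
eexists; apply: wdiff_eq h _ _; first reflexivity.
by rewrite /jac; move: k0; rewrite /kden => k0; field.
Qed.

Lemma ccontM (u v : R[i] -> R[i]) z : ccont u z -> ccont v z -> ccont (fun z => u z * v z) z.
Proof.
move=> cu cv e e0.
pose K := 1 + rnorm (v z) + rnorm (u z).
have K0 : 0 < K by rewrite /K -(addrA 1) ltr_wpDr// addr_ge0// rnorm_ge0.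
have [d1 d10 h1] := cu _ (divr_gt0 e0 K0).
have [d2 d20 h2] := cv _ (divr_gt0 e0 K0); have [d3 d30 h3] := cv _ ltr01.
exists (Num.min d1 (Num.min d2 d3)); first by rewrite !lt_min d10 d20.
move=> w; rewrite !lt_min => /and3P[/h1 {}h1 /h2 {}h2 /h3 {}h3].
rewrite [X in rnorm X](_ : _ = (u w - u z) * v w + u z * (v w - v z)); last by ring.
have hv : rnorm (v w) <= 1 + rnorm (v z).
  by rewrite -lerBlDr (le_trans (rnorm_sub _ _))// ltW.
apply: (le_lt_trans (rnormD _ _)); rewrite !rnormM.
have -> : e = e / K * (1 + rnorm (v z)) + rnorm (u z) * (e / K).
  rewrite [LHS](_ : _ = e / K * K); last by rewrite divfK// gt_eqF.
  by rewrite /K; ring.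
rewrite ltr_leD//; last by rewrite ler_wpM2l ?rnorm_ge0// ltW.
rewrite (le_lt_trans (ler_wpM2l (rnorm_ge0 _) hv))// ltr_pM2r//.
by rewrite ltr_wpDr ?rnorm_ge0.
Qed.

Lemma cmeasurable_disk f : (forall z, disk z -> ccont f z) ->
  cmeasurable disk2 (fun p => f (mkC p)).
Proof.
move=> cf; split; apply: (ccont_measurable (D := disk)) => //;
  solve [exact: Re_lipschitz|exact: Im_lipschitz|exact: disk2_open2].
Qed.

Lemma disk2_cst_integrable (K : R) : leb2.-integrable disk2 (EFin \o (fun=> K)).
Proof.
apply: measurable_bounded_integrable => //; [exact: disk2_measurable|exact: disk2_finite|].
by exists `|K|; split; [exact: num_real|move=> M MK x _ /=; exact: ltW].
Qed.

Lemma cintegrable_disk f (K : R) : (forall z, disk z -> ccont f z) ->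
  (forall z, disk z -> rnorm (f z) <= K) -> cintegrable leb2 disk2 (fun p => f (mkC p)).
Proof.
move=> cf fK; apply: (@cintegrable_dom _ _ _ _ _ _ (fun=> K)).
- exact: disk2_measurable.
- exact: cmeasurable_disk.
- exact: disk2_cst_integrable.
- by move=> p; exact: fK.
Qed.

Lemma bergman_cont N w z : disk w -> disk z -> ccont (bergman N w) z.
Proof.
move=> Dw Dz; have kN : kden w z ^+ N.+2 != 0 by rewrite expf_neq0// kden_neq0.
exact: wdiff_cont (wdiffM (wdiffX N (wdiff_jac z))
  (@wdiffV _ (fun z => kden w z ^+ N.+2) _ _ _ kN (wdiffX N.+2 (wdiff_kden w z)))).
Qed.

Lemma rnorm_bergman N w z : disk z ->
  rnorm (bergman N w z) = (1 - rnorm z ^+ 2) ^+ N / rnorm (kden w z) ^+ N.+2.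
Proof. by move=> Dz; rewrite rnormM rnormV !rnormX rnorm_jac. Qed.

Lemma bergman_bnd N w z : disk w -> disk z ->
  rnorm (bergman N w z) <= ((1 - rnorm w) ^+ N.+2)^-1.
Proof.
move=> Dw Dz; have w1 : 0 < 1 - rnorm w by rewrite subr_gt0 -diskE.
rewrite rnorm_bergman// -[leRHS]mul1r; apply: ler_pM.
- by rewrite exprn_ge0// ltW// jac_real_gt0.
- by rewrite invr_ge0 exprn_ge0// rnorm_ge0.
- by rewrite exprn_ile1// ?gerBl ?sqr_ge0// ltW// jac_real_gt0.
- rewrite lef_pV2 ?posrE ?exprn_gt0//; last exact: kden_gt0.
  by rewrite ler_pXn2r// ?nnegrE ?rnorm_ge0 ?kden_ge_l// ltW.
Qed.

Lemma wdiff_ccont f z : (exists a, wdiff f z a 0) -> ccont f z.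
Proof. by move=> [a /wdiff_cont]. Qed.

Section divided_difference.
Context (f : R[i] -> R[i]) (M : R) (w : R[i]) (N : nat).
Context (f_diff : forall z, disk z -> exists a, wdiff f z a 0).
Context (f_bnd : forall z, disk z -> rnorm (f z) <= M) (Dw : disk w) (N_gt0 : (0 < N)%N).

Let f' : R[i] := sval (cid (f_diff Dw)).
Let f'P : wdiff f w f' 0 := svalP (cid (f_diff Dw)).
(* The Bergman-type integrand is, up to a constant, [v = d u / d (conj z)], where [u] is
   continuous and vanishes off the disk. Hence its integral is 0 by Green's formula. *)
Let q z := if z == w then f' else (f z - f w) / (z - w).
Let u z := if `[< disk z >] then q z * (jac z / kden w z) ^+ N.+1 else 0.
Let v z := if `[< disk z >] then
  - (N.+1%:R * (f z - f w) * (jac z ^+ N / kden w z ^+ N.+2)) else 0.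

(** Near [w] the divided difference is within 1 of [f']; at distance at least [d] from [w] it is at
    most [2 * M / d]. *)
Let q_bnd : exists K, forall z, disk z -> rnorm (q z) <= K.
Proof.
have [d d0 hd] := f'P ltr01.
have M0 : 0 <= M by exact: le_trans (rnorm_ge0 _) (f_bnd Dw).
exists (1 + rnorm f' + 2 * M / d) => z Dz; rewrite /q; have [_|zw] := eqVneq z w.
  by rewrite addrAC lerDr addr_ge0// divr_ge0 ?mulr_ge0// ltW.
have zw0 : 0 < rnorm (z - w) by rewrite rnorm_gt0 subr_eq0.
rewrite rnormM rnormV ler_pdivrMr//.
have [/hd zd|dz] := ltP (rnorm (z - w)) d.
  have : rnorm (f z - f w) <= (1 + rnorm f') * rnorm (z - w).
    rewrite mulrDl -(rnormM f').
    rewrite [X in rnorm X <= _](_ : _ = (f z - f w - f' * (z - w) - 0 * conjc (z - w)) +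
      f' * (z - w)); last by ring.
    by rewrite (le_trans (rnormD _ _))// lerD2r.
  move=> /le_trans; apply; rewrite ler_wpM2r ?rnorm_ge0// lerDl.
  by rewrite divr_ge0 ?mulr_ge0// ltW.
apply: (@le_trans _ _ (2 * M / d * rnorm (z - w))); last first.
  by rewrite ler_wpM2r ?rnorm_ge0// lerDr addr_ge0// rnorm_ge0.
rewrite (@le_trans _ _ (2 * M / d * d))//; last first.
  by rewrite ler_wpM2l// divr_ge0 ?mulr_ge0// ltW.
by rewrite divfK ?gt_eqF// (le_trans (rnormB _ _))// mulr_natl mulr2n lerD// f_bnd.
Qed.

(** Here [0 < N] enters. The two factors [1 - |z|^2] available in [u] give it derivative 0 on the
    unit circle, and the one in [v] gives continuity there, so that both functions extend by 0. *)
Let uv_bnd : exists2 C, 0 <= C & forall z, disk z ->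
  rnorm (u z) <= C * (1 - rnorm z ^+ 2) ^+ 2 /\ rnorm (v z) <= C * (1 - rnorm z ^+ 2).
Proof.
have [K hK] := q_bnd.
have K0 : 0 <= K by exact: le_trans (rnorm_ge0 _) (hK w Dw).
have M0 : 0 <= M by exact: le_trans (rnorm_ge0 _) (f_bnd Dw).
have w1 : 0 < 1 - rnorm w by rewrite subr_gt0 -diskE.
pose C1 := K / (1 - rnorm w) ^+ N.+1; pose C2 := N.+1%:R * (2 * M) / (1 - rnorm w) ^+ N.+2.
have C10 : 0 <= C1 by rewrite divr_ge0// exprn_ge0// ltW.
have C20 : 0 <= C2 by apply: divr_ge0; [rewrite !mulr_ge0|rewrite exprn_ge0// ltW].
exists (C1 + C2); first exact: addr_ge0.
move=> z Dz; rewrite /u /v asboolT//.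
have j0 := jac_real_gt0 Dz.
have j1 : 1 - rnorm z ^+ 2 <= 1 by rewrite gerBl sqr_ge0.
have kw : 1 - rnorm w <= rnorm (kden w z) := kden_ge_l w Dz.
have kinv n : (rnorm (kden w z) ^+ n)^-1 <= ((1 - rnorm w) ^+ n)^-1.
  rewrite lef_pV2 ?posrE ?exprn_gt0//; last exact: kden_gt0.
  by apply: lerXn2r; rewrite ?nnegrE ?rnorm_ge0// ltW.
split.
  rewrite rnormM rnormX rnormM rnormV rnorm_jac// exprMn exprVn.
  apply: (@le_trans _ _ (C1 * (1 - rnorm z ^+ 2) ^+ 2)); last first.
    by rewrite ler_wpM2r ?sqr_ge0// lerDl.
  rewrite /C1 mulrAC -mulrA ler_pM ?rnorm_ge0 ?hK//.
    by rewrite mulr_ge0// ?invr_ge0 exprn_ge0// ?rnorm_ge0// ltW.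
  apply: ler_pM; rewrite ?invr_ge0 ?exprn_ge0// ?rnorm_ge0//; [exact: ltW|].
  by apply: ler_wiXn2l => //; exact: ltW.
rewrite rnormN !rnormM rnormV !rnormX rnorm_jac//.
apply: (@le_trans _ _ (C2 * (1 - rnorm z ^+ 2))); last first.
  by rewrite ler_wpM2r ?(ltW j0)// lerDr.
have -> : C2 * (1 - rnorm z ^+ 2) =
  N.+1%:R * (2 * M) * ((1 - rnorm z ^+ 2) * ((1 - rnorm w) ^+ N.+2)^-1).
  by rewrite /C2; ring.
apply: ler_pM.
- by rewrite mulr_ge0// rnorm_ge0.
- by rewrite mulr_ge0// ?invr_ge0 exprn_ge0// ?rnorm_ge0// ltW.
- rewrite rnorm_nat.
  by rewrite ler_wpM2l// (le_trans (rnormB _ _))// mulr_natl mulr2n lerD// f_bnd.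
apply: ler_pM; rewrite ?invr_ge0 ?exprn_ge0// ?rnorm_ge0//; first exact: ltW.
by rewrite -[leRHS]expr1; apply: ler_wiXn2l => //; exact: ltW.
Qed.

Let bnd_near z0 : ~ disk z0 -> forall z, disk z ->
  1 - rnorm z ^+ 2 <= 2 * rnorm (z - z0).
Proof.
rewrite diskE => /negP; rewrite -leNgt => z0_1 z; rewrite diskE => z1.
have h : 1 - rnorm z <= rnorm (z - z0).
  by rewrite rnormBC (le_trans _ (rnorm_sub _ _))// lerD2r.
have -> : 1 - rnorm z ^+ 2 = (1 - rnorm z) * (1 + rnorm z) by ring.
rewrite mulrC ler_pM//; last by lra.
- by rewrite addr_ge0// rnorm_ge0.
- by rewrite subr_ge0 ltW.
Qed.

Let disk_near z0 : disk z0 -> exists2 d : R, 0 < d & forall z, rnorm (z - z0) < d -> disk z.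
Proof.
rewrite diskE => z1; exists (1 - rnorm z0); first by rewrite subr_gt0.
by move=> z; rewrite diskE => h; have := rnorm_sub z z0; lra.
Qed.

Let u_diff z0 : z0 != w -> exists a, wdiff u z0 a (v z0).
Proof.
move=> z0w; have [Dz|nDz] := pselect (disk z0).
  have [a ha] := wdiff_ratio (kden_neq0 Dw Dz).
  have [b hb] := f_diff Dz.
  have zw : z0 - w != 0 by rewrite subr_eq0.
  have hq := wdiffM (wdiffB hb (wdiff_cst z0 (f w)))
    (@wdiffV _ (fun z => z - w) _ _ _ zw (wdiffB (wdiff_id z0) (wdiff_cst z0 w))).
  have := wdiffM hq (wdiffX N.+1 ha) => /=.
  set A := (X in wdiff _ _ X _) => hA; exists A.
  have [d d0 hd] := disk_near Dz.
  apply: (@wdiff_near _ _ u _ _ _ _ _); last first.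
    apply: wdiff_eq hA _ _; first reflexivity.
    rewrite /v asboolT// !subrr !oppr0 !mul0r !mulr0 addr0 mul0r add0r expr_div_n.
    rewrite (exprS _ N.+1) (exprS (kden w z0) N).
    have := kden_neq0 Dw Dz; move: (kden w z0) => k k0.
    have kN : k ^+ N != 0 by rewrite expf_neq0.
    by move: (jac z0 ^+ N) (k ^+ N) kN => J K K0; field; rewrite ?zw ?K0 ?k0.
  exists (Num.min d (rnorm (z0 - w))); first by rewrite lt_min d0 rnorm_gt0.
  move=> z; rewrite lt_min => /andP[/hd Dz' zz0]; rewrite /u asboolT// /q ifF//.
  by apply/negbTE; apply: contraTneq zz0 => ->; rewrite rnormBC ltxx.
(* Off the open disk [u] is bounded by the square of the distance to [z0], so both of its
   derivatives at [z0] are 0. *)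
exists 0; rewrite /v asboolF//= => e e0.
have [C C0 hC] := uv_bnd.
have C4 : 0 < 4 * C + 1 by rewrite ltr_wpDl// mulr_ge0.
exists (e / (4 * C + 1)); first by rewrite divr_gt0.
move=> z zz0; rewrite !mul0r !subr0 {2}/u asboolF// subr0.
have [Dz|nDz'] := pselect (disk z); last first.
  by rewrite /u asboolF// rnorm0 mulr_ge0 ?rnorm_ge0// ltW.
have [h _] := hC z Dz; apply: (le_trans h).
have hb := bnd_near nDz Dz.
apply: (@le_trans _ _ (C * (2 * rnorm (z - z0)) ^+ 2)).
  rewrite ler_wpM2l// ler_pXn2r// nnegrE ?mulr_ge0 ?rnorm_ge0//.
  by rewrite ltW// jac_real_gt0.
rewrite exprMn expr2 mulrA mulrA mulrA -mulrA -expr2 expr2 mulrA ler_wpM2r ?rnorm_ge0//.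
move: zz0; rewrite ltr_pdivlMr// => /ltW; apply: le_trans; rewrite mulrC.
by rewrite ler_wpM2l ?rnorm_ge0//; lra.
Qed.

Let u_cont z0 : ccont u z0.
Proof.
have [->|/u_diff[a /wdiff_cont//]] := eqVneq z0 w.
(* [w] is the exceptional point of Green's formula: there only continuity is at hand, and it follows
   from the existence of the derivative [f']. *)
have cq : ccont q w.
  move=> e e0; have [d d0 hd] := f'P (divr_gt0 e0 (ltr0n _ 2)); exists d => // z zw.
  rewrite /q eqxx; case: eqVneq => [_|nzw]; first by rewrite subrr rnorm0.
  have zw0 : z - w != 0 by rewrite subr_eq0.
  rewrite [X in rnorm X](_ : _ = (f z - f w - f' * (z - w) - 0 * conjc (z - w)) / (z - w)).
    rewrite rnormM rnormV ltr_pdivrMr ?rnorm_gt0// (le_lt_trans (hd _ zw))//.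
    by rewrite ltr_pM2r ?rnorm_gt0//; lra.
  by field.
have [a ha] := wdiff_ratio (kden_neq0 Dw Dw).
have h := ccontM cq (wdiff_cont (wdiffX N.+1 ha)).
move=> e /h[d d0 hd]; have [d' d'0 hd'] := disk_near Dw.
exists (Num.min d d'); first by rewrite lt_min d0.
by move=> z; rewrite lt_min => /andP[/hd + /hd' Dz]; rewrite /u !asboolT.
Qed.

Let v_cont z0 : ccont v z0.
Proof.
have [Dz|nDz] := pselect (disk z0).
  have [b hb] := f_diff Dz.
  have kN : kden w z0 ^+ N.+2 != 0 by rewrite expf_neq0// kden_neq0.
  have h := wdiff_cont (wdiffM (wdiffM (wdiff_cst z0 (- N.+1%:R)) (wdiffB hb (wdiff_cst z0 (f w))))
    (wdiffM (wdiffX N (wdiff_jac z0)) (@wdiffV _ (fun z => kden w z ^+ N.+2) _ _ _ kN (wdiffX N.+2 (wdiff_kden w z0))))).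
  move=> e /h[d d0 hd]; have [d' d'0 hd'] := disk_near Dz.
  exists (Num.min d d'); first by rewrite lt_min d0.
  by move=> z; rewrite lt_min => /andP[/hd + /hd' Dz']; rewrite /v !asboolT// !mulNr.
move=> e e0; have [C C0 hC] := uv_bnd.
have C4 : 0 < 2 * C + 1 by rewrite ltr_wpDl// mulr_ge0.
exists (e / (2 * C + 1)); first by rewrite divr_gt0.
move=> z zz0; rewrite {2}/v asboolF// subr0.
have [Dz|nDz'] := pselect (disk z); last by rewrite /v asboolF// rnorm0.
have [_ h] := hC z Dz; apply: (le_lt_trans h).
have hb := bnd_near nDz Dz.
apply: (@le_lt_trans _ _ (C * (2 * rnorm (z - z0)))); first by rewrite ler_wpM2l.
move: zz0; rewrite ltr_pdivlMr//; apply: le_lt_trans; rewrite mulrCA mulrC.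
have := rnorm_ge0 (z - z0) => ?.
rewrite mulrC mulrA mulrC ler_wpM2l//; lra.
Qed.

Let S (p : R * R) := (f (mkC p) - f w) * bergman N w (mkC p).

Lemma divided_difference_integral : cint leb2 disk2 S = 0.
Proof.
have [C C0 hC] := uv_bnd.
have bu z : rnorm (u z) <= C.
  have [Dz|nDz] := pselect (disk z); last by rewrite /u asboolF// rnorm0.
  have [h _] := hC z Dz; rewrite (le_trans h)// ler_piMr// exprn_ile1//.
    by rewrite ltW// jac_real_gt0.
  by rewrite gerBl sqr_ge0.
have bv z : rnorm (v z) <= C.
  have [Dz|nDz] := pselect (disk z); last by rewrite /v asboolF// rnorm0.
  have [_ h] := hC z Dz; rewrite (le_trans h)// ler_piMr//.
  by rewrite gerBl sqr_ge0.
have u0 z : 2 <= `|complex.Re z - complex.Re w| \/ 2 <= `|complex.Im z - complex.Im w| ->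
    u z = 0.
  move=> h; rewrite /u asboolF// diskE; apply/negP; rewrite -leNgt.
  have w1 : rnorm w < 1 by rewrite -diskE.
  have : 2 <= rnorm (z - w).
    by case: h => /le_trans; apply; [exact: Re_lipschitz|exact: Im_lipschitz].
  by have := rnormB z w; lra.
(* Half-side 2 suffices for the square around [w] to contain the disk, because [w] lies in the disk
   too. *)
have g1 := @green_Im_eq0 R u v C w bu bv u_cont v_cont u_diff 2.
have iu_bnd (x : R[i] -> R[i]) : (forall z, rnorm (x z) <= C) -> forall z, rnorm ('i * x z) <= C.
  by move=> hx z; rewrite rnormM [rnorm 'i](_ : _ = 1) ?mul1r// /rnorm normc_def/= expr0n add0r expr1n sqrtr1.
have iu_diff z : z != w -> exists a, wdiff (fun z => 'i * u z) z a ('i * v z).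
  move=> /u_diff[a ha]; exists ('i * a).
  by have h := wdiffM (wdiff_cst z 'i) ha; apply: wdiff_eq h _ _; rewrite mul0r add0r.
have iu0 z : 2 <= `|complex.Re z - complex.Re w| \/ 2 <= `|complex.Im z - complex.Im w| ->
    'i * u z = 0.
  by move=> /u0 ->; rewrite mulr0.
(* The imaginary part of ['i * v] is the real part of [v]. *)
have g2 := @green_Im_eq0 R (fun z => 'i * u z) (fun z => 'i * v z) C w (iu_bnd _ bu) (iu_bnd _ bv)
  (fun z => ccontM (wdiff_cont (wdiff_cst z 'i)) (u_cont z))
  (fun z => ccontM (wdiff_cont (wdiff_cst z 'i)) (v_cont z)) iu_diff 2.
have le2 : is_true ((0 < 2 :> R) && (2 <= 2 :> R)) by rewrite lexx andbT ltr0n.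
have {}g1 := g1 le2 u0; have {}g2 := g2 le2 iu0.
set box := (X in Rintegral _ X _ = 0) in g1.
have restrict (G : R * R -> R) : (forall p, ~ disk2 p -> G p = 0) ->
    \int[leb2]_(p in box) G p = \int[leb2]_(p in disk2) G p.
  move=> G0; have disk_box : disk2 `<=` box.
    move=> p; rewrite /disk2/= diskE => p1.
    have w1 : rnorm w < 1 by rewrite -diskE.
    have := le_lt_trans (Re_lipschitz (mkC p) w) (le_lt_trans (rnormB _ _) (ltrD p1 w1)).
    have := le_lt_trans (Im_lipschitz (mkC p) w) (le_lt_trans (rnormB _ _) (ltrD p1 w1)).
    rewrite !ltr_norml /mkC/= => /andP[? ?] /andP[? ?].
    by split; rewrite /= in_itv/=; apply/andP; split; lra.
  rewrite -[in RHS](setIidr disk_box) [RHS]Rintegral_mkcondr.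
  apply: eq_Rintegral => p _; rewrite patchE; case: ifPn => //.
  by rewrite notin_setE => /G0.
have S_int : cintegrable leb2 disk2 S.
  apply: (@cintegrable_disk (fun z => (f z - f w) * bergman N w z)
      (2 * M * ((1 - rnorm w) ^+ N.+2)^-1)) => z Dz.
    apply: ccontM; last exact: bergman_cont.
    have [b hb] := f_diff Dz; exact: wdiff_cont (wdiffB hb (wdiff_cst z (f w))).
  rewrite rnormM ler_pM ?rnorm_ge0 ?bergman_bnd//.
  by rewrite (le_trans (rnormB _ _))// mulr_natl mulr2n lerD// f_bnd.
have vE p : disk2 p -> v (mkC p) = - N.+1%:R%:C * S p.
  by move=> Dp; rewrite /v asboolT// /S /bergman rmorph_nat; ring.
have scale (h : R[i] -> R) : h 0 = 0 -> leb2.-integrable disk2 (EFin \o (fun p => h (S p))) ->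
    (forall a, h (- N.+1%:R%:C * a) = - N.+1%:R * h a) ->
    \int[leb2]_(p in box) (- (2 * h (v (mkC p)))) = 0 ->
    \int[leb2]_(p in disk2) h (S p) = 0.
  move=> h0 hi hZ; rewrite restrict; last first.
    by move=> p Dp; rewrite /v asboolF// h0 mulr0 oppr0.
  rewrite (@eq_Rintegral _ _ R leb2 disk2 (fun p => 2 * N.+1%:R * h (S p))); last first.
    by move=> p; rewrite inE => /vE ->; rewrite hZ; ring.
  rewrite RintegralZl//; last exact: disk2_measurable.
  by move=> /eqP; rewrite !mulf_eq0 !pnatr_eq0/= => /eqP.
rewrite /cint; have [S1 S2] := S_int.
rewrite (scale (@complex.Re R))//; last 2 first.
- by move=> [a b] /=; rewrite oppr0 mul0r subr0.
- rewrite -[RHS]g2; apply: eq_Rintegral => p _; congr (- (2 * _)).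
  by case: (v _) => a b /=; ring.
rewrite (scale (@complex.Im R))//.
by move=> [a b] /=; rewrite oppr0 mul0r addr0.
Qed.

End divided_difference.

(** Its value is pi / (N + 1): area is not normalized here. *)
Definition bergman_const N : R := \int[leb2]_(p in disk2) (1 - rnorm (mkC p) ^+ 2) ^+ N.

Lemma bergman_const_gt0 N : 0 < bergman_const N.
Proof.
pose box : set (R * R) := `](- 4^-1), (- 4^-1 + 2^-1)] `*` `](- 4^-1), (- 4^-1 + 2^-1)].
have mbox : measurable box by apply: measurableX; exact: measurable_itv.
have box_small p : box p -> 2^-1 <= 1 - rnorm (mkC p) ^+ 2.
  move=> [/=]; rewrite !in_itv/= => /andP[a1 a2] /andP[b1 b2].
  have : rnorm (mkC p) <= 2^-1.
    rewrite (le_trans (rnorm_le_ReIm _))//= (_ : 2^-1 = 4^-1 + 4^-1); last by field.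
    by rewrite lerD// ler_norml; apply/andP; split; lra.
  move=> h; have : rnorm (mkC p) ^+ 2 <= 2^-1 ^+ 2.
    by rewrite ler_pXn2r// nnegrE ?rnorm_ge0// invr_ge0.
  rewrite expr2 [2^-1 ^+ 2]expr2; lra.
have box_disk : box `<=` disk2.
  move=> p /box_small h; rewrite /disk2/= diskE -(@expr_lt1 _ 2)// ?rnorm_ge0//.
  have h2 : (0 : R) < 2^-1 by rewrite invr_gt0.
  by lra.
have int : leb2.-integrable disk2 (EFin \o (fun p => (1 - rnorm (mkC p) ^+ 2) ^+ N)).
  apply: measurable_bounded_integrable; [exact: disk2_measurable|exact: disk2_finite| |].
    apply: measurable_funX; apply: measurable_funB => //; apply: measurable_funX.
    apply: (@ccont_measurable R disk (@rnorm R R[i]) id); first exact: rnorm_lipschitz.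
      exact: disk2_open2.
    by move=> z _ e e0; exists e.
  exists 1; split; [exact: num_real|move=> K K1 p Dp /=].
  rewrite ger0_norm ?exprn_ge0 ?(ltW (jac_real_gt0 Dp))//.
  rewrite (le_trans _ (ltW K1))// exprn_ile1 ?gerBl ?sqr_ge0// ltW// jac_real_gt0//.
have fin := @integrable_fin_num _ _ R leb2 disk2 disk2_measurable _ int.
rewrite /bergman_const /Rintegral.
rewrite -lte_fin fineK//.
apply: (@lt_le_trans _ _ (\int[leb2]_(p in box) ((2^-1) ^+ N)%:E)%E).
  rewrite integral_cst// [X in (_ * X)%E](leb2_box _ _ _ _) ?invr_ge0//.
  by rewrite -EFinM lte_fin !mulr_gt0 ?exprn_gt0 ?invr_gt0.
apply: (@le_trans _ _ (\int[leb2]_(p in box) ((1 - rnorm (mkC p) ^+ 2) ^+ N)%:E)%E).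
  apply: ge0_le_integral_nonmeasurable => p bp; rewrite lee_fin ?exprn_ge0 ?invr_ge0//.
  by apply: lerXn2r; rewrite ?nnegrE ?invr_ge0 ?(le_trans _ (box_small p bp)) ?invr_ge0 ?box_small.
apply: ge0_subset_integral => //; first exact: disk2_measurable.
  by case/integrableP: int.
by move=> p Dp; rewrite lee_fin exprn_ge0// ltW// jac_real_gt0.
Qed.

Lemma cint_bergman0 N : cint leb2 disk2 (fun p => jac (mkC p) ^+ N) = (bergman_const N)%:C.
Proof.
rewrite /cint /bergman_const; congr (_ +i* _).
  by apply: eq_Rintegral => p _; rewrite jacE -rmorphXn.
rewrite (@eq_Rintegral _ _ R leb2 disk2 (cst 0)); last by move=> p _; rewrite jacE -rmorphXn.
by rewrite Rintegral_cst ?mul0r//; exact: disk2_measurable.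
Qed.

Lemma bergman0E N z : bergman N 0 z = jac z ^+ N.
Proof. by rewrite /bergman /kden mulr0 subr0 expr1n divr1. Qed.

Lemma kdenV_conj_wdiff n w z : disk w -> disk z ->
  exists a, wdiff (fun z => conjc (kden w z ^+ n)^-1) z a 0.
Proof.
move=> Dw Dz; have kN : kden w z ^+ n != 0 by rewrite expf_neq0// kden_neq0.
have := wdiff_conj (@wdiffV _ (fun z => kden w z ^+ n) _ _ _ kN (wdiffX n (wdiff_kden w z))).
by rewrite mulr0 oppr0 mul0r conjc0 => h; eexists; exact: h.
Qed.

Lemma kdenV_bnd n w z : disk w -> disk z -> rnorm (kden w z ^+ n)^-1 <= ((1 - rnorm w) ^+ n)^-1.
Proof.
move=> Dw Dz; have w1 : 0 < 1 - rnorm w by rewrite subr_gt0 -diskE.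
rewrite rnormV rnormX lef_pV2 ?posrE ?exprn_gt0//; last exact: kden_gt0.
by apply: lerXn2r; rewrite ?nnegrE ?rnorm_ge0 ?kden_ge_l// ltW.
Qed.

Lemma bergman_cintegrable f (M : R) N w : (forall z, disk z -> ccont f z) ->
  (forall z, disk z -> rnorm (f z) <= M) -> disk w ->
  cintegrable leb2 disk2 (fun p => f (mkC p) * bergman N w (mkC p)).
Proof.
move=> cf fM Dw.
apply: (@cintegrable_disk (fun z => f z * bergman N w z) (M * ((1 - rnorm w) ^+ N.+2)^-1)) => z Dz.
  by apply: ccontM; [exact: cf|exact: bergman_cont].
by rewrite rnormM ler_pM ?rnorm_ge0 ?bergman_bnd// fM.
Qed.

Lemma ccont_cst (c : R[i]) z : ccont (fun=> c) z.
Proof. exact: wdiff_cont (wdiff_cst z c). Qed.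

Lemma divided_difference_eq f (M : R) N w : (0 < N)%N ->
  (forall z, disk z -> exists a, wdiff f z a 0) ->
  (forall z, disk z -> rnorm (f z) <= M) -> disk w ->
  cint leb2 disk2 (fun p => f (mkC p) * bergman N w (mkC p)) =
  f w * cint leb2 disk2 (fun p => bergman N w (mkC p)).
Proof.
move=> N0 df fM Dw.
have cf z : disk z -> ccont f z by move=> /df/wdiff_ccont.
have i1 := bergman_cintegrable N cf fM Dw.
have i2 : cintegrable leb2 disk2 (fun p => bergman N w (mkC p)).
  have := @bergman_cintegrable (fun=> 1) 1 N w (fun z _ => ccont_cst 1 z) _ Dw.
  by under eq_fun do rewrite mul1r; apply=> z _; rewrite rnorm1.
rewrite -cintZ//; last exact: disk2_measurable.
apply/eqP; rewrite -subr_eq0 -cintB//; [|exact: disk2_measurable|].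
  rewrite -[X in _ == X](divided_difference_integral df fM Dw N0); apply/eqP.
  by apply: eq_cint => p _; rewrite mulrBl.
by apply: cintegrableZ => //; exact: disk2_measurable.
Qed.

(** Conjugation reduces this to the point 0: the conjugate of [(kden w z)^-(N+2)] is analytic in [z]
    with value 1 at 0, and the formula already known at 0 evaluates its integral against
    [jac z ^+ N], which is real. *)
Lemma cint_bergman N w : (0 < N)%N -> disk w ->
  cint leb2 disk2 (fun p => bergman N w (mkC p)) = (bergman_const N)%:C.
Proof.
move=> N0 Dw; pose h z := conjc (kden w z ^+ N.+2)^-1.
have h_bnd z : disk z -> rnorm (h z) <= ((1 - rnorm w) ^+ N.+2)^-1.
  by move=> Dz; rewrite rnorm_conj kdenV_bnd.
have dh z (Dz : disk z) : exists a, wdiff h z a 0 := kdenV_conj_wdiff N.+2 Dw Dz.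
have := divided_difference_eq N0 dh h_bnd (@disk0 R).
rewrite {2}/h /kden conjc0 mul0r subr0 expr1n invr1 conjc1 mul1r.
under [X in _ = cint _ _ X]eq_fun do rewrite bergman0E.
rewrite cint_bergman0 => hE.
rewrite -[RHS]conjc_real -hE -cint_conj.
- by apply: eq_cint => p _; rewrite bergman0E (conjcM (h _)) conjcK conjcX conj_jac mulrC.
- exact: disk2_measurable.
- apply: (bergman_cintegrable _ _ h_bnd); last exact: disk0.
  by move=> z /dh/wdiff_ccont.
Qed.

Lemma reproducing_bounded f (M : R) N w : (0 < N)%N ->
  (forall z, disk z -> exists a, wdiff f z a 0) ->
  (forall z, disk z -> rnorm (f z) <= M) -> disk w ->
  cint leb2 disk2 (fun p => f (mkC p) * bergman N w (mkC p)) = (bergman_const N)%:C * f w.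
Proof.
by move=> N0 df fM Dw; rewrite (divided_difference_eq N0 df fM Dw) cint_bergman// mulrC.
Qed.

End kernel.

(** * Cauchy estimates *)

Section cauchy_estimates.
Context {R : realType}.
Local Notation leb := (@lebesgue_measure R).
Local Notation leb2 := (leb \x leb)%E.
Implicit Types (f : R[i] -> R[i]) (a z w : R[i]).

Definition analytic_on (D : set R[i]) f := forall z, D z -> exists b, wdiff f z b 0.

Lemma wdiff_affine f a (c : R[i]) z b b' : wdiff f (a + c * z) b b' ->
  wdiff (fun z => f (a + c * z)) z (b * c) (b' * conjc c).
Proof.
move=> df e e0; have c1 : 0 < 1 + rnorm c by rewrite ltr_wpDr ?rnorm_ge0.
have [d d0 hd] := df _ (divr_gt0 e0 c1).
exists (d / (1 + rnorm c)); first exact: divr_gt0.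
move=> w wz; have E : a + c * w - (a + c * z) = c * (w - z) by ring.
have le1 : rnorm (c * (w - z)) <= (1 + rnorm c) * rnorm (w - z).
  by rewrite rnormM ler_wpM2r ?rnorm_ge0// lerDr.
have := hd (a + c * w); rewrite E (conjcM c) !mulrA => /(_ _).
move=> /(_ _)/le_trans; apply.
  by rewrite (le_lt_trans le1)// mulrC -ltr_pdivlMr.
rewrite (le_trans (ler_wpM2l (ltW (divr_gt0 e0 c1)) le1))//.
by rewrite mulrA divfK// gt_eqF.
Qed.

Lemma bergman1_lipschitz w z : disk z -> rnorm w <= 2^-1 ->
  rnorm (bergman 1 w z - bergman 1 0 z) <= 40 * rnorm w.
Proof.
move=> Dz w2; set k := kden w z.
have k2 : 2^-1 <= rnorm k.
  have := @kden_ge_l R w z Dz; rewrite -/k; lra.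
have k0 : k != 0 by rewrite -rnorm_gt0 (lt_le_trans _ k2)// invr_gt0.
have zw : rnorm (conjc z * w) <= rnorm w.
  by rewrite rnormM rnorm_conj ler_piMl ?rnorm_ge0// ltW// -diskE.
(* [k^-3 - 1 = (1 - k) (1 + k + k^2) k^-3] with [1 - k = conjc z * w]. As the modulus of [k] lies
   between 1/2 and 3/2, the last two factors contribute at most (1 + 3/2 + 9/4) 8 = 38. *)
rewrite bergman0E [X in rnorm X](_ : _ = jac z * (conjc z * w) * (1 + k + k ^+ 2) * (k^-1) ^+ 3).
  have hk : rnorm k <= 3 / 2.
    by rewrite /k /kden (le_trans (rnormB _ _))// rnorm1; lra.
  have hk2 : rnorm (1 + k + k ^+ 2) <= 1 + 3 / 2 + (3 / 2) ^+ 2.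
    rewrite (le_trans (rnormD _ _))// lerD//.
      by rewrite (le_trans (rnormD _ _))// rnorm1 lerD.
    by rewrite rnormX; apply: lerXn2r; rewrite ?nnegrE ?rnorm_ge0// (le_trans (rnorm_ge0 k)).
  have hki : rnorm (k^-1 ^+ 3) <= 2 ^+ 3.
    rewrite rnormX rnormV; apply: lerXn2r; rewrite ?nnegrE ?invr_ge0 ?rnorm_ge0//.
    by rewrite -(invrK 2) lef_pV2 ?posrE ?invr_gt0// (lt_le_trans _ k2)// invr_gt0.
  have hj : rnorm (jac z) <= 1 by rewrite rnorm_jac// gerBl sqr_ge0.
  have h1 : rnorm (jac z * (conjc z * w)) <= rnorm w.
    by rewrite rnormM (le_trans (ler_piMl (rnorm_ge0 _) hj)).
  have h2 : rnorm (jac z * (conjc z * w) * (1 + k + k ^+ 2)) <=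
      rnorm w * (1 + 3 / 2 + (3 / 2) ^+ 2).
    by rewrite rnormM ler_pM ?rnorm_ge0.
  have := ler_pM (rnorm_ge0 _) (rnorm_ge0 _) h2 hki; rewrite -rnormM => /le_trans; apply.
  have := rnorm_ge0 w; rewrite !exprS expr0; lra.
rewrite /bergman !expr1 -/k (_ : conjc z * w = 1 - k); last by rewrite /k /kden; ring.
by field.
Qed.

(** After rescaling to the unit disk, the difference of the reproducing formulas at [h / r] and at 0
    is an integral against the difference of two kernels, which is Lipschitz for points of modulus
    at most 1/2. The summand 1 only keeps the constant positive. *)
Lemma lipschitz_center : exists2 C : R, 0 < C & forall f a (r M : R), 0 < r ->
  analytic_on [set z | rnorm (z - a) < r] f ->
  (forall z, rnorm (z - a) < r -> rnorm (f z) <= M) ->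
  forall h, rnorm h <= r / 2 -> rnorm (f (a + h) - f a) <= C * M / r * rnorm h.
Proof.
pose area := fine (leb2 disk2); pose c := @bergman_const R 1.
have c0 : 0 < c := bergman_const_gt0 1.
have area0 : 0 <= area by rewrite fine_ge0// measure_ge0.
exists (80 * area / c + 1); first by rewrite ltr_wpDl// divr_ge0 ?mulr_ge0// ltW.
move=> f a r M r0 df fM h h2.
pose rc := r%:C; pose F z := f (a + rc * z).
have rcn : rnorm rc = r by rewrite /rc rnorm_real gtr0_norm.
have rc0 : rc != 0 by rewrite -rnorm_gt0 rcn.
have inB z : disk z -> rnorm (a + rc * z - a) < r.
  rewrite diskE => z1; rewrite addrAC subrr add0r rnormM rcn.
  by rewrite -[ltRHS]mulr1 ltr_pM2l.
have M0 : 0 <= M.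
  by apply: le_trans (rnorm_ge0 _) (fM a _); rewrite subrr rnorm0.
have dF z : disk z -> exists b, wdiff F z b 0.
  move=> Dz; have [b hb] := df _ (inB z Dz); exists (b * rc).
  by have := wdiff_affine hb; rewrite mul0r.
have FM z : disk z -> rnorm (F z) <= M by move=> /inB/fM.
pose w := h / rc.
have wE : rc * w = h by rewrite /w mulrC divfK.
have rw : rnorm h = r * rnorm w by rewrite -wE rnormM rcn.
have w2 : rnorm w <= 2^-1 by rewrite -(ler_pM2l r0) -rw.
have Dw : disk w by rewrite diskE (le_lt_trans w2)// invf_lt1// ltr1n.
have e1 := reproducing_bounded (ltnSn 0) dF FM Dw.
have e2 := reproducing_bounded (ltnSn 0) dF FM (@disk0 R).
have cF z : disk z -> ccont F z by move=> /dF/wdiff_ccont.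
have i1 := bergman_cintegrable 1 cF FM Dw.
have i2 := bergman_cintegrable 1 cF FM (@disk0 R).
have eF : F w - F 0 = f (a + h) - f a by rewrite /F wE mulr0 addr0.
have e3 : c * rnorm (F w - F 0) <= 80 * area * M * rnorm w.
  have -> : c * rnorm (F w - F 0) = rnorm (c%:C * F w - c%:C * F 0).
    by rewrite -mulrBr rnormM rnorm_real gtr0_norm.
  rewrite -e1 -e2 -cintB//; last exact: disk2_measurable.
  have -> : 80 * area * M * rnorm w = 2 * \int[leb2]_(p in disk2) (40 * M * rnorm w).
    rewrite [X in 2 * X](@Rintegral_cst _ _ R leb2 disk2 disk2_measurable) -/area.
    ring.
  apply: rnorm_cint_le; first exact: disk2_measurable.
  - apply: (@cmeasurable_disk R (fun z => F z * bergman 1 w z - F z * bergman 1 0 z)) => z Dz.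
    have kk v (Dv : disk v) : exists x y, wdiff (bergman 1 v) z x y.
      have kN : kden v z ^+ 3 != 0 by rewrite expf_neq0// kden_neq0.
      do 2 eexists; exact: (wdiffM (wdiffX 1 (wdiff_jac z))
        (@wdiffV _ (fun z => kden v z ^+ 3) _ _ _ kN (wdiffX 3 (wdiff_kden v z)))).
    have [b hb] := dF _ Dz.
    have [x [y hxy]] := kk _ Dw; have [x' [y' hxy']] := kk _ (@disk0 R).
    exact: wdiff_cont (wdiffB (wdiffM hb hxy) (wdiffM hb hxy')).
  - exact: disk2_cst_integrable.
  - move=> p Dp; rewrite -mulrBr rnormM -mulrA mulrCA.
    by rewrite ler_pM ?rnorm_ge0 ?FM// bergman1_lipschitz.
rewrite -eF rw.
have -> : (80 * area / c + 1) * M / r * (r * rnorm w) =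
    80 * area * M * rnorm w / c + M * rnorm w by field; rewrite !gt_eqF.
by rewrite -[leLHS]addr0 lerD ?mulr_ge0 ?rnorm_ge0// ler_pdivlMr// mulrC.
Qed.

Lemma analytic_derivable f z : (exists b, wdiff f z b 0) -> wdiff f z (derive1 f z) 0.
Proof.
move=> [b hb]; have db := wdiff_derivable hb.
have dz : derivable f z 1 by exact: ex_derive.
exact: derivable_wdiff.
Qed.

(** The Lipschitz estimate bounds the difference quotients at the center, and the bound survives as
    the step tends to 0. *)
Lemma cauchy_estimate : exists2 C : R, 0 < C & forall f a (r M : R), 0 < r ->
  analytic_on [set z | rnorm (z - a) < r] f ->
  (forall z, rnorm (z - a) < r -> rnorm (f z) <= M) ->
  rnorm (derive1 f a) <= C * M / r.
Proof.
have [C C0 hC] := lipschitz_center; exists C => // f a r M r0 df fM.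
have da : wdiff f a (derive1 f a) 0.
  by apply: analytic_derivable; apply: df; rewrite /= subrr rnorm0.
apply/ler_addgt0Pr => e e0; have [d d0 hd] := da _ e0.
pose t := Num.min (d / 2) (r / 2); have t0 : 0 < t by rewrite lt_min !divr_gt0.
have rt : rnorm (t%:C : R[i]) = t by rewrite rnorm_real gtr0_norm.
have := hd (a + t%:C); rewrite addrAC subrr add0r rt mul0r subr0 => /(_ _) h1.
have {}h1 : rnorm (f (a + t%:C) - f a - derive1 f a * t%:C) <= e * t.
  by apply: h1; rewrite gt_min; apply/orP; left; rewrite ltr_pdivrMr// ltr_pMr// ltr1n.
have := hC f a r M r0 df fM t%:C; rewrite rt => /(_ _) h2.
have {}h2 : rnorm (f (a + t%:C) - f a) <= C * M / r * t.
  by apply: h2; rewrite ge_min lexx orbT.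
rewrite -(ler_pM2r t0) -{1}rt -rnormM mulrDl.
rewrite [X in rnorm X](_ : _ = (f (a + t%:C) - f a) -
  (f (a + t%:C) - f a - derive1 f a * t%:C)); last by ring.
by rewrite (le_trans (rnormB _ _))// lerD.
Qed.

(** Near [a] the difference quotients [q] are analytic and bounded by the Lipschitz constant of [f].
    The Lipschitz estimate therefore applies to [q] itself, uniformly in the step [t], and passes to
    the limit [derive1 f]. *)
Lemma analytic_derive1_cont f a : analytic_on_disk f -> disk a -> ccont (derive1 f) a.
Proof.
move=> df Da.
have df' z : disk z -> wdiff f z (derive1 f z) 0 by move=> /df/derivable_wdiff.
have [C C0 hC] := lipschitz_center.
have [d d0 hd] := wdiff_cont (df' _ Da) ltr01.
have a1 : rnorm a < 1 by rewrite -diskE.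
pose r := Num.min d (1 - rnorm a).
have r0 : 0 < r by rewrite lt_min d0 subr_gt0.
have r_disk z : rnorm (z - a) < r -> disk z.
  rewrite lt_min => /andP[_ h]; rewrite diskE.
  by have := rnorm_sub z a; lra.
pose M := rnorm (f a) + 1.
have M0 : 0 < M by rewrite ltr_wpDl// rnorm_ge0.
have fM z : rnorm (z - a) < r -> rnorm (f z) <= M.
  rewrite lt_min => /andP[/hd h _]; rewrite /M -lerBlDl (le_trans (rnorm_sub _ _))// ltW//.
have r2 : 0 < r / 2 by rewrite divr_gt0.
have r4 : 0 < r / 4 by rewrite divr_gt0.
have sub z w : rnorm (z - a) < r / 2 -> rnorm (w - z) < r / 2 -> rnorm (w - a) < r.
  move=> h1 h2; rewrite (_ : w - a = (w - z) + (z - a)); last by ring.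
  by rewrite (le_lt_trans (rnormD _ _))// (splitr r) ltrD.
pose L := C * M / (r / 2).
have L0 : 0 < L by rewrite divr_gt0// mulr_gt0.
have lip z h : rnorm (z - a) < r / 2 -> rnorm h <= r / 4 -> rnorm (f (z + h) - f z) <= L * rnorm h.
  move=> za hr; apply: hC => //.
  - by move=> w /= wz; exists (derive1 f w); apply: df'; apply: r_disk; exact: sub wz.
  - by move=> w wz; apply: fM; exact: sub wz.
  - lra.
pose L' := C * L / (r / 2).
have L'0 : 0 < L' by rewrite divr_gt0// mulr_gt0.
have lip' k : rnorm k <= r / 4 -> rnorm (derive1 f (a + k) - derive1 f a) <= L' * rnorm k.
  move=> kr.
  have ka : rnorm (a + k - a) < r / 2 by rewrite addrAC subrr add0r; lra.
  have aa : rnorm (a - a) < r / 2 by rewrite subrr rnorm0.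
  have sub2 z : rnorm (z - a) < r / 2 -> rnorm (z - a) < r by lra.
  have Dk := r_disk _ (sub2 _ ka).
  apply/ler_addgt0Pr => e e0; have e2 : 0 < e / 2 by rewrite divr_gt0.
  have [d1 d10 h1] := df' _ Dk _ e2; have [d2 d20 h2] := df' _ Da _ e2.
  pose t := Num.min (Num.min (d1 / 2) (d2 / 2)) (r / 4).
  have t0 : 0 < t by rewrite !lt_min !divr_gt0.
  have rt : rnorm (t%:C : R[i]) = t by rewrite rnorm_real gtr0_norm.
  have tn0 : t%:C != 0 :> R[i] by rewrite -rnorm_gt0 rt.
  have td1 : t < d1 by rewrite !gt_min ltr_pdivrMr// ltr_pMr// ltr1n.
  have td2 : t < d2 by rewrite !gt_min [d2 / 2 < _]ltr_pdivrMr// ltr_pMr// ltr1n orbT.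
  have tr4 : t <= r / 4 by rewrite ge_min lexx orbT.
  pose q z := (f (z + t%:C) - f z) / t%:C.
  have qL z : rnorm (z - a) < r / 2 -> rnorm (q z) <= L.
    by move=> za; rewrite rnormM rnormV rt ler_pdivrMr// -{2}rt lip// rt.
  have dq : analytic_on [set z | rnorm (z - a) < r / 2] q.
    move=> z /= za.
    have Dz := r_disk _ (sub2 _ za).
    have zt : rnorm (z + t%:C - z) < r / 2 by rewrite addrAC subrr add0r rt; lra.
    have Dzt := r_disk _ (sub _ _ za zt).
    have ha := @wdiff_affine f t%:C 1 z (derive1 f (z + t%:C)) 0.
    rewrite mul1r addrC in ha.
    have := wdiffM (wdiffB (ha (df' _ Dzt)) (df' _ Dz)) (wdiff_cst z (t%:C)^-1).
    rewrite mul0r !subrr mul0r mulr0 addr0 => h; eexists.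
    apply: (wdiff_near _ (wdiff_eq h erefl (addr0 _))); exists 1 => // y _.
    by rewrite /q mul1r (addrC t%:C).
  have hq := hC q a (r / 2) L r2 dq qL k; rewrite -/L' in hq.
  have {}hq : rnorm (q (a + k) - q a) <= L' * rnorm k by apply: hq; lra.
  have near_q z d3 : (forall w, rnorm (w - z) < d3 -> rnorm (f w - f z - derive1 f z * (w - z) -
      0 * conjc (w - z)) <= e / 2 * rnorm (w - z)) -> t < d3 ->
      rnorm (derive1 f z - q z) <= e / 2.
    move=> h td; have := h (z + t%:C); rewrite addrAC subrr add0r rt mul0r subr0 => /(_ td) {}h.
    rewrite -(ler_pM2r t0) -{1}rt -rnormM mulrBl /q divfK// rnormBC.
    by rewrite (_ : f (z + t%:C) - f z - derive1 f z * t%:C = f (z + t%:C) - f z - derive1 f z * t%:C).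
  have := near_q _ _ h1 td1; have := near_q _ _ h2 td2; move: hq; clear.
  move: (derive1 f (a + k)) (derive1 f a) (q (a + k)) (q a) (L' * rnorm k) => x y u v c h1 h2 h3.
  rewrite (_ : x - y = (x - u) + (u - v) - (y - v)); last by ring.
  rewrite (le_trans (rnormB _ _))// (le_trans (lerD (rnormD _ _) (lexx _)))//; lra.
move=> e e0; exists (Num.min (r / 4) (e / L')); first by rewrite lt_min r4 divr_gt0.
move=> w; rewrite lt_min => /andP[w4]; rewrite ltr_pdivlMr// => we.
have h := lip' (w - a) (ltW w4); rewrite (addrC a (w - a)) (subrK a w) in h.
apply: (le_lt_trans h).
by rewrite mulrC.
Qed.

End cauchy_estimates.

(** * The Forelli-Rudin estimate *)

Section one_dimensional_bounds.
Context {R : realType}.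
Local Notation leb := (@lebesgue_measure R).

(** [f] may blow up at either end, so the fundamental theorem is applied on closed subintervals
    exhausting []a, b[], and monotone convergence passes to the limit. *)
Lemma integral_oo_le (f F : R -> R) (a b K : R) : a < b ->
  (forall x, a < x < b -> 0 <= f x) ->
  (forall x, a < x < b -> {for x, continuous f}) ->
  (forall x, a < x < b -> is_derive x 1 F (f x)) ->
  (forall x, a < x < b -> 0 <= F x <= K) ->
  (\int[leb]_(x in `]a, b[) (f x)%:E <= K%:E)%E.
Proof.
move=> ab f0 cf dF FK.
have mf : measurable_fun `]a, b[ f.
  apply: open_continuous_measurable_fun; first exact: interval_open.
  by move=> x; rewrite inE/= in_itv/= => /cf.
(* The denominator starts at 3 so that [e n] stays below half the length and the subinterval is
   never degenerate. *)
pose e n : R := (b - a) / n.+3%:R.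
have e0 n : 0 < e n by rewrite divr_gt0// subr_gt0.
have e_half n : e n < (b - a) / 2.
  by rewrite ltr_pM2l ?subr_gt0// ltf_pV2 ?posrE// ltr_nat.
pose A n : set R := `[a + e n, b - e n]%classic.
have Asub n : A n `<=` `]a, b[.
  move=> x; rewrite /A/= !in_itv/= => /andP[h1 h2]; have := e0 n.
  by move=> h; apply/andP; split; lra.
have An n : (\int[leb]_(x in A n) (f x)%:E <= K%:E)%E.
  have lt_n : a + e n < b - e n by have := e_half n; lra.
  have inab x : a + e n <= x <= b - e n -> a < x < b.
    by move=> /andP[h1 h2]; have := e0 n => h; apply/andP; split; lra.
  have cF x : a + e n <= x <= b - e n -> {for x, continuous F}.
    move=> /inab/dF h; apply: differentiable_continuous; apply/derivable1_diffP.
    exact: ex_derive.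
  rewrite (@continuous_FTC2 _ f F)//.
  - rewrite -EFinB lee_fin.
    have /FK/andP[_ h1] : a < b - e n < b by apply: inab; rewrite lexx andbT ltW.
    have /FK/andP[h2 _] : a < a + e n < b by apply: inab; rewrite lexx ltW.
    lra.
  - apply: continuous_in_subspaceT => x; rewrite inE/= in_itv/= => /inab/cf.
    exact.
  - split.
    + move=> x; rewrite in_itv/= => /andP[h1 h2].
      have /dF h : a < x < b by apply: inab; rewrite !ltW.
      exact: ex_derive.
    + apply: cvg_at_right_filter; apply: cF; by rewrite lexx ltW.
    + apply: cvg_at_left_filter; apply: cF; by rewrite lexx ltW.
  - move=> x; rewrite in_itv/= => /andP[h1 h2].
    have /dF h : a < x < b by apply: inab; rewrite !ltW.
    by rewrite derive1E; exact: derive_val.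
have Acup : \bigcup_n A n = `]a, b[%classic.
  apply/seteqP; split=> [x [n _ /Asub//]|x]; rewrite /= in_itv/= => /andP[ax xb].
  have m0 : 0 < Num.min (x - a) (b - x) / (b - a).
    by rewrite divr_gt0 ?subr_gt0// lt_min !subr_gt0 ax.
  have [n _ /(_ n (leqnn n)) /=] := near_infty_natSinv_lt (PosNum m0).
  rewrite ltr_pdivlMr ?subr_gt0// mulrC => h.
  have en : e n < Num.min (x - a) (b - x).
    apply: lt_trans h; rewrite /e ltr_pM2l ?subr_gt0// ltf_pV2 ?posrE// ltr_nat.
    by rewrite !ltnS leqnSn.
  exists n => //; rewrite /A/= in_itv/=; move: en; rewrite lt_min => /andP[? ?].
  by apply/andP; split; lra.
have nd : nondecreasing_seq A.
  apply/nondecreasing_seqP => n; rewrite subsetEset => x; rewrite /A/= !in_itv/=.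
  have : e n.+1 <= e n.
    by rewrite /e ler_pM2l ?subr_gt0// lef_pV2 ?posrE// ler_nat.
  by move=> h /andP[? ?]; apply/andP; split; lra.
have mA n : measurable (A n) by exact: measurable_itv.
have cvg : (\int[leb]_(x in A n) (f x)%:E @[n --> \oo] -->
    \int[leb]_(x in `]a, b[) (f x)%:E)%E.
  rewrite -Acup; apply: ge0_nondecreasing_set_cvg_integral => //.
    by move=> n; apply/measurable_EFinP; apply: measurable_funS mf => //; exact: Asub.
  by move=> n x /Asub; rewrite lee_fin /= in_itv/= => /f0.
rewrite -(cvg_lim _ cvg)//; apply: lime_le; first by apply/cvg_ex; eexists; exact: cvg.
by near=> n; exact: An.
Unshelve. all: by end_near. Qed.

Lemma is_derive_subr (c x : R) : is_derive x 1 (fun x : R => c - x) (-1).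
Proof. by have h := is_deriveB (is_derive_cst c x 1) (is_derive_id x 1); rewrite sub0r in h. Qed.

Lemma is_derive_addr (c x : R) : is_derive x 1 (fun x : R => c + x) 1.
Proof. by have h := is_deriveD (is_derive_cst c x 1) (is_derive_id x 1); rewrite add0r in h. Qed.

Lemma integral_abs_le (h H : R -> R) (c L K : R) : 0 < L ->
  (forall t, 0 < t < L -> 0 <= h t) ->
  (forall t, 0 < t < L -> {for t, continuous h}) ->
  (forall t, 0 < t < L -> is_derive t 1 H (h t)) ->
  (forall t, 0 < t < L -> 0 <= H t <= K) ->
  measurable_fun [set: R] h ->
  (\int[leb]_(x in `](c - L)%R, (c + L)%R[) (h `|x - c|%R)%:E <= (2 * K)%:E)%E.
Proof.
move=> L0 h0 ch dH HK mh.
have split_itv : `](c - L), (c + L)[%classic `\ c = `](c - L), c[ `|` `]c, (c + L)[.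
  apply/seteqP; split=> x /=; rewrite !in_itv/=.
    move=> [/andP[h1 h2] /eqP xc]; case: (ltgtP x c) xc => // xc _.
      by left; apply/andP.
    by right; apply/andP.
  move=> [|] /andP[h1 h2]; split.
  - by apply/andP; split; lra.
  - by apply/eqP; rewrite lt_eqF.
  - by apply/andP; split; lra.
  - by apply/eqP; rewrite gt_eqF.
have mabs : measurable_fun [set: R] (fun x => h `|x - c|).
  apply: (measurableT_comp mh); apply: measurableT_comp => //.
  exact: measurable_funB.
have right_part : (\int[leb]_(x in `]c, (c + L)%R[) (h `|x - c|%R)%:E <= K%:E)%E.
  apply: (@le_trans _ _ (\int[leb]_(x in `]c, (c + L)%R[) (h (x - c)%R)%:E)%E).
    apply: ge0_le_integral_nonmeasurable => x; rewrite /= in_itv/= => /andP[h1 h2]; rewrite lee_fin.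
      by rewrite gtr0_norm ?subr_gt0//; apply: h0; apply/andP; split; lra.
    by rewrite gtr0_norm ?subr_gt0.
  apply: (@integral_oo_le _ (fun x => H (x - c))); first by rewrite ltrDl.
  - by move=> x /andP[? ?]; apply: h0; apply/andP; split; lra.
  - move=> x /andP[? ?]; apply: (@continuous_comp _ _ _ (fun x => x - c) h).
      by apply: cvgB; [exact: cvg_id|exact: cvg_cst].
    by apply: ch; apply/andP; split; lra.
  - move=> x /andP[? ?].
    have /dH hd : 0 < x - c < L by apply/andP; split; lra.
    have := @is_derive1_comp R H (fun x => x - c) x (h (x - c)) 1 hd.
    by rewrite mulr1; apply; apply: is_derive_eq; rewrite subr0.
  - by move=> x /andP[? ?]; apply: HK; apply/andP; split; lra.
have left_part : (\int[leb]_(x in `](c - L)%R, c[) (h `|x - c|%R)%:E <= K%:E)%E.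
  apply: (@le_trans _ _ (\int[leb]_(x in `](c - L)%R, c[) (h (c - x)%R)%:E)%E).
    apply: ge0_le_integral_nonmeasurable => x; rewrite /= in_itv/= => /andP[h1 h2]; rewrite lee_fin.
      by rewrite ltr0_norm ?subr_lt0// opprB; apply: h0; apply/andP; split; lra.
    by rewrite ltr0_norm ?subr_lt0// opprB.
  apply: (@integral_oo_le _ (fun x => K - H (c - x))); first by rewrite gtrBl.
  - by move=> x /andP[? ?]; apply: h0; apply/andP; split; lra.
  - move=> x /andP[? ?]; apply: (@continuous_comp _ _ _ (fun x => c - x) h).
      by apply: cvgB; [exact: cvg_cst|exact: cvg_id].
    by apply: ch; apply/andP; split; lra.
  - move=> x /andP[? ?].
    have /dH hd : 0 < c - x < L by apply/andP; split; lra.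
    have hd2 := @is_derive1_comp R H (fun x => c - x) x (h (c - x)) (-1) hd (is_derive_subr c x).
    have hd3 := is_deriveB (is_derive_cst K x 1) hd2.
    by rewrite mulrN1 sub0r opprK in hd3; exact: hd3.
  - move=> x /andP[? ?].
    by have /HK/andP[? ?] : 0 < c - x < L; [|apply/andP; split]; lra.
rewrite -(@integral_setD1 _ _ c); last 2 first.
- by apply: measurableD => //; exact: measurable_itv.
- by apply/measurable_EFinP; apply: measurable_funTS.
rewrite split_itv ge0_integral_setU//=.
- by rewrite mulr_natl mulr2n EFinD leeD.
- by apply/measurable_EFinP; apply: measurable_funTS.
- move=> x [|]; rewrite /= in_itv/= => /andP[? ?]; rewrite lee_fin; apply: h0.
    by rewrite ltr0_norm; [|lra]; apply/andP; split; lra.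
  by rewrite gtr0_norm; [|lra]; apply/andP; split; lra.
- apply/disj_setPS => x [/=]; rewrite !in_itv/= => /andP[_ h1] /andP[h2 _]; lra.
Qed.

Lemma continuous_powR (f : R -> R) (p t : R) : {for t, continuous f} -> 0 < f t ->
  {for t, continuous (fun x => f x `^ p)}.
Proof.
move=> cf ft; apply: (@continuous_comp _ _ _ f (fun y => y `^ p)) => //.
apply: differentiable_continuous; apply/derivable1_diffP.
by have h := is_derive1_powR p ft; exact: ex_derive.
Qed.

(** Put [y = D + X - t]. The substitution [rho = (X - t) / y], with derivative [- D / y^2], turns
    the integrand into [rho^a] times the factor [y^-b], which is at most [D^-b]. The singularity of
    [rho^a] at 0 is integrable because [-1 < a]. *)
Lemma integral_x_le (a b D X : R) : -1 < a -> 0 < b -> 0 < D -> 0 < X ->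
  (\int[leb]_(x in `](- X)%R, X[)
     ((X - `|x|) `^ a * (D + (X - `|x|)) `^ (- (a + 2 + b)))%:E <=
   (2 * (D `^ (- (1 + b)) / (a + 1)))%:E)%E.
Proof.
move=> a1 b0 D0 X0; have a10 : 0 < a + 1 by lra.
pose rho (t : R) : R := 1 - D * (D + X - t) `^ (-1).
pose h (t : R) := D `^ (- (1 + b)) * (rho t `^ a * (D * (D + X - t) `^ (-2))).
pose H (t : R) := D `^ (- (1 + b)) / (a + 1) * (1 - rho t `^ (a + 1)).
have rhoE t : t < X -> rho t = (X - t) / (D + X - t).
  move=> tX; have y0 : 0 < D + X - t by lra.
  by rewrite /rho powR_inv1 ?ltW//; field; rewrite gt_eqF.
have rho01 t : 0 < t < X -> 0 < rho t < 1.
  move=> /andP[t0 tX]; have y0 : 0 < D + X - t by lra.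
  rewrite rhoE// divr_gt0//; last by lra.
  by rewrite ltr_pdivrMr// mul1r; lra.
have cy (t : R) : {for t, continuous (fun t : R => D + X - t)}.
  by apply: cvgB; [exact: cvg_cst|exact: cvg_id].
have dy (t p : R) : t < X ->
    is_derive t 1 (fun t : R => (D + X - t) `^ p) (- (p * (D + X - t) `^ (p - 1))).
  move=> tX; have y0 : 0 < D + X - t by lra.
  have := @is_derive1_comp R (fun y : R => y `^ p) (fun t => D + X - t) t _ (-1)
    (is_derive1_powR p y0) (is_derive_subr (D + X) t).
  by rewrite mulrN1.
have drho t : 0 < t < X -> is_derive t 1 rho (D * (D + X - t) `^ (-2) * -1).
  move=> /andP[t0 tX].
  have h1 := is_deriveB (is_derive_cst (1 : R) t 1) (is_deriveZ D (dy t (-1) tX)).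
  rewrite mulN1r opprK sub0r (_ : -1 - 1 = -2 :> R) in h1; last by lra.
  by rewrite mulrN1; exact: h1.
have crho t : 0 < t < X -> {for t, continuous rho}.
  move=> /drho hd; apply: differentiable_continuous; apply/derivable1_diffP.
  exact: ex_derive.
have dH t : 0 < t < X -> is_derive t 1 H (h t).
  move=> tX; have /andP[r0 r1] := rho01 t tX.
  have h1 := @is_derive1_comp R (fun y : R => y `^ (a + 1)) rho t _ _ (is_derive1_powR (a + 1) r0) (drho t tX).
  have h2 := is_deriveZ (D `^ (- (1 + b)) / (a + 1)) (is_deriveB (is_derive_cst (1 : R) t 1) h1).
  apply: (is_derive_eq h2).
  rewrite /GRing.scale/= sub0r addrK /h.
  by field; rewrite gt_eqF.
have K0 : 0 <= D `^ (- (1 + b)) / (a + 1) by rewrite divr_ge0 ?powR_ge0// ltW.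
apply: (@le_trans _ _ (\int[leb]_(x in `](0 - X)%R, (0 + X)%R[) (h `|x - 0|%R)%:E)%E).
  rewrite sub0r add0r; apply: ge0_le_integral_nonmeasurable => x.
    by move=> _; rewrite lee_fin mulr_ge0// powR_ge0.
  rewrite /= in_itv/= => /andP[x1 x2]; rewrite lee_fin subr0.
  have ax : `|x| < X by rewrite ltr_norml x1.
  set t := `|x| in ax *; set y := D + X - t.
  have y0 : 0 < y by rewrite /y; lra.
  have Dy : D <= y by rewrite /y; lra.
  have -> : D + (X - t) = y by rewrite /y; ring.
  have -> : X - t = rho t * y by rewrite rhoE// -/y divfK// gt_eqF.
  have r0 : 0 <= rho t by rewrite rhoE// divr_ge0 ?(ltW y0)//; lra.
  rewrite powRM ?(ltW y0)// /h -mulrA [leRHS]mulrCA ler_wpM2l ?powR_ge0//.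
  rewrite -powRD; last by rewrite (gt_eqF y0) implybT.
  have -> : a + - (a + 2 + b) = - b + -2 by ring.
  rewrite powRD; last by rewrite (gt_eqF y0) implybT.
  rewrite mulrA ler_wpM2r ?powR_ge0//.
  have -> : D `^ (- (1 + b)) * D = D `^ (- b).
    rewrite -[X in _ * X](powRr1 (ltW D0)) -powRD; last by rewrite (gt_eqF D0) implybT.
    by congr powR; ring.
  rewrite !powRN lef_pV2 ?posrE ?powR_gt0//.
  by apply: ge0_ler_powR; rewrite ?nnegrE ?(ltW b0) ?(ltW D0) ?(ltW y0).
apply: (@integral_abs_le h H) => //.
- move=> t tX; have /andP[r0 _] := rho01 t tX.
  by rewrite !mulr_ge0 ?powR_ge0// ltW.
- move=> t /[dup] tX /andP[t0 tX']; have /andP[r0 _] := rho01 t tX.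
  have y0 : 0 < D + X - t by lra.
  have c1 := continuous_powR (p := a) (crho t tX) r0.
  have c2 := continuous_powR (p := -2) (cy t) y0.
  exact: (cvgM (cvg_cst _) (cvgM c1 (cvgM (cvg_cst _) c2))).
- move=> t tX; have /andP[r0 r1] := rho01 t tX.
  have : rho t `^ (a + 1) <= 1 `^ (a + 1).
    by apply: ge0_ler_powR; rewrite ?nnegrE ?ltW.
  rewrite powR1 => r1'; apply/andP; split.
    by rewrite mulr_ge0// subr_ge0.
  by rewrite ler_piMr// gerBl powR_ge0.
- have my : measurable_fun [set: R] (fun t : R => D + X - t) by exact: measurable_funB.
  have mp (p : R) : measurable_fun [set: R] (fun t : R => (D + X - t) `^ p).
    exact: measurableT_comp (measurable_powR p) my.
  apply: measurable_funM => //; apply: measurable_funM.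
    apply: (measurableT_comp (measurable_powR a)).
    by apply: measurable_funB => //; exact: measurable_funM.
  exact: measurable_funM.
Qed.

Lemma integral_y_le (b D v : R) : 0 < b -> 0 < D -> `|v| <= 1 ->
  (\int[leb]_(y in `](-1)%R, 1%R[) ((D + `|y - v|) `^ (- (1 + b)))%:E <=
   (2 * (D `^ (- b) / b))%:E)%E.
Proof.
move=> b0 D0 v1.
pose h (t : R) := (D + t) `^ (- (1 + b)).
pose H (t : R) := b^-1 * (D `^ (- b) - (D + t) `^ (- b)).
have mh : measurable_fun [set: R] h.
  apply: (measurableT_comp (measurable_powR _)); exact: measurable_funD.
have dH (t : R) : 0 < t < 2 -> is_derive t 1 H (h t).
  move=> /andP[t0 _]; have y0 : 0 < D + t by rewrite addr_gt0.
  have h1 : is_derive t 1 (fun t : R => (D + t) `^ (- b)) (- b * (D + t) `^ (- b - 1)).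
    have := @is_derive1_comp R (fun y : R => y `^ (- b)) (fun t => D + t) t _ 1 (is_derive1_powR (- b) y0)
      (is_derive_addr D t).
    by rewrite mulr1.
  have h2 := is_deriveZ b^-1 (is_deriveB (is_derive_cst (D `^ (- b)) t 1) h1).
  apply: (is_derive_eq h2).
  rewrite /GRing.scale/= sub0r mulNr opprK mulrA mulVf ?gt_eqF// mul1r /h.
  by congr powR; ring.
apply: (@le_trans _ _ (\int[leb]_(y in `](v - 2)%R, (v + 2)%R[) (h `|y - v|%R)%:E)%E).
  apply: ge0_subset_integral.
  - exact: measurable_itv.
  - exact: measurable_itv.
  - apply/measurable_EFinP; apply: measurable_funTS; apply: (measurableT_comp mh).
    by apply: measurableT_comp => //; exact: measurable_funB.
  - by move=> y _; rewrite lee_fin powR_ge0.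
  - move=> y; rewrite /= !in_itv/= => /andP[? ?].
    by move: v1; rewrite ler_norml => /andP[? ?]; apply/andP; split; lra.
apply: (@integral_abs_le h H) => //.
- by move=> t _; rewrite powR_ge0.
- move=> t /andP[t0 _]; have y0 : 0 < D + t by rewrite addr_gt0.
  have cD : {for t, continuous (fun t : R => D + t)}.
    by apply: cvgD; [exact: cvg_cst|exact: cvg_id].
  exact: (continuous_powR (p := - (1 + b)) cD y0).
- move=> t /andP[t0 _]; rewrite /H mulrC.
  have le1 : (D + t) `^ (- b) <= D `^ (- b).
    rewrite !powRN lef_pV2 ?posrE ?powR_gt0 ?addr_gt0//.
    by apply: ge0_ler_powR; rewrite ?nnegrE ?(ltW b0) ?(ltW D0)// ?lerDl ?addr_ge0// ltW.
  apply/andP; split.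
    by rewrite divr_ge0 ?subr_ge0// ltW.
  by rewrite ler_wpM2r ?invr_ge0 ?ltW// gtrBl powR_gt0// addr_gt0.
Qed.

End one_dimensional_bounds.

Section forelli_rudin.
Context {R : realType}.
Local Notation leb := (@lebesgue_measure R).
Local Notation leb2 := (leb \x leb)%E.

(* On the part of the disk where [`|t| <= `|s|], [1 - rnorm z ^+ 2] is comparable to the
   distance [sqrt (1 - t ^+ 2) - `|s|] of [z = s + i t] to the circle along the line
   [Im z = t]. *)
Definition strip_kernel (a c d v s t : R) : R :=
  (Num.sqrt (1 - t ^+ 2) - `|s|) `^ a *
  (d + `|t - v| + (Num.sqrt (1 - t ^+ 2) - `|s|)) `^ (- c).

Definition strip_kernel_disk (a c d v s t : R) : \bar R :=
  (if (s ^+ 2 + t ^+ 2 < 1)%R then (strip_kernel a c d v s t)%:E else 0)%E.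

Lemma strip_kernel_disk_ge0 a c d v s t : (0 <= strip_kernel_disk a c d v s t)%E.
Proof. by rewrite /strip_kernel_disk; case: ifP => // _; rewrite lee_fin mulr_ge0 ?powR_ge0. Qed.

Lemma sqr_lt_sqrt (s t : R) : t ^+ 2 < 1 -> (s ^+ 2 + t ^+ 2 < 1) = (`|s| < Num.sqrt (1 - t ^+ 2)).
Proof.
move=> t1; have t0 : 0 <= 1 - t ^+ 2 by rewrite subr_ge0 ltW.
rewrite -sqrtr_sqr ltr_sqrt ?subr_gt0//.
by apply/idP/idP; lra.
Qed.

(** Integrating in [s] with [D = d + |t - v|] lowers the exponent from [a + 2 + b] to [1 + b];
    integrating in [t] lowers it to [b]. Each integration contributes a factor 2. *)
Lemma strip_kernel_iterated (a b d v : R) : -1 < a -> 0 < b -> 0 < d -> `|v| <= 1 ->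
  (\int[leb]_t \int[leb]_s strip_kernel_disk a (a + 2 + b) d v s t <=
   (4 / (a + 1) / b * d `^ (- b))%:E)%E.
Proof.
move=> a1 b0 d0 v1; have a10 : 0 < a + 1 by lra.
have inner t : (\int[leb]_s strip_kernel_disk a (a + 2 + b) d v s t <=
    ((fun t => (2 / (a + 1) * (d + `|t - v|) `^ (- (1 + b)))%:E) \_ `](-1)%R, 1%R[) t)%E.
  rewrite patchE; case: ifPn => [|tn]; last first.
    rewrite integral0_eq// => s _; rewrite /strip_kernel_disk ifF//; apply/negbTE.
    apply: contra tn => st; rewrite inE/= in_itv/= -ltr_norml -[X in _ < X]sqrtr1.
    by rewrite -sqrtr_sqr ltr_sqrt//; have := sqr_ge0 s; lra.
  rewrite inE/= in_itv/= -ltr_norml => t1.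
  have t2 : t ^+ 2 < 1 by rewrite -real_normK ?num_real// expr_lt1.
  have X0 : 0 < Num.sqrt (1 - t ^+ 2) by rewrite sqrtr_gt0 subr_gt0.
  have D0 : 0 < d + `|t - v| by rewrite ltr_pwDl.
  apply: le_trans (_ : (2 * ((d + `|t - v|) `^ (- (1 + b)) / (a + 1)))%:E <= _)%E; last first.
    by rewrite lee_fin [X in 2 * X]mulrC mulrA.
  apply: le_trans (integral_x_le a1 b0 D0 X0).
  rewrite [leRHS]integral_mkcond; apply: ge0_le_integral_nonmeasurable => s _.
    exact: strip_kernel_disk_ge0.
  rewrite patchE mem_setE in_itv/= -ltr_norml /strip_kernel_disk sqr_lt_sqrt//.
apply: (@le_trans _ _ (\int[leb]_(t in `](-1)%R, 1%R[)
    (2 / (a + 1) * (d + `|t - v|) `^ (- (1 + b)))%:E)%E).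
  rewrite [leRHS]integral_mkcond; apply: ge0_le_integral_nonmeasurable => t _ //.
  by apply: integral_ge0 => s _; exact: strip_kernel_disk_ge0.
have mh : measurable_fun (`](-1)%R, 1%R[%classic : set R) (fun t : R => (d + `|t - v|) `^ (- (1 + b))).
  apply: measurable_funTS; apply: (measurableT_comp (measurable_powR _)).
  apply: measurable_funD => //; apply: measurableT_comp => //; exact: measurable_funB.
under eq_integral do rewrite EFinM.
rewrite ge0_integralZl_EFin//; last first.
- by rewrite divr_ge0 ?ltW.
- exact/measurable_EFinP.
- by move=> t _; rewrite lee_fin powR_ge0.
apply: (@le_trans _ _ ((2 / (a + 1))%:E * (2 * (d `^ (- b) / b))%:E)%E).
  by apply: lee_wpmul2l; [rewrite lee_fin divr_ge0 ?ltW|exact: integral_y_le].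
rewrite -EFinM lee_fin le_eqVlt; apply/orP; left; apply/eqP.
by field; rewrite !gt_eqF.
Qed.

Lemma strip_kernel_measurable (a c d v : R) :
  measurable_fun [set: R * R] (fun p : R * R => strip_kernel a c d v p.1 p.2).
Proof.
have mX : measurable_fun [set: R * R] (fun p : R * R => Num.sqrt (1 - p.2 ^+ 2) - `|p.1|).
  apply: measurable_funB; last by apply: measurableT_comp => //; exact: measurable_fst.
  apply: (measurableT_comp (continuous_measurable_fun (@sqrt_continuous R))).
  apply: measurable_funB => //; apply: measurable_funX; exact: measurable_snd.
apply: measurable_funM; first exact: (measurableT_comp (measurable_powR _)).
apply: (measurableT_comp (measurable_powR _)).
apply: measurable_funD => //; apply: measurable_funD => //.
apply: measurableT_comp => //; apply: measurable_funB => //; exact: measurable_snd.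
Qed.

Lemma mkC_disk (p : R * R) : disk (mkC p) <-> p.1 ^+ 2 + p.2 ^+ 2 < 1.
Proof.
rewrite diskE -(rnorm_sqr (mkC p)); split=> h; first by rewrite expr_lt1// rnorm_ge0.
by move: h; rewrite expr_lt1// rnorm_ge0.
Qed.

Lemma strip_kernel_integral (a b d v : R) : -1 < a -> 0 < b -> 0 < d -> `|v| <= 1 ->
  (\int[leb2]_(p in disk2) (strip_kernel a (a + 2 + b) d v p.1 p.2)%:E <=
   (4 / (a + 1) / b * d `^ (- b))%:E)%E.
Proof.
move=> a1 b0 d0 v1; apply: le_trans (strip_kernel_iterated a1 b0 d0 v1).
rewrite integral_mkcond fubini_tonelli2//=.
- rewrite le_eqVlt; apply/orP; left; apply/eqP.
  apply: eq_integral => t _; apply: eq_integral => s _.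
  rewrite patchE /strip_kernel_disk; case: ifPn => [/[1!inE]/mkC_disk/= ->//|st].
  by case: ifPn => // h; case/negP: st; rewrite inE; exact/mkC_disk.
- apply/(measurable_restrictT _ _).1; first exact: disk2_measurable.
  apply/measurable_EFinP; apply: measurable_funTS; exact: strip_kernel_measurable.
- by move=> p; apply: erestrict_ge0 => q _; rewrite lee_fin mulr_ge0 ?powR_ge0.
Qed.

Lemma strip_kernel_integral_swap (a b d v : R) : -1 < a -> 0 < b -> 0 < d -> `|v| <= 1 ->
  (\int[leb2]_(p in disk2) (strip_kernel a (a + 2 + b) d v p.2 p.1)%:E <=
   (4 / (a + 1) / b * d `^ (- b))%:E)%E.
Proof.
move=> a1 b0 d0 v1; apply: le_trans (strip_kernel_iterated a1 b0 d0 v1).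
rewrite integral_mkcond fubini_tonelli1//=.
- rewrite le_eqVlt; apply/orP; left; apply/eqP.
  apply: eq_integral => t _; apply: eq_integral => s _.
  rewrite patchE /strip_kernel_disk (addrC (s ^+ 2)); case: ifPn => [/[1!inE]/mkC_disk/= ->//|st].
  by case: ifPn => // h; case/negP: st; rewrite inE; exact/mkC_disk.
- apply/(measurable_restrictT _ _).1; first exact: disk2_measurable.
  apply/measurable_EFinP; apply: measurable_funTS.
  exact: (measurableT_comp (strip_kernel_measurable a (a + 2 + b) d v) (@measurable_swap _ _ _ _)).
- by move=> p; apply: erestrict_ge0 => q _; rewrite lee_fin mulr_ge0 ?powR_ge0.
Qed.

(** The difference of the squares of the two sides is exactly [(1 - |z|^2) (1 - |w|^2)]. *)
Lemma kden_ge_dist (w z : R[i]) : disk w -> disk z -> rnorm (z - w) <= rnorm (kden w z).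
Proof.
rewrite !diskE => w1 z1.
rewrite -(ler_pXn2r (n := 2)) ?nnegrE ?rnorm_ge0//.
have : 0 <= (1 - rnorm z ^+ 2) * (1 - rnorm w ^+ 2).
  by rewrite mulr_ge0 ?subr_ge0 ?expr_le1 ?rnorm_ge0 ?(ltW w1) ?(ltW z1).
rewrite !rnorm_sqr /kden; case: (z) (w) => [x y] [u v] /= h.
by rewrite -subr_ge0; apply: le_trans h _; rewrite le_eqVlt; apply/orP; left; apply/eqP; ring.
Qed.

Lemma kden_ge_boundary_l (w z : R[i]) : disk w -> disk z ->
  1 - rnorm z ^+ 2 <= 2 * rnorm (kden w z).
Proof.
move=> Dw Dz; have := kden_ge_r z Dw; have := rnorm_ge0 z; move: (Dz); rewrite diskE.
by move: (rnorm z) (rnorm (kden w z)) => r k; nra.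
Qed.

Lemma kden_ge_boundary_r (w z : R[i]) : disk w -> disk z ->
  1 - rnorm w ^+ 2 <= 2 * rnorm (kden w z).
Proof.
move=> Dw Dz; have := kden_ge_l w Dz; have := rnorm_ge0 w; move: (Dw); rewrite diskE.
by move: (rnorm w) (rnorm (kden w z)) => r k; nra.
Qed.

Lemma powR_le_between (a s : R) : 2^-1 <= s <= 2 -> s `^ a <= 2 `^ `|a|.
Proof.
move=> /andP[s1 s2]; have s0 : 0 < s by lra.
have [a0|a0] := leP 0 a.
  by rewrite ger0_norm// ge0_ler_powR// nnegrE ltW.
rewrite ltr0_norm// -[X in _ `^ X <= _]opprK powRN -powR_inv1 ?powR_ge0//.
rewrite -powRrM mulrC powRrM powR_inv1 ?(ltW s0)//.
rewrite ge0_ler_powR// ?nnegrE ?invr_ge0 ?(ltW s0)//; first by lra.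
by rewrite -[leRHS]invrK lef_pV2 ?posrE// invr_gt0.
Qed.

(** With [X = sqrt (1 - t^2)] one has [1 - |z|^2 = (X - |s|) (X + |s|)], and [|t| <= |s|] keeps
    [X + |s|] between 1/2 and 2. The constant 7 is 2 + 1 + 4, the three summands of the strip kernel
    being at most 2, 1 and 4 times the modulus of [kden w z]. *)
Lemma kernel_le_strip (a b : R) (w : R[i]) (s t v : R) (z : R[i]) : -1 < a -> 0 < b ->
  disk w -> disk z -> rnorm z ^+ 2 = s ^+ 2 + t ^+ 2 -> `|t - v| <= rnorm (z - w) ->
  `|t| <= `|s| ->
  (1 - rnorm z ^+ 2) `^ a * rnorm (kden w z) `^ (- (a + 2 + b)) <=
  2 `^ `|a| * 7 `^ (a + 2 + b) * strip_kernel a (a + 2 + b) (1 - rnorm w ^+ 2) v s t.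
Proof.
move=> a1 b0 Dw Dz zE tv ts.
have c0 : 0 <= a + 2 + b by lra.
have z1 := sqr_rnorm_lt1 Dz; have w1 := sqr_rnorm_lt1 Dw.
have sst : t ^+ 2 <= s ^+ 2 by rewrite -(real_normK (num_real t)) -(real_normK (num_real s)) lerXn2r ?nnegrE.
have t1 : t ^+ 2 < 1 by have := sqr_ge0 s; lra.
have sX : `|s| < Num.sqrt (1 - t ^+ 2) by rewrite -sqr_lt_sqrt// -zE.
set X := Num.sqrt (1 - t ^+ 2) in sX *.
have X2 : X ^+ 2 = 1 - t ^+ 2 by rewrite sqr_sqrtr// subr_ge0 ltW.
have X1 : X <= 1 by rewrite -sqrtr1 ler_wsqrtr// gerBl sqr_ge0.
have Xh : 2^-1 <= X.
  rewrite -(ler_pXn2r (n := 2)) ?nnegrE ?sqrtr_ge0 ?invr_ge0// X2.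
  by rewrite expr2; lra.
have s0 : 0 <= `|s| by [].
have s2 : `|s| ^+ 2 = s ^+ 2 by rewrite real_normK ?num_real.
set T := X - `|s|.
have T0 : 0 < T by rewrite subr_gt0.
have dz : 1 - rnorm z ^+ 2 = T * (X + `|s|).
  by rewrite zE -s2 /T; move: X2; generalize X `|s| => x r h; rewrite -subr_sqr h; ring.
have D0 : 0 < 1 - rnorm w ^+ 2 + `|t - v| + T.
  by rewrite ltr_wpDl// addr_ge0// subr_ge0 ltW.
have K0 := kden_gt0 Dw Dz.
have TK : T <= 4 * rnorm (kden w z).
  have := kden_ge_boundary_l Dw Dz; rewrite dz; move: T0 Xh s0; rewrite -/T.
  by generalize T X `|s| (rnorm (kden w z)) => T' x r k *; nra.
have DK : 1 - rnorm w ^+ 2 + `|t - v| + T <= 7 * rnorm (kden w z).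
  have := kden_ge_boundary_r Dw Dz; have := le_trans tv (kden_ge_dist Dw Dz).
  by move: TK; generalize (rnorm (kden w z)) => k; lra.
rewrite /strip_kernel -/X -/T dz powRM ?(ltW T0) ?addr_ge0 ?sqrtr_ge0//.
have h1 : (X + `|s|) `^ a <= 2 `^ `|a|.
  by apply: powR_le_between; apply/andP; split; lra.
have h2 : rnorm (kden w z) `^ (- (a + 2 + b)) <=
    7 `^ (a + 2 + b) * (1 - rnorm w ^+ 2 + `|t - v| + T) `^ (- (a + 2 + b)).
  rewrite !powRN -ler_pdivrMr ?invr_gt0 ?powR_gt0// invrK mulrC ler_pdivrMr ?powR_gt0//.
  rewrite -powRM ?(ltW K0)//; apply: ge0_ler_powR => //; first by rewrite nnegrE ltW.
  by rewrite nnegrE mulr_ge0 ?rnorm_ge0.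
apply: (@le_trans _ _ (T `^ a * 2 `^ `|a| *
    (7 `^ (a + 2 + b) * (1 - rnorm w ^+ 2 + `|t - v| + T) `^ (- (a + 2 + b))))).
  by apply: ler_pM; rewrite ?mulr_ge0 ?powR_ge0// ler_wpM2l// powR_ge0.
rewrite le_eqVlt; apply/orP; left; apply/eqP.
move: (T `^ a) (2 `^ `|a|) (7 `^ _) (_ `^ - _) => k1 k2 k3 k4; ring.
Qed.

(** At every point one coordinate dominates the other in absolute value. The two strip kernels [h1]
    and [h2], with the coordinates exchanged, take care of the two cases. *)
Lemma forelli_rudin (a b : R) : -1 < a -> 0 < b -> exists2 C : R, 0 < C &
  forall w : R[i], disk w ->
  (\int[leb2]_(p in disk2) ((1 - rnorm (mkC p) ^+ 2) `^ a *
      rnorm (kden w (mkC p)) `^ (- (a + 2 + b)))%:E <=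
   (C * (1 - rnorm w ^+ 2) `^ (- b))%:E)%E.
Proof.
move=> a1 b0; have a10 : 0 < a + 1 by lra.
pose k := 2 `^ `|a| * 7 `^ (a + 2 + b) : R.
have k0 : 0 < k by rewrite mulr_gt0// powR_gt0.
exists (k * (8 / (a + 1) / b)); first by rewrite mulr_gt0// !divr_gt0.
move=> w Dw; have d0 := jac_real_gt0 Dw; set d := 1 - rnorm w ^+ 2 in d0 *.
have Rew : `|complex.Re w| <= 1 by rewrite (le_trans (Re_le_rnorm _))// ltW// -diskE.
have Imw : `|complex.Im w| <= 1 by rewrite (le_trans (Im_le_rnorm _))// ltW// -diskE.
pose h1 (p : R * R) := strip_kernel a (a + 2 + b) d (complex.Im w) p.1 p.2.
pose h2 (p : R * R) := strip_kernel a (a + 2 + b) d (complex.Re w) p.2 p.1.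
have h1_ge0 p : 0 <= h1 p by rewrite mulr_ge0 ?powR_ge0.
have h2_ge0 p : 0 <= h2 p by rewrite mulr_ge0 ?powR_ge0.
have mh1 : measurable_fun disk2 (EFin \o h1).
  by apply/measurable_EFinP; apply: measurable_funTS; exact: strip_kernel_measurable.
have mh2 : measurable_fun disk2 (EFin \o h2).
  apply/measurable_EFinP; apply: measurable_funTS.
  exact: (measurableT_comp (strip_kernel_measurable _ _ _ _) (@measurable_swap _ _ _ _)).
apply: (@le_trans _ _ (\int[leb2]_(p in disk2) (k%:E * ((EFin \o h1) p + (EFin \o h2) p)))%E).
  apply: ge0_le_integral_nonmeasurable => p Dp; first by rewrite lee_fin mulr_ge0 ?powR_ge0.
  rewrite /= -EFinD -EFinM lee_fin mulrDr.
  have zE : rnorm (mkC p) ^+ 2 = p.1 ^+ 2 + p.2 ^+ 2 by rewrite rnorm_sqr.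
  have [p21|p12] := leP `|p.2| `|p.1|.
    apply: le_trans (_ : k * h1 p <= _); last by rewrite lerDl mulr_ge0// ltW.
    apply: (kernel_le_strip a1 b0 Dw Dp zE) => //.
    exact: (Im_lipschitz (mkC p) w).
  apply: le_trans (_ : k * h2 p <= _); last by rewrite lerDr mulr_ge0// ltW.
  rewrite addrC in zE; apply: (kernel_le_strip a1 b0 Dw Dp zE); last exact: ltW.
  exact: (Re_lipschitz (mkC p) w).
rewrite ge0_integralZl_EFin//; last first.
- exact: ltW.
- exact: emeasurable_funD.
- by move=> p _; rewrite adde_ge0// lee_fin.
- exact: disk2_measurable.
have e1 := @ge0_integralD _ _ R leb2 disk2 (disk2_measurable (R := R)) (EFin \o h1) (EFin \o h2)
  (fun p _ => h1_ge0 p) mh1 (fun p _ => h2_ge0 p) mh2.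
rewrite [X in (_ * X <= _)%E](_ : _ = \int[leb2]_(p in disk2) (h1 p)%:E +
    \int[leb2]_(p in disk2) (h2 p)%:E)%E; last exact: e1.
apply: (@le_trans _ _ (k%:E * ((4 / (a + 1) / b * d `^ (- b))%:E + (4 / (a + 1) / b * d `^ (- b))%:E))%E).
  apply: lee_wpmul2l; first by rewrite lee_fin ltW.
  by apply: leeD; [exact: strip_kernel_integral|exact: strip_kernel_integral_swap].
rewrite -EFinD -EFinM lee_fin le_eqVlt; apply/orP; left; apply/eqP.
by move: (d `^ (- b)) => e; field; rewrite !gt_eqF.
Qed.

End forelli_rudin.

(** * Normal weights and the weighted Forelli-Rudin estimate *)

Section weights.
Context {R : realType}.
Local Notation leb := (@lebesgue_measure R).
Local Notation leb2 := (leb \x leb)%E.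
Implicit Types (nu : radial_weight R) (w z : R[i]).

Lemma weight_rnorm nu z : disk z -> nu z = nu (rnorm z)%:C.
Proof. by move=> Dz; rewrite {1}weight_radial// normE. Qed.

Lemma weight_le nu z w : disk z -> disk w -> rnorm z <= rnorm w -> nu w <= nu z.
Proof. by move=> Dz Dw zw; apply: weight_ninc => //; rewrite !normE lecR. Qed.

Lemma weight_cont nu z : disk z -> forall e : R, 0 < e -> exists2 d : R, 0 < d &
  forall w, rnorm (w - z) < d -> `|nu w - nu z| < e.
Proof.
move=> Dz e e0; have /(_ z) := @weight_continuous R nu; rewrite inE => /(_ Dz).
move=> /cvgrPdist_lt/(_ _ e0)/nbhs_rnormP[d d0 h]; exists d => // w /h.
by rewrite distrC.
Qed.

Lemma weight_cont_V nu z : disk z -> forall e : R, 0 < e -> exists2 d : R, 0 < d &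
  forall w, rnorm (w - z) < d -> `|(nu w)^-1 - (nu z)^-1| < e.
Proof.
move=> Dz e e0; have n0 := weight_gt0 nu Dz.
have k0 : 0 < Num.min (nu z / 2) (e * nu z ^+ 2 / 2).
  by rewrite lt_min !divr_gt0// mulr_gt0// exprn_gt0.
have [d d0 h] := weight_cont nu Dz k0; exists d => // w /h.
rewrite lt_min => /andP[h1 h2].
have w0 : nu z / 2 < nu w by move: h1; rewrite ltr_norml => /andP[]; lra.
have w1 : 0 < nu w by apply: lt_trans w0; rewrite divr_gt0.
have -> : (nu w)^-1 - (nu z)^-1 = - (nu w - nu z) / (nu w * nu z).
  by field; rewrite !gt_eqF.
rewrite normrM normrN normfV (gtr0_norm (mulr_gt0 w1 n0)) ltr_pdivrMr ?mulr_gt0//.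
apply: lt_le_trans h2 _; rewrite -mulrA ler_pM2l// expr2 mulrAC ler_wpM2r//; exact: ltW.
Qed.

Lemma weight_V_measurable nu : measurable_fun disk2 (fun p => (nu (mkC p))^-1).
Proof.
apply: continuous_measurable2 => [|p Dp e e0]; first exact: disk2_open2.
by have [d d0 h] := weight_cont_V nu Dp e0; exists d => // q /h.
Qed.

Lemma jac_measurable : measurable_fun [set: R * R] (fun p => 1 - rnorm (mkC p) ^+ 2).
Proof.
rewrite (_ : (fun p => _) = (fun p : R * R => 1 - (p.1 ^+ 2 + p.2 ^+ 2))); last first.
  by apply/funext => p; rewrite rnorm_sqr.
apply: measurable_funB => //; apply: measurable_funD; apply: measurable_funX.
  exact: measurable_fst.
exact: measurable_snd.
Qed.

Lemma kden_measurable w : measurable_fun [set: R * R] (fun p => rnorm (kden w (mkC p))).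
Proof.
apply: (@ccont_measurable _ setT (@rnorm R R[i]) (fun z => kden w z)).
- exact: rnorm_lipschitz.
- exact: open2T.
- by move=> z _; apply: wdiff_cont; exact: wdiff_kden.
Qed.

Lemma powR_div (x y b : R) : 0 < x -> 0 < y -> (x / y) `^ b = x `^ b / y `^ b.
Proof.
move=> x0 y0; rewrite powRM ?(ltW x0) ?invr_ge0 ?(ltW y0)//.
by rewrite -[y^-1]powR_inv1 ?(ltW y0)// -powRrM mulN1r powRN.
Qed.

Lemma weight_ratio_I nu beta : exponent_I nu beta -> exists2 C : R, 0 < C &
  forall z w, disk z -> disk w -> rnorm w <= rnorm z ->
    nu w <= C * nu z * ((1 - rnorm w ^+ 2) / (1 - rnorm z ^+ 2)) `^ beta.
Proof.
move=> [b0 [C C0 h]]; exists C => // z w Dz Dw wz.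
have dz := jac_real_gt0 Dz; have dw := jac_real_gt0 Dw.
have := h _ _ (rnorm_ge0 w) wz; rewrite -diskE => /(_ Dz).
rewrite -!weight_rnorm// ler_pdivrMr ?powR_gt0// => h1; apply: le_trans h1 _.
rewrite powR_div// le_eqVlt; apply/orP; left; apply/eqP.
by move: (_ `^ beta) (_ `^ beta) => u v; ring.
Qed.

Lemma weight_ratio_II nu gamma : exponent_II nu gamma -> exists2 C : R, 0 < C &
  forall z w, disk z -> disk w -> rnorm z <= rnorm w ->
    nu w <= C * nu z * ((1 - rnorm w ^+ 2) / (1 - rnorm z ^+ 2)) `^ gamma.
Proof.
move=> [b0 [C C0 h]]; exists C => // z w Dz Dw wz.
have dz := jac_real_gt0 Dz; have dw := jac_real_gt0 Dw.
have := h _ _ (rnorm_ge0 z) wz; rewrite -diskE => /(_ Dw).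
rewrite -!weight_rnorm// ler_pdivrMr ?powR_gt0// => h1; apply: le_trans h1 _.
rewrite powR_div// le_eqVlt; apply/orP; left; apply/eqP.
by move: (_ `^ gamma) (_ `^ gamma) => u v; ring.
Qed.

(** Where [|w| <= |z|], condition (I) bounds [1 / nu z] by [1 / nu w] times a power of
    [(1 - |w|^2) / (1 - |z|^2)]; elsewhere condition (II) does. Either way the weight moves to the
    point [w], and the unweighted estimate applies with [a] equal to [alpha] minus the exponent. *)
Lemma weighted_forelli_rudin nu (alpha : R) :
  (exists2 beta, exponent_I nu beta & beta - 1 < alpha) ->
  (exists gamma, exponent_II nu gamma) ->
  exists2 C : R, 0 < C & forall w, disk w ->
  (\int[leb2]_(p in disk2) ((1 - rnorm (mkC p) ^+ 2) `^ alpha / nu (mkC p) *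
      rnorm (kden w (mkC p)) `^ (- (alpha + 2)))%:E <= (C / nu w)%:E)%E.
Proof.
move=> [beta eI ba] [gamma0 eII].
have b0 := eI.1; have g00 := eII.1.
have [C1 C10 h1] := weight_ratio_I eI; have [C2 C20 h2] := weight_ratio_II eII.
(* The exponent is lowered to keep [-1 < alpha - gamma]. This is allowed because the ratio raised to
   it is at most 1 in the region where condition (II) is used. *)
pose gamma := Num.min gamma0 ((alpha + 1) / 2).
have g0 : 0 < gamma by rewrite lt_min g00 divr_gt0//; lra.
have ga : gamma <= (alpha + 1) / 2 by rewrite ge_min lexx orbT.
have gg : gamma <= gamma0 by rewrite ge_min lexx.
have ab : -1 < alpha - beta by lra.
have ag : -1 < alpha - gamma by lra.
have [K1 K10 k1] := forelli_rudin ab b0.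
have [K2 K20 k2] := forelli_rudin ag g0.
exists (C1 * K1 + C2 * K2); first by rewrite addr_gt0// mulr_gt0.
move=> w Dw; have nw := weight_gt0 nu Dw; have dw := jac_real_gt0 Dw.
pose H (b : R) (p : R * R) := (1 - rnorm (mkC p) ^+ 2) `^ (alpha - b) *
  rnorm (kden w (mkC p)) `^ (- (alpha - b + 2 + b)).
have H0 b p : 0 <= H b p by rewrite mulr_ge0 ?powR_ge0.
have mH b : measurable_fun disk2 (H b).
  apply: measurable_funTS; apply: measurable_funM.
    exact: (measurableT_comp (measurable_powR _) jac_measurable).
  exact: (measurableT_comp (measurable_powR _) (kden_measurable w)).
have mHA (A b : R) : measurable_fun disk2 (fun p => A * H b p).
  by apply: measurable_funM => //; exact: mH.
pose A1 := C1 * (1 - rnorm w ^+ 2) `^ beta / nu w.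
pose A2 := C2 * (1 - rnorm w ^+ 2) `^ gamma / nu w.
have A10 : 0 <= A1 by rewrite !mulr_ge0 ?invr_ge0 ?powR_ge0 ?ltW.
have A20 : 0 <= A2 by rewrite !mulr_ge0 ?invr_ge0 ?powR_ge0 ?ltW.
have ratio (b : R) z : disk z -> ((1 - rnorm w ^+ 2) / (1 - rnorm z ^+ 2)) `^ b =
    (1 - rnorm w ^+ 2) `^ b * (1 - rnorm z ^+ 2) `^ (- b).
  by move=> /jac_real_gt0 dz; rewrite powR_div// powRN.
have HE (b C : R) p : disk2 p ->
    (1 - rnorm (mkC p) ^+ 2) `^ alpha * rnorm (kden w (mkC p)) `^ (- (alpha + 2)) *
    (C * ((1 - rnorm w ^+ 2) / (1 - rnorm (mkC p) ^+ 2)) `^ b / nu w) =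
    C * (1 - rnorm w ^+ 2) `^ b / nu w * H b p.
  move=> Dp; rewrite ratio// /H powRD; last by rewrite (gt_eqF (jac_real_gt0 Dp)) implybT.
  have -> : alpha - b + 2 + b = alpha + 2 by ring.
  move: (_ `^ alpha) (_ `^ - b) (_ `^ - (alpha + 2)) (_ `^ b) => x1 x2 x3 x4.
  ring.
have pointwise p : disk2 p ->
   (1 - rnorm (mkC p) ^+ 2) `^ alpha / nu (mkC p) * rnorm (kden w (mkC p)) `^ (- (alpha + 2))
   <= A1 * H beta p + A2 * H gamma p.
  move=> Dp; have dz := jac_real_gt0 Dp; have nz := weight_gt0 nu Dp.
  rewrite mulrAC.
  have [wz|zw] := leP (rnorm w) (rnorm (mkC p)).
    apply: le_trans (_ : A1 * H beta p <= _); last by rewrite lerDl mulr_ge0.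
    rewrite -HE// ler_wpM2l ?mulr_ge0 ?powR_ge0//.
    rewrite ler_pdivlMr// ler_pdivrMl// mulrCA mulrA; exact: h1.
  apply: le_trans (_ : A2 * H gamma p <= _); last by rewrite lerDr mulr_ge0.
  rewrite -HE// ler_wpM2l ?mulr_ge0 ?powR_ge0//.
  rewrite ler_pdivlMr// ler_pdivrMl// mulrCA mulrA.
  apply: le_trans (h2 _ _ Dp Dw (ltW zw)) _; rewrite ler_wpM2l ?mulr_ge0 ?(ltW C20) ?(ltW nz)//.
  have r0 : 0 < (1 - rnorm w ^+ 2) / (1 - rnorm (mkC p) ^+ 2) by rewrite divr_gt0.
  apply: ger_powR => //; rewrite r0/= ler_pdivrMr// mul1r lerD2l lerN2.
  by rewrite lerXn2r ?nnegrE ?rnorm_ge0// ltW.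
have e1 := @ge0_integralD _ _ R leb2 disk2 (disk2_measurable (R := R))
  (fun p => (A1 * H beta p)%:E) (fun p => (A2 * H gamma p)%:E).
apply: (@le_trans _ _ (\int[leb2]_(p in disk2) ((A1 * H beta p)%:E + (A2 * H gamma p)%:E))%E).
  apply: ge0_le_integral_nonmeasurable => p Dp; last by rewrite -EFinD lee_fin pointwise.
  by rewrite lee_fin !mulr_ge0 ?powR_ge0 ?invr_ge0// ltW// weight_gt0.
have i1 (A b : R) : 0 <= A -> (\int[leb2]_(p in disk2) (A * H b p)%:E =
    A%:E * \int[leb2]_(p in disk2) (H b p)%:E)%E.
  move=> A0; under eq_integral do rewrite EFinM.
  rewrite ge0_integralZl_EFin//; first exact: disk2_measurable.
    by move=> p _; rewrite lee_fin.
  by apply/measurable_EFinP; exact: mH.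
rewrite [leLHS]e1.
- rewrite !i1//; apply: (@le_trans _ _ (A1%:E * (K1 * (1 - rnorm w ^+ 2) `^ (- beta))%:E +
     A2%:E * (K2 * (1 - rnorm w ^+ 2) `^ (- gamma))%:E)%E).
    by apply: leeD; apply: lee_wpmul2l; rewrite ?lee_fin//; [exact: k1|exact: k2].
  rewrite -!EFinM -EFinD lee_fin /A1 /A2 !powRN le_eqVlt; apply/orP; left; apply/eqP.
  move: (powR_gt0 beta dw) (powR_gt0 gamma dw).
  by move: (_ `^ beta) (_ `^ gamma) => u v u0 v0; field; rewrite !gt_eqF.
- by move=> p _; rewrite lee_fin mulr_ge0.
- by apply/measurable_EFinP; exact: mHA.
- by move=> p _; rewrite lee_fin mulr_ge0.
- by apply/measurable_EFinP; exact: mHA.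
Qed.

End weights.

(** * The reproducing formula in weighted spaces *)

Section reproducing_formula.
Context {R : realType}.
Local Notation leb := (@lebesgue_measure R).
Local Notation leb2 := (leb \x leb)%E.
Implicit Types (nu : radial_weight R) (f : R[i] -> R[i]) (w z : R[i]).

Lemma rnorm_cvg_unique (u : nat -> R[i]) a b : rnorm (u n - a) @[n --> \oo] --> (0 : R) ->
  rnorm (u n - b) @[n --> \oo] --> (0 : R) -> a = b.
Proof.
move=> ua ub; apply/eqP; rewrite -subr_eq0 -rnorm_eq0P -[_ == _]negbK.
apply/negP => ab0; have {}ab0 : 0 < rnorm (a - b) by rewrite lt_def ab0 rnorm_ge0.
have e0 : 0 < rnorm (a - b) / 2 by rewrite divr_gt0.
near \oo => n.
have h1 : rnorm (u n - a) < rnorm (a - b) / 2.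
  rewrite -[ltLHS]ger0_norm ?rnorm_ge0// -normrN -sub0r; near: n.
  by move/cvgrPdist_lt: ua; apply.
have h2 : rnorm (u n - b) < rnorm (a - b) / 2.
  rewrite -[ltLHS]ger0_norm ?rnorm_ge0// -normrN -sub0r; near: n.
  by move/cvgrPdist_lt: ub; apply.
have : rnorm (a - b) <= rnorm (u n - a) + rnorm (u n - b).
  have -> : a - b = (u n - b) - (u n - a) by rewrite opprB [RHS]addrC addrA subrK.
  rewrite [leRHS]addrC; exact: rnormB.
by apply/negP; rewrite -ltNge; lra.
Unshelve. all: by end_near. Qed.

Lemma Hinf_bound nu f z : Hinf_set nu f -> disk z ->
  rnorm (f z) <= fine (weighted_norm nu f) / nu z.
Proof.
move=> [_ nf] Dz; have := weighted_norm_ub nu f Dz.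
by rewrite -(fineK (fin_weighted_norm nf)) lee_fin ler_pdivlMr ?weight_gt0// mulrC.
Qed.

Lemma forelli_rudin_measurable nu (a c : R) w : measurable_fun disk2 (fun p =>
  (1 - rnorm (mkC p) ^+ 2) `^ a / nu (mkC p) * rnorm (kden w (mkC p)) `^ c).
Proof.
apply: measurable_funM; last first.
  exact: measurable_funTS (measurableT_comp (measurable_powR _) (kden_measurable w)).
apply: measurable_funM; last exact: weight_V_measurable.
exact: measurable_funTS (measurableT_comp (measurable_powR _) jac_measurable).
Qed.

(** The surplus power [(1 - |z|^2)^(N - alpha)] is absorbed by the kernel through
    [1 - |z|^2 <= 2 |kden w z|]. *)
Lemma rnorm_bergman_le (alpha : R) N w z : alpha <= N%:R -> disk w -> disk z ->
  rnorm (bergman N w z) <= 2 `^ (N%:R - alpha) *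
    ((1 - rnorm z ^+ 2) `^ alpha * rnorm (kden w z) `^ (- (alpha + 2))).
Proof.
move=> aN Dw Dz; have dz := jac_real_gt0 Dz; have K0 := kden_gt0 Dw Dz.
have := kden_ge_boundary_l Dw Dz.
rewrite rnorm_bergman//; move: (rnorm (kden w z)) (1 - _) K0 dz => k d k0 d0 dk.
rewrite -!powR_mulrn ?(ltW k0) ?(ltW d0)//.
have -> : d `^ N%:R = d `^ alpha * d `^ (N%:R - alpha).
  by rewrite -powRD ?(gt_eqF d0) ?implybT// addrC subrK.
have -> : k `^ (- (alpha + 2)) = k `^ (N%:R - alpha) / k `^ N.+2%:R.
  rewrite -powRN -powRD ?(gt_eqF k0) ?implybT//; congr powR.
  by rewrite -[N.+2]addn2 natrD; ring.
have h : d `^ (N%:R - alpha) <= 2 `^ (N%:R - alpha) * k `^ (N%:R - alpha).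
  rewrite -powRM ?(ltW k0)//; apply: ge0_ler_powR; rewrite ?subr_ge0// nnegrE ?(ltW d0)//.
  by rewrite mulr_ge0 ?(ltW k0).
have e0 : 0 < d `^ alpha / k `^ N.+2%:R by rewrite divr_gt0 ?powR_gt0.
move: h; rewrite -(ler_pM2l e0).
move: (d `^ alpha) (d `^ _) (2 `^ _) (k `^ (_ - _)) (k `^ _)^-1 => x1 x2 x3 x4 x5.
by rewrite mulrAC => h; apply: le_trans h _; rewrite le_eqVlt; apply/orP; left; apply/eqP; ring.
Qed.

Lemma weighted_bergman_integral nu (alpha : R) N : alpha <= N%:R ->
  (exists2 beta, exponent_I nu beta & beta - 1 < alpha) ->
  (exists gamma, exponent_II nu gamma) ->
  exists2 C : R, 0 < C & forall w, disk w ->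
  (\int[leb2]_(p in disk2) (rnorm (bergman N w (mkC p)) / nu (mkC p))%:E <= (C / nu w)%:E)%E.
Proof.
move=> aN eI eII; have [C C0 h] := weighted_forelli_rudin eI eII.
pose k : R := 2 `^ (N%:R - alpha).
have k0 : 0 < k by rewrite powR_gt0.
exists (k * C); first by rewrite mulr_gt0.
move=> w Dw.
apply: (@le_trans _ _ (\int[leb2]_(p in disk2) (k%:E * ((1 - rnorm (mkC p) ^+ 2) `^ alpha / nu (mkC p) *
      rnorm (kden w (mkC p)) `^ (- (alpha + 2)))%:E))%E).
  apply: ge0_le_integral_nonmeasurable => p Dp; have nz := weight_gt0 nu Dp.
    by rewrite lee_fin divr_ge0 ?rnorm_ge0// ltW.
  rewrite -EFinM lee_fin mulrAC mulrA ler_wpM2r ?invr_ge0 ?(ltW nz)//.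
  exact: rnorm_bergman_le.
rewrite ge0_integralZl_EFin//; first last.
- exact: ltW.
- by apply/measurable_EFinP; exact: forelli_rudin_measurable.
- by move=> p Dp; rewrite lee_fin !mulr_ge0 ?powR_ge0 ?invr_ge0// ltW// weight_gt0.
- exact: disk2_measurable.
rewrite -mulrA EFinM; apply: lee_wpmul2l; first by rewrite lee_fin ltW.
exact: h.
Qed.

Lemma bergman_measurable nu N w : disk w ->
  measurable_fun disk2 (fun p => rnorm (bergman N w (mkC p)) / nu (mkC p)).
Proof.
move=> Dw; apply: measurable_funM; last exact: weight_V_measurable.
apply: (@ccont_measurable _ disk (@rnorm R R[i]) (bergman N w)).
- exact: rnorm_lipschitz.
- exact: disk2_open2.
- by move=> z Dz; exact: bergman_cont.
Qed.

Definition bergman_integrable nu N w :=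
  leb2.-integrable disk2 (fun p => (rnorm (bergman N w (mkC p)) / nu (mkC p))%:E).

Lemma weighted_bergman_integrable nu (alpha : R) N w : alpha <= N%:R ->
  (exists2 beta, exponent_I nu beta & beta - 1 < alpha) ->
  (exists gamma, exponent_II nu gamma) -> disk w -> bergman_integrable nu N w.
Proof.
move=> aN eI eII Dw; have [C _ h] := weighted_bergman_integral aN eI eII.
apply/integrableP; split.
  by apply/measurable_EFinP; exact: bergman_measurable.
apply: le_lt_trans (ltry (C / nu w)); apply: le_trans (h w Dw).
apply: ge0_le_integral_nonmeasurable => p Dp //=.
by rewrite lee_fin ger0_norm// divr_ge0 ?rnorm_ge0// ltW// weight_gt0.
Qed.

Lemma Hinf_analytic nu f z : Hinf_set nu f -> disk z -> exists a, wdiff f z a 0.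
Proof. by move=> [[df _] _] Dz; exists (derive1 f z); apply: derivable_wdiff; exact: df. Qed.

(** The dilations [F n] of [f] are bounded on the disk and obey the formula already proved. Since
    [nu] decreases with the modulus, the bound [M / nu] for [f] also holds for all dilations, and
    dominated convergence applies. *)
Lemma reproducing_Hinf nu f N w : (0 < N)%N -> bergman_integrable nu N w ->
  Hinf_set nu f -> disk w ->
  cint leb2 disk2 (fun p => f (mkC p) * bergman N w (mkC p)) = (bergman_const N)%:C * f w.
Proof.
move=> N0 iB hf Dw; set M := fine (weighted_norm nu f).
have af z : disk z -> exists a, wdiff f z a 0 by move=> Dz; exact: Hinf_analytic hf Dz.
have M0 : 0 <= M by rewrite fine_ge0// weighted_norm_ge0.
pose r (n : nat) : R := 1 - n.+1%:R^-1.
have r0 n : 0 <= r n by rewrite subr_ge0 invf_le1 ?ler1n.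
have r1 n : r n < 1 by rewrite gtrBl invr_gt0.
have rz n z : disk z -> rnorm ((r n)%:C * z) <= r n.
  rewrite diskE => z1; rewrite rnormM rnorm_real ger0_norm//.
  by rewrite -[leRHS]mulr1 ler_wpM2l// ltW.
have rz' n z : rnorm ((r n)%:C * z) <= rnorm z.
  by rewrite rnormM rnorm_real ger0_norm// ler_piMl ?rnorm_ge0// ltW.
have Drz n z : disk z -> disk ((r n)%:C * z).
  by move=> Dz; rewrite diskE (le_lt_trans (rz n z Dz)).
pose F n z := f ((r n)%:C * z).
have aF n z : disk z -> exists a, wdiff (F n) z a 0.
  move=> Dz; have [a ha] := af _ (Drz n z Dz).
  rewrite -[X in wdiff f X]add0r in ha.
  have := wdiff_affine ha; rewrite mul0r => h; exists (a * (r n)%:C).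
  apply: (wdiff_near _ h); exists 1 => // y _; by rewrite /F add0r.
have rF n : cint leb2 disk2 (fun p => F n (mkC p) * bergman N w (mkC p)) = (bergman_const N)%:C * F n w.
  have [K hK] := holomorphic_bounded hf.1 (r0 n) (r1 n).
  by apply: (@reproducing_bounded _ (F n) K) => //; [exact: aF|move=> z Dz; apply: hK; exact: rz].
have cvF z : disk z -> rnorm (F n z - f z) @[n --> \oo] --> (0 : R).
  move=> Dz; have [a ha] := af z Dz; have ca := wdiff_cont ha.
  apply/cvgrPdist_lt => e e0; have [d d0 h] := ca e e0.
  near=> n; rewrite sub0r normrN ger0_norm ?rnorm_ge0//; apply: h.
  have -> : (r n)%:C * z - z = (- n.+1%:R^-1)%:C * z.
    by rewrite /r rmorphB rmorph1 mulrBl mul1r addrAC subrr add0r rmorphN mulNr.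
  rewrite rnormM rnorm_real normrN gtr0_norm ?invr_gt0//.
  apply: (@le_lt_trans _ _ n.+1%:R^-1).
    by rewrite ler_piMr ?invr_ge0// ltW// -diskE.
  by near: n; exact: (near_infty_natSinv_lt (PosNum d0)).
have mF n : cmeasurable disk2 (fun p => F n (mkC p) * bergman N w (mkC p)).
  apply: (@cmeasurable_disk _ (fun z => F n z * bergman N w z)) => z Dz.
  by have [a /wdiff_cont ca] := aF n z Dz; apply: ccontM => //; exact: bergman_cont.
have iMB : leb2.-integrable disk2 (EFin \o (fun p => M * (rnorm (bergman N w (mkC p)) / nu (mkC p)))).
  by apply: integrableZ_EFin; [exact: disk2_measurable|exact: iB].
have lim1 := @cint_dominated _ _ R leb2 disk2 (fun n p => F n (mkC p) * bergman N w (mkC p))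
  (fun p => f (mkC p) * bergman N w (mkC p)) (fun p => M * (rnorm (bergman N w (mkC p)) / nu (mkC p)))
  (disk2_measurable (R := R)) mF iMB.
have {}lim1 : rnorm ((bergman_const N)%:C * F n w - cint leb2 disk2 (fun p => f (mkC p) * bergman N w (mkC p)))
    @[n --> \oo] --> (0 : R).
  under eq_fun do rewrite -rF; apply: lim1.
    move=> p Dp; under eq_fun do rewrite -mulrBl rnormM.
    have h := cvgM (cvF _ Dp) (cvg_cst (rnorm (bergman N w (mkC p)))).
    by rewrite mul0r in h; exact: h.
  move=> n p Dp; rewrite rnormM [leRHS]mulrCA mulrC ler_wpM2l ?rnorm_ge0//.
  have nz := weight_gt0 nu Dp.
  apply: (@le_trans _ _ (M / nu ((r n)%:C * mkC p))); first exact: (Hinf_bound hf (Drz n _ Dp)).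
  have nrz := weight_gt0 nu (Drz n _ Dp).
  by rewrite ler_wpM2l// lef_pV2 ?posrE//; exact: weight_le (Drz n _ Dp) Dp (rz' n _).
have lim2 : rnorm ((bergman_const N)%:C * F n w - (bergman_const N)%:C * f w) @[n --> \oo] --> (0 : R).
  under eq_fun do rewrite -mulrBr rnormM.
  have h := cvgM (cvg_cst (rnorm ((bergman_const N)%:C : R[i]))) (cvF _ Dw).
  by rewrite mulr0 in h; exact: h.
exact: rnorm_cvg_unique lim1 lim2.
Unshelve. all: by end_near. Qed.

End reproducing_formula.

(** * Growth of primitives *)

Section ray_integrals.
Context {R : realType}.
Local Notation leb := (@lebesgue_measure R).
Implicit Types (F f g : R[i] -> R[i]) (z w : R[i]).

Lemma near_itvoo (a b x : R) : a < x -> x < b -> \forall y \near x, a < y < b.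
Proof.
move=> ax xb; exists (Num.min (x - a) (b - x)); first by rewrite /= lt_min !subr_gt0 ax.
by move=> y /=; rewrite lt_min !ltr_norml => /andP[/andP[? ?] /andP[? ?]]; apply/andP; split; lra.
Qed.

(* The integral is [H s - H 0] for a primitive [H] of [h], since [t |-> H (t * s)] is a
   primitive of [t |-> h (t * s) * s]. *)
Lemma ray_integral_derive (h : R -> R) (a b : R) : a < 0 -> 1 < b ->
  (forall x, a <= x <= b -> {for x, continuous h}) ->
  is_derive (1 : R) 1 (fun s : R => \int[leb]_(t in `[0, 1]) (h (t * s) * s)) (h 1).
Proof.
move=> a0 b1 ch; have b0 : 0 < b by lra.
pose H (x : R) := \int[leb]_(t in `[a, x]) h t.
have ih : leb.-integrable `[a, b] (EFin \o h).
  apply: continuous_compact_integrable; first exact: segment_compact.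
  by apply: continuous_in_subspaceT => x; rewrite inE/= in_itv/= => /ch.
have dH x : a < x < b -> is_derive x 1 H (h x).
  move=> /andP[ax xb].
  have [|dx ex] := @continuous_FTC1_closed R h a x b xb ih ax.
    by apply: ch; rewrite !ltW.
  by rewrite derive1E in ex; exact: DeriveDef dx ex.
have cH x : a < x < b -> {for x, continuous H}.
  move=> /dH d; apply: differentiable_continuous; apply/derivable1_diffP.
  exact: ex_derive.
have E s : 0 < s < b -> \int[leb]_(t in `[0, 1]) (h (t * s) * s) = H s - H 0.
  move=> /andP[s0 sb].
  have in_ab t : 0 <= t <= 1 -> a < t * s < b.
    by move=> /andP[t0 t1]; apply/andP; split; nra.
  have ds (t : R) : is_derive t 1 (fun t : R => t * s) s.
    have h1 := is_deriveZ s (is_derive_id t (1 : R)).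
    by rewrite (_ : (fun t => _) = s \*: id); [apply: (is_derive_eq h1); rewrite /GRing.scale/= mulr1|
      apply/funext => y /=; rewrite mulrC].
  have dF (t : R) : 0 <= t <= 1 -> is_derive t 1 (fun t : R => H (t * s)) (h (t * s) * s).
    by move=> t01; exact: (@is_derive1_comp R H (fun t => t * s) t _ _ (dH _ (in_ab t t01)) (ds t)).
  have cF (t : R) : 0 <= t <= 1 -> {for t, continuous (fun t : R => H (t * s))}.
    move=> /dF d; apply: differentiable_continuous; apply/derivable1_diffP.
    exact: ex_derive.
  have := @continuous_FTC2 R (fun t => h (t * s) * s) (fun t => H (t * s)) 0 1 ltr01.
  rewrite mul1r mul0r /Rintegral => -> //.
  - apply: continuous_in_subspaceT => t; rewrite inE/= in_itv/= => t01.
    have cg : {for t, continuous (fun t : R => h (t * s))}.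
      have c1 : {for t, continuous (fun t : R => t * s)}.
        exact: (cvgM cvg_id (cvg_cst s)).
      apply: (@continuous_comp _ _ _ (fun t : R => t * s) h) => //.
      by apply: ch; have /andP[? ?] := in_ab t t01; rewrite !ltW.
    exact: (cvgM cg (cvg_cst s)).
  - split.
    + move=> t; rewrite in_itv/= => /andP[t0 t1].
      have d : is_derive t 1 (fun t : R => H (t * s)) (h (t * s) * s) by apply: dF; rewrite !ltW.
      exact: ex_derive.
    + by apply: cvg_at_right_filter; apply: cF; rewrite lexx ler01.
    + by apply: cvg_at_left_filter; apply: cF; rewrite lexx ler01.
  - move=> t; rewrite in_itv/= => /andP[t0 t1].
    have d : is_derive t 1 (fun t : R => H (t * s)) (h (t * s) * s) by apply: dF; rewrite !ltW.
    by rewrite derive1E; exact: derive_val.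
have dHc : is_derive (1 : R) 1 (fun s => H s - H 0) (h 1).
  have d1 : is_derive (1 : R) 1 H (h 1) by apply: dH; apply/andP; split; lra.
  by have := is_deriveB d1 (is_derive_cst (H 0) (1 : R) (1 : R)); rewrite subr0.
apply: (near_eq_is_derive _ dHc).
near=> s; rewrite E//; near: s; apply: near_itvoo; first exact: ltr01.
by [].
Unshelve. all: by end_near. Qed.

(** [p] is a real-linear functional of norm at most 1: the real part, the imaginary part or the real
    part after a rotation. It turns complex derivatives along a ray into real ones. *)
Lemma wdiff_ray_derive (p : R[i] -> R) G z a (t : R) :
  (forall x y, p (x - y) = p x - p y) -> (forall (t : R) x, p (t%:C * x) = t * p x) ->
  (forall x, `|p x| <= rnorm x) ->
  wdiff G (t%:C * z) a 0 -> is_derive t 1 (fun s : R => p (G (s%:C * z))) (p (a * z)).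
Proof.
move=> pB pZ p_le dG.
have cf : h^-1 *: (((fun s : R => p (G (s%:C * z))) \o shift t) h%:A - p (G (t%:C * z))) @[h --> 0^'] --> p (a * z).
  apply/cvgrPdist_le => e e0.
  have z1 : 0 < rnorm z + 1 by rewrite ltr_wpDl ?rnorm_ge0.
  have [d d0 hd] := dG _ (divr_gt0 e0 z1).
  near=> h.
  have h0 : h != 0 by near: h; exact: nbhs_dnbhs_neq.
  rewrite /= /GRing.scale/= mulr1 distrC.
  have hz : (h + t)%:C * z - t%:C * z = h%:C * z by rewrite rmorphD mulrDl addrK.
  have := hd ((h + t)%:C * z); rewrite mul0r subr0 hz rnormM rnorm_real => /(_ _) h1.
  have {}h1 : rnorm (G ((h + t)%:C * z) - G (t%:C * z) - a * (h%:C * z)) <= e / (rnorm z + 1) * (`|h| * rnorm z).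
    apply: h1; apply: (@le_lt_trans _ _ (`|h| * (rnorm z + 1))).
      by rewrite ler_wpM2l// lerDl.
    rewrite -ltr_pdivlMr//; near: h; apply: dnbhs0_lt; exact: divr_gt0.
  have := le_trans (p_le _) h1.
  rewrite pB pB mulrCA pZ.
  have -> : h^-1 * (p (G ((h + t)%:C * z)) - p (G (t%:C * z))) - p (a * z) =
     h^-1 * (p (G ((h + t)%:C * z)) - p (G (t%:C * z)) - h * p (a * z)).
    by rewrite [RHS]mulrBr mulKf.
  rewrite normrM normfV => h2; rewrite ler_pdivrMl ?normr_gt0//.
  apply: le_trans h2 _; rewrite mulrCA ler_wpM2l//.
  by rewrite -mulrA ler_piMr ?(ltW e0)// mulrC ler_pdivrMr// mul1r lerDl.
apply: DeriveDef; first by apply/cvg_ex; exists (p (a * z)).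
apply/cvg_lim => //.
Unshelve. all: by end_near. Qed.

(** As [G] is analytic, its derivative at [z] is determined along the ray through [z]. There
    [s |-> G (s z)] is a primitive of [F (s z) * z], and dividing by [z] requires [z != 0]. *)
Lemma segment_integral_derive F G z : (forall w, disk w -> ccont F w) ->
  (forall w, disk w -> G w = segment_integral F w) -> analytic_on_disk G ->
  disk z -> z != 0 -> derive1 G z = F z.
Proof.
move=> cF GE aG Dz z0; have z1 : rnorm z < 1 by rewrite -diskE.
have rz0 : 0 < rnorm z by rewrite rnorm_gt0.
(* A number strictly between 1 and [1 / |z|], so that the ray stays in the disk slightly beyond
   [z]. *)
pose b := ((rnorm z)^-1 + 1) / 2.
have b_inv : 1 < (rnorm z)^-1 by rewrite invf_gt1.
have b1 : 1 < b by rewrite /b; lra.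
have bz : b < (rnorm z)^-1 by rewrite /b; lra.
have Dxz (x : R) : - b <= x <= b -> disk (x%:C * z).
  rewrite -ler_norml => xb; rewrite diskE rnormM rnorm_real.
  by rewrite -ltr_pdivlMr// div1r (le_lt_trans xb).
have dG : wdiff G (1%:C * z) (derive1 G z) 0.
  by rewrite mul1r; apply: derivable_wdiff; exact: aG.
have part (p : R[i] -> R) (qI : R[i] -> R) :
   (forall x y, p (x - y) = p x - p y) -> (forall (t : R) x, p (t%:C * x) = t * p x) ->
   (forall x, `|p x| <= rnorm x) ->
   (forall w, p (segment_integral F w) = \int[leb]_(t in `[0, 1]) p (F (t%:C * w) * w)) ->
   p (derive1 G z * z) = p (F z * z).
  move=> pB pZ p_le pI.
  have d1 := wdiff_ray_derive pB pZ p_le dG.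
  pose h (x : R) := p (F (x%:C * z) * z).
  have ch x : - b <= x <= b -> {for x, continuous h}.
    move=> xb; apply/cvgrPdist_lt => e e0.
    have [d d0 hd] := cF _ (Dxz x xb) _ (divr_gt0 e0 rz0).
    near=> y; rewrite distrC /h -pB (le_lt_trans (p_le _))//.
    rewrite -mulrBl rnormM -ltr_pdivlMr//; apply: hd.
    rewrite -mulrBl -rmorphB rnormM rnorm_real -ltr_pdivlMr//.
    near: y; exists (d / rnorm z); first exact: divr_gt0.
    by move=> y /=; rewrite distrC.
  have d2 : is_derive (1 : R) 1 (fun s : R => \int[leb]_(t in `[0, 1]) (h (t * s) * s)) (h 1).
    by apply: (@ray_integral_derive h (- b) b) => //; lra.
  have d3 : is_derive (1 : R) 1 (fun s : R => p (G (s%:C * z))) (h 1).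
    apply: (near_eq_is_derive _ d2); near=> s.
    have sb : - b <= s <= b.
      suff /andP[? ?] : - b < s < b by rewrite !ltW.
      near: s; apply: near_itvoo; lra.
    rewrite GE ?pI; last exact: Dxz.
    apply: eq_Rintegral => t _.
    have -> : t%:C * (s%:C * z) = (t * s)%:C * z by rewrite mulrA rmorphM.
    by rewrite [F _ * _]mulrCA pZ mulrC.
  have e1 := @derive_val _ _ _ _ _ _ _ d1; have e2 := @derive_val _ _ _ _ _ _ _ d3.
  by rewrite -e1 e2 /h mul1r.
have eRe : complex.Re (derive1 G z * z) = complex.Re (F z * z).
  apply: part => //.
  - by move=> [? ?] [? ?].
  - by move=> t [x y]; rewrite /= mul0r subr0.
  - exact: Re_le_rnorm.
have eIm : complex.Im (derive1 G z * z) = complex.Im (F z * z).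
  apply: part => //.
  - by move=> [? ?] [? ?].
  - by move=> t [x y]; rewrite /= mul0r addr0.
  - exact: Im_le_rnorm.
apply: (mulIf z0); move: eRe eIm.
by move: (derive1 G z * z) (F z * z) => [x y] [x' y'] /= -> ->.
Unshelve. all: by end_near. Qed.

(** At 0 the ray degenerates; both sides are continuous there and agree at the nearby points
    [t%:C]. *)
Lemma segment_integral_derive1 F G z : (forall w, disk w -> ccont F w) ->
  (forall w, disk w -> G w = segment_integral F w) -> analytic_on_disk G ->
  disk z -> derive1 G z = F z.
Proof.
move=> cF GE aG Dz; have [z0|] := eqVneq z 0; last exact: segment_integral_derive.
apply/eqP; rewrite -subr_eq0 -rnorm_eq0P; apply/eqP/le_anti; rewrite rnorm_ge0 andbT.
apply/ler_addgt0Pr => e e0; rewrite add0r; have e2 : 0 < e / 2 by rewrite divr_gt0.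
have [d1 d10 h1] := analytic_derive1_cont aG Dz e2.
have [d2 d20 h2] := cF z Dz _ e2.
pose t := Num.min (Num.min (d1 / 2) (d2 / 2)) 2^-1.
have t0 : 0 < t by rewrite !lt_min (divr_gt0 d10)// (divr_gt0 d20)//= invr_gt0.
have td1 : t < d1 by rewrite !gt_min ltr_pdivrMr// ltr_pMr// ltr1n.
have td2 : t < d2 by rewrite !gt_min [X in _ || X || _]ltr_pdivrMr// ltr_pMr// ltr1n orbT.
have t1 : t < 1 by rewrite !gt_min invf_lt1 ?ltr1n ?orbT.
have rt : rnorm (t%:C - z) = t by rewrite z0 subr0 rnorm_real gtr0_norm.
have Dt : disk (t%:C : R[i]) by rewrite diskE rnorm_real gtr0_norm.
have tn0 : t%:C != 0 :> R[i] by rewrite -rnorm_gt0 rnorm_real gtr0_norm.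
have := h1 t%:C; rewrite rt => /(_ td1); rewrite (segment_integral_derive cF GE aG Dt tn0) => k1.
have := h2 t%:C; rewrite rt => /(_ td2) k2.
rewrite (_ : derive1 G z - F z = (F t%:C - F z) - (F t%:C - derive1 G z)); last by ring.
by rewrite (le_trans (rnormB _ _))// (splitr e) ltW// ltrD.
Qed.

End ray_integrals.

Section bloch_growth.
Context {R : realType}.
Implicit Types (mu nu : radial_weight R) (G f g : R[i] -> R[i]) (z w : R[i]).

Lemma mvt_le (q P dq p : R -> R) (a b : R) : a < b ->
  (forall t, a <= t <= b -> is_derive t 1 q (dq t)) ->
  (forall t, a <= t <= b -> is_derive t 1 P (p t)) ->
  (forall t, a < t < b -> dq t <= p t) -> q b - q a <= P b - P a.
Proof.
move=> ab hq hP le.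
have d t : a <= t <= b -> is_derive t 1 (P - q) (p t - dq t).
  by move=> t_ab; exact: is_deriveB (hP t t_ab) (hq t t_ab).
have [||c cab] := @MVT R (P - q) (fun t => p t - dq t) a b ab.
- by move=> t; rewrite in_itv/= => /andP[t1 t2]; apply: d; rewrite !ltW.
- apply: continuous_in_subspaceT => t; rewrite inE/= in_itv/= => /d h.
  apply: differentiable_continuous; apply/derivable1_diffP; exact: ex_derive.
rewrite in_itv/= in cab; rewrite [(P - q) b]/= [(P - q) a]/= => e.
have : 0 <= (p c - dq c) * (b - a).
  by rewrite mulr_ge0 ?subr_ge0 ?le// ltW.
by rewrite -e !fctE; lra.
Qed.

Lemma ray_growth G z (P p : R -> R) (s : R) : analytic_on_disk G -> disk z -> 0 <= s < 1 ->
  (forall t, s <= t <= 1 -> is_derive t 1 P (p t)) ->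
  (forall t, s < t < 1 -> rnorm (derive1 G (t%:C * z) * z) <= p t) ->
  rnorm (G z - G (s%:C * z)) <= P 1 - P s.
Proof.
move=> aG Dz /andP[s0 s1] dP le.
have Dtz t : s <= t <= 1 -> disk (t%:C * z).
  move=> /andP[st t1]; have t0 : 0 <= t by lra.
  move: Dz; rewrite !diskE rnormM rnorm_real ger0_norm//; apply: le_lt_trans.
  by rewrite ler_piMl ?rnorm_ge0.
(* Multiplication by the phase [u] turns [D] into its modulus, so that a real mean value argument
   yields the complex estimate. If [D = 0], then [u = 0] by the convention for inverses. *)
set D := G z - G (s%:C * z); pose u := conjc D * (rnorm D)^-1%:C.
have u1 : rnorm u <= 1.
  rewrite rnormM rnorm_conj rnorm_real normfV ger0_norm ?rnorm_ge0//.
  by have [->|D0] := eqVneq (rnorm D) 0; [rewrite mul0r|rewrite mulfV].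
pose f x := complex.Re (u * x).
have fB x y : f (x - y) = f x - f y by rewrite /f mulrBr; case: (u * x) (u * y) => ? ? [? ?].
have fZ (t : R) x : f (t%:C * x) = t * f x.
  by rewrite /f mulrCA; case: (u * x) => a b /=; rewrite mul0r subr0.
have f_le x : `|f x| <= rnorm x.
  by rewrite (le_trans (Re_le_rnorm _))// rnormM ler_piMl// rnorm_ge0.
have dq t : s <= t <= 1 -> is_derive t 1 (fun t : R => f (G (t%:C * z))) (f (derive1 G (t%:C * z) * z)).
  move=> /Dtz Dt; apply: wdiff_ray_derive => //.
  by apply: derivable_wdiff; exact: aG.
have := mvt_le s1 dq dP; rewrite mul1r -fB => h.
have -> : rnorm D = f D.
  rewrite /f /u mulrAC rnorm_conjM -rmorphM/= expr2.
  by have [->|D0] := eqVneq (rnorm D) 0; [rewrite !mul0r|rewrite mulfK].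
apply: h => t st; apply: le_trans (le t st); exact: le_trans (ler_norm _) (f_le _).
Qed.

(** Condition (II), comparing [mu z] with [mu (t z)], bounds the derivative along the ray by a
    multiple of [(1 - t r)^(-gamma-1)]. Integration gives [(1 - r)^-gamma], which the factor
    [(1 - r^2)^gamma] compensates up to [2^gamma]. The starting point [s] allows hypotheses that
    hold only near the circle. *)
Lemma bloch_growth mu gamma : exponent_II mu gamma -> exists2 C : R, 0 < C &
  forall G z (M s : R), analytic_on_disk G -> disk z -> 0 <= M -> 0 <= s < 1 ->
  (forall t, s < t < 1 -> (1 - rnorm (t%:C * z) ^+ 2) * mu (t%:C * z) *
     rnorm (derive1 G (t%:C * z)) <= M) ->
  mu z * rnorm (G z - G (s%:C * z)) <= C * M.
Proof.
move=> eII; have g0 := eII.1; have [C C0 hC] := weight_ratio_II eII.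
exists (C * 2 `^ gamma / gamma); first by rewrite divr_gt0// mulr_gt0// powR_gt0.
move=> G z M s aG Dz M0 /andP[s0 s1] GM; have muz := weight_gt0 mu Dz.
have z1 : rnorm z < 1 by rewrite -diskE.
set r := rnorm z in z1 *; have r0 : 0 <= r by exact: rnorm_ge0.
pose K := M * C * (1 - r ^+ 2) `^ gamma / mu z.
have K0 : 0 <= K by rewrite divr_ge0 ?(ltW muz)// !mulr_ge0 ?powR_ge0// ltW.
pose P (t : R) := K / gamma * (1 - t * r) `^ (- gamma).
pose p (t : R) := K * r * (1 - t * r) `^ (- gamma - 1).
have y0 t : s <= t <= 1 -> 0 < 1 - t * r by move=> /andP[st t1]; nra.
have dP t : s <= t <= 1 -> is_derive t 1 P (p t).
  move=> /y0 yt.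
  have d1 : is_derive t 1 (fun t : R => 1 - t * r) (- r).
    have h := is_deriveB (is_derive_cst (1 : R) t 1) (is_deriveZ r (is_derive_id t (1 : R))).
    rewrite (_ : (fun t => _) = cst 1 - r \*: id); last by apply/funext => y; rewrite !fctE mulrC.
    by apply: (is_derive_eq h); rewrite sub0r /GRing.scale/= mulr1.
  have d2 := @is_derive1_comp R (fun y : R => y `^ (- gamma)) (fun t : R => 1 - t * r) t _ _
    (is_derive1_powR (- gamma) yt) d1.
  have d3 := is_deriveZ (K / gamma) d2.
  apply: (is_derive_eq d3); rewrite /GRing.scale/= /p.
  by move: (_ `^ _) => u; field; rewrite gt_eqF.
have le t : s < t < 1 -> rnorm (derive1 G (t%:C * z) * z) <= p t.
  move=> /[dup] st /andP[st1 t1]; have t0 : 0 < t by lra.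
  have yt : 0 < 1 - t * r by apply: y0; rewrite !ltW.
  have rw : rnorm (t%:C * z) = t * r by rewrite rnormM rnorm_real gtr0_norm.
  have rtr : t * r <= r by rewrite ler_piMl// ltW.
  have Dw : disk (t%:C * z) by rewrite diskE rw (le_lt_trans rtr).
  have muw := weight_gt0 mu Dw; have dw := jac_real_gt0 Dw; have dz := jac_real_gt0 Dz.
  have := hC _ _ Dw Dz; rewrite rw => /(_ rtr).
  rewrite rw in dw; have := GM t st; rewrite (rnormM (derive1 G (t%:C * z))) -/r rw.
  move: (rnorm (derive1 G _)) (rnorm_ge0 (derive1 G (t%:C * z))) => A A0 h1 h2.
  have y1 : 1 - t * r <= 1 - (t * r) ^+ 2 by rewrite lerD2l lerN2 expr2 ler_piMl ?mulr_ge0 ?(ltW t0)//; lra.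
  rewrite powR_div// in h2.
  have y2 : (1 - (t * r) ^+ 2) `^ (- gamma - 1) <= (1 - t * r) `^ (- gamma - 1).
    rewrite -opprD !powRN lef_pV2 ?posrE ?powR_gt0//.
    by apply: ge0_ler_powR; rewrite ?nnegrE ?(ltW yt) ?(ltW dw)// addr_ge0// ltW.
  rewrite /p /K mulrC -mulrA mulrCA ler_wpM2l//.
  apply: le_trans (_ : M * C * (1 - r ^+ 2) `^ gamma / mu z * (1 - (t * r) ^+ 2) `^ (- gamma - 1) <= _); last first.
    by rewrite ler_wpM2l.
  have -> : (1 - (t * r) ^+ 2) `^ (- gamma - 1) = ((1 - (t * r) ^+ 2) `^ gamma)^-1 / (1 - (t * r) ^+ 2).
    by rewrite powRD ?(gt_eqF dw) ?implybT// powRN powR_inv1 ?(ltW dw).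
  have pw : 0 < (1 - (t * r) ^+ 2) `^ gamma by rewrite powR_gt0.
  rewrite [leRHS]mulrA ler_pdivlMr// mulrAC ler_pdivlMr//.
  apply: (@le_trans _ _ (A * (1 - (t * r) ^+ 2) * (C * mu (t%:C * z) *
     ((1 - r ^+ 2) `^ gamma / (1 - (t * r) ^+ 2) `^ gamma)))).
    by rewrite ler_wpM2l ?mulr_ge0// ltW.
  have q0 : 0 <= C * ((1 - r ^+ 2) `^ gamma / (1 - (t * r) ^+ 2) `^ gamma).
    by rewrite mulr_ge0 ?divr_ge0 ?powR_ge0 ?(ltW C0).
  move: (ler_wpM2r q0 h1); move: ((1 - r ^+ 2) `^ gamma) ((1 - (t * r) ^+ 2) `^ gamma)^-1 => u v h3.
  rewrite (_ : A * _ * _ = (1 - (t * r) ^+ 2) * mu (t%:C * z) * A * (C * (u * v))); last by ring.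
  by apply: le_trans h3 _; rewrite !mulrA.
have := ray_growth aG Dz (introT andP (conj s0 s1)) dP le.
have Ps : 0 <= P s by rewrite mulr_ge0 ?powR_ge0// divr_ge0// ltW.
move=> h; rewrite mulrC -ler_pdivlMr//; apply: le_trans h _.
apply: (@le_trans _ _ (P 1)); first by rewrite gerBl.
have y1 : 0 < 1 - r by rewrite subr_gt0.
rewrite /P mul1r powRN /K.
have -> : 1 - r ^+ 2 = (1 - r) * (1 + r) by ring.
rewrite powRM ?(ltW y1) ?addr_ge0//.
have p0 : 0 < (1 - r) `^ gamma by rewrite powR_gt0.
have p2 : (1 + r) `^ gamma <= 2 `^ gamma.
  by apply: ge0_ler_powR; rewrite ?nnegrE ?addr_ge0// ?(ltW g0)//; lra.
have c0 : 0 <= M * C / gamma / mu z by rewrite !mulr_ge0 ?invr_ge0// ltW.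
move: (ler_wpM2l c0 p2); move: ((1 - r) `^ gamma) p0 ((1 + r) `^ gamma) (2 `^ gamma) => a a0 b c h.
rewrite (_ : _ * a^-1 = M * C / gamma / mu z * b); last by field; rewrite !gt_eqF.
by apply: le_trans h _; rewrite le_eqVlt; apply/orP; left; apply/eqP; field; rewrite !gt_eqF.
Qed.

Lemma bloch_growth0 mu gamma : exponent_II mu gamma -> exists2 C : R, 0 < C &
  forall G z (M : R), analytic_on_disk G -> G 0 = 0 -> disk z -> 0 <= M ->
  (forall w, disk w -> (1 - rnorm w ^+ 2) * mu w * rnorm (derive1 G w) <= M) ->
  mu z * rnorm (G z) <= C * M.
Proof.
move=> /bloch_growth[C C0 h]; exists C => // G z M aG G0 Dz M0 GM.
have := h G z M 0 aG Dz M0; rewrite lexx ltr01 mul0r G0 subr0; apply=> // t /andP[t0 t1].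
apply: GM; move: Dz; rewrite !diskE rnormM rnorm_real gtr0_norm//; apply: le_lt_trans.
by rewrite ler_piMl ?rnorm_ge0// ltW.
Qed.

(** [G z] is compared with its value at the point of modulus [s] on the same ray. The increment is
    small by the growth estimate on the outer part of the ray; the value is bounded by [K], and
    [mu z * K] tends to 0. *)
Lemma vanishing_growth mu gamma G : exponent_II mu gamma -> holomorphic G ->
  vanishes_at_boundary (fun z => (1 - rnorm z ^+ 2) * mu z * rnorm (derive1 G z)) ->
  vanishes_at_boundary (fun z => mu z * rnorm (G z)).
Proof.
move=> eII hG vG e e0; have [C C0 hC] := bloch_growth eII.
have g0 := eII.1; have [C' C'0 hC'] := weight_ratio_II eII.
have e2C : 0 < e / (2 * C) by rewrite divr_gt0// mulr_gt0.
have [rho rho1 hrho] := vG _ e2C.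
pose s := Num.max rho 2^-1.
have s1 : s < 1 by rewrite gt_max rho1 invf_lt1// ltr1n.
have s0 : 0 < s by rewrite lt_max invr_gt0 ltr0n orbT.
have [K hK] := holomorphic_bounded hG (ltW s0) s1.
have K0 : 0 <= K by apply: le_trans (rnorm_ge0 (G 0)) (hK _ _); rewrite rnorm0 ltW.
have m0 := weight_gt0 mu (disk0 (R := R)).
pose k := C' * mu 0 * (K + 1).
have k0 : 0 < k by rewrite !mulr_gt0// ltr_wpDl.
(* Chosen so that [1 - |z|^2 < d] gives [k * (1 - |z|^2)^gamma < e / 2], a bound for [mu z * K] by
   condition (II) at 0. *)
pose d := (e / (2 * k)) `^ gamma^-1.
have d0 : 0 < d by rewrite powR_gt0// divr_gt0// mulr_gt0.
exists (Num.max s (1 - d / 2)); first by rewrite gt_max s1 gtrBl divr_gt0.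
move=> z /andP[]; rewrite gt_max => /andP[sz dz] z1.
have Dz : disk z by rewrite diskE.
have muz := weight_gt0 mu Dz.
have rz : 0 < rnorm z by apply: lt_trans sz.
rewrite ger0_norm ?mulr_ge0 ?rnorm_ge0 ?(ltW muz)//.
pose t := s / rnorm z.
have t0 : 0 < t by rewrite divr_gt0.
have t1 : t < 1 by rewrite ltr_pdivrMr// mul1r.
have rtz (x : R) : 0 <= x -> rnorm (x%:C * z) = x * rnorm z.
  by move=> x0; rewrite rnormM rnorm_real ger0_norm.
have GD : mu z * rnorm (G z - G (t%:C * z)) <= C * (e / (2 * C)).
  apply: hC => //; first exact: hG.1.
  - exact: ltW.
  - by rewrite t1 ltW.
  - move=> x /andP[tx x1]; have x0 : 0 < x by apply: lt_trans tx.
    have xz : rnorm (x%:C * z) < 1 by rewrite rtz ?(ltW x0)// (lt_trans _ z1)// gtr_pMl.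
    apply: ltW; apply: le_lt_trans (ler_norm _) (hrho _ _); rewrite xz andbT.
    rewrite rtz ?(ltW x0)//; apply: (@le_lt_trans _ _ s); first by rewrite le_max lexx.
    by rewrite -ltr_pdivrMr.
have Gt : rnorm (G (t%:C * z)) <= K.
  by apply: hK; rewrite rtz ?(ltW t0)// /t divfK// gt_eqF.
have small : mu z * K < e / 2.
  have := hC' _ _ (disk0 (R := R)) Dz; rewrite rnorm0 expr0n subr0 divr1 => /(_ (ltW rz)) h.
  have dz0 := jac_real_gt0 Dz.
  have dzd : 1 - rnorm z ^+ 2 < d.
    by move: dz z1 rz; move: (rnorm z) => r h1 h2 h3; nra.
  have : (1 - rnorm z ^+ 2) `^ gamma < d `^ gamma.
    by apply: gt0_ltr_powR; rewrite ?nnegrE ?(ltW dz0) ?(ltW d0).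
  rewrite -powRrM mulVf ?gt_eqF// powRr1; last by rewrite ltW// divr_gt0// mulr_gt0.
  have k2 : 0 < 2 * k by rewrite mulr_gt0.
  rewrite ltr_pdivlMr// => h2.
  apply: (@le_lt_trans _ _ (mu z * (K + 1))); first by rewrite ler_wpM2l ?(ltW muz)// lerDl.
  apply: (@le_lt_trans _ _ (C' * mu 0 * (1 - rnorm z ^+ 2) `^ gamma * (K + 1))).
    by rewrite ler_wpM2r// addr_ge0.
  rewrite ltr_pdivlMr//; apply: le_lt_trans h2; rewrite le_eqVlt; apply/orP; left; apply/eqP.
  rewrite /k; ring.
have e2 : C * (e / (2 * C)) = e / 2 by field; rewrite gt_eqF.
rewrite e2 in GD; apply: (@le_lt_trans _ _ (mu z * rnorm (G z - G (t%:C * z)) + mu z * K)).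
  rewrite -mulrDr ler_wpM2l ?(ltW muz)// -[X in rnorm X](subrK (G (t%:C * z))).
  by rewrite (le_trans (rnormD _ _))// lerD2l.
by rewrite (splitr e) ler_ltD.
Qed.

(** If [|w| <= |z|], monotonicity suffices. Otherwise condition (I) applies, with [1 - |z|^2 <= 2 (1
    - |z|) <= 4 (1 - |w|) <= 4 (1 - |w|^2)]. *)
Lemma weight_comparable nu beta : exponent_I nu beta -> exists2 C : R, 0 < C &
  forall z w, disk z -> disk w -> 1 - rnorm z <= 2 * (1 - rnorm w) -> nu z <= C * nu w.
Proof.
move=> eI; have b0 := eI.1; have [C C0 hC] := weight_ratio_I eI.
exists (1 + C * 4 `^ beta); first by rewrite addr_gt0// mulr_gt0// powR_gt0.
move=> z w Dz Dw zw; have nz := weight_gt0 nu Dz; have nw := weight_gt0 nu Dw.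
rewrite mulrDl mul1r; have [wz|zw'] := leP (rnorm w) (rnorm z).
  apply: le_trans (weight_le nu Dw Dz wz) _.
  by rewrite lerDl !mulr_ge0 ?powR_ge0// ltW.
apply: le_trans (hC _ _ Dw Dz (ltW zw')) _.
rewrite -[leLHS]add0r lerD ?(ltW nw)// mulrAC ler_wpM2r ?(ltW nw)// ler_wpM2l ?(ltW C0)//.
have dz := jac_real_gt0 Dz; have dw := jac_real_gt0 Dw.
apply: ge0_ler_powR; rewrite ?nnegrE ?divr_ge0 ?(ltW dz) ?(ltW dw) ?(ltW b0)//.
rewrite ler_pdivrMr//; have := rnorm_ge0 w; have := rnorm_ge0 z.
by move: Dz Dw zw zw'; rewrite !diskE; move: (rnorm z) (rnorm w) => r s; nra.
Qed.

(** Cauchy's estimate is used on the disk of radius [(1 - |z|) / 2] around [z], on which [mu] is at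
    least a constant multiple of [mu z]. *)
Lemma bloch_cauchy mu beta : exponent_I mu beta -> exists2 C : R, 0 < C &
  forall G z (M : R), analytic_on_disk G -> disk z ->
  (forall w, disk w -> mu w * rnorm (G w) <= M) ->
  (1 - rnorm z ^+ 2) * mu z * rnorm (derive1 G z) <= C * M.
Proof.
move=> /weight_comparable[C C0 hC]; have [C' C'0 hC'] := @cauchy_estimate R.
exists (4 * C' * C); first by rewrite !mulr_gt0.
move=> G z M aG Dz GM; have muz := weight_gt0 mu Dz.
have z1 : rnorm z < 1 by rewrite -diskE.
pose r := (1 - rnorm z) / 2.
have r0 : 0 < r by rewrite divr_gt0// subr_gt0.
have M0 : 0 <= M.
  by apply: le_trans (GM _ Dz); rewrite mulr_ge0 ?rnorm_ge0// ltW.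
have near_w w : rnorm (w - z) < r -> disk w /\ 1 - rnorm z <= 2 * (1 - rnorm w).
  move=> wz; have := rnorm_sub w z; rewrite diskE; split; rewrite /r in wz; lra.
have h := hC' G z r (C * M / mu z) r0.
have {h}h : rnorm (derive1 G z) <= C' * (C * M / mu z) / r.
  apply: h => [w /= /near_w[Dw _]|w /near_w[Dw zw]].
    by exists (derive1 G w); apply: derivable_wdiff; exact: aG.
  have muw := weight_gt0 mu Dw.
  rewrite ler_pdivlMr// mulrC; apply: le_trans (_ : C * mu w * rnorm (G w) <= _).
    by rewrite ler_wpM2r ?rnorm_ge0// hC.
  by rewrite -mulrA ler_wpM2l ?(ltW C0)// GM.
have dz : 1 - rnorm z ^+ 2 <= 4 * r.
  by move: (rnorm_ge0 z) z1; rewrite /r; move: (rnorm z) => x x0 x1; nra.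
rewrite -mulrA; apply: le_trans (_ : 4 * r * (mu z * rnorm (derive1 G z)) <= _).
  by rewrite ler_wpM2r// mulr_ge0 ?rnorm_ge0// ltW.
apply: le_trans (_ : 4 * r * (mu z * (C' * (C * M / mu z) / r)) <= _).
  have r4 : 0 <= 4 * r by rewrite ltW// mulr_gt0.
  by apply: ler_wpM2l => //; apply: ler_wpM2l => //; exact: ltW.
by rewrite le_eqVlt; apply/orP; left; apply/eqP; field; rewrite !gt_eqF.
Qed.

End bloch_growth.

(** * The operator and the growth of its images *)

Section operator.
Context {R : realType} (nu mu : radial_weight R) (g phi : R[i] -> R[i]).
Context (aG : analytic_on_disk g) (phi_self : analytic_self_map phi).
Implicit Types (f : R[i] -> R[i]) (z w : R[i]).

Definition density z : R := (1 - rnorm z ^+ 2) * mu z * rnorm (derive1 g z).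

Lemma density_ge0 z : disk z -> 0 <= density z.
Proof.
by move=> Dz; rewrite !mulr_ge0 ?rnorm_ge0// ltW// ?weight_gt0// jac_real_gt0.
Qed.

Lemma T_op_derive1 f z : analytic_on_disk f -> analytic_on_disk (T_op g phi f) -> disk z ->
  derive1 (T_op g phi f) z = f (phi z) * derive1 g z.
Proof.
move=> af aT Dz.
apply: (@segment_integral_derive1 _ (fun z => f (phi z) * derive1 g z)) => // w Dw.
  apply: ccontM; last exact: analytic_derive1_cont.
  have cf := wdiff_cont (derivable_wdiff (af _ (phi_self.2 _ Dw))).
  have cp := wdiff_cont (derivable_wdiff (phi_self.1 _ Dw)).
  move=> e e0; have [d d0 hd] := cf e e0; have [d' d'0 hd'] := cp d d0.
  by exists d' => // y /hd'/hd.
by rewrite /T_op mem_set.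
Qed.

Lemma T_op_at0 f : T_op g phi f 0 = 0.
Proof.
rewrite /T_op; case: ifP => // _; rewrite /segment_integral.
by congr (_ +i* _); under eq_Rintegral do rewrite mulr0; rewrite /Rintegral integral0.
Qed.

Lemma T_op_bloch f z : analytic_on_disk f -> analytic_on_disk (T_op g phi f) -> disk z ->
  (1 - rnorm z ^+ 2) * mu z * rnorm (derive1 (T_op g phi f) z) = density z * rnorm (f (phi z)).
Proof.
by move=> af aT Dz; rewrite T_op_derive1// rnormM /density; ring.
Qed.

Lemma T_op_norm_le gamma : exponent_II mu gamma -> exists2 C : R, 0 < C &
  forall f (K : R), 0 <= K -> analytic_on_disk f -> analytic_on_disk (T_op g phi f) ->
  (forall z, disk z -> density z * rnorm (f (phi z)) <= K) ->
  forall z, disk z -> mu z * rnorm (T_op g phi f z) <= C * K.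
Proof.
move=> /bloch_growth0[C C0 hC]; exists C => // f K K0 af aT le z Dz.
apply: hC => //; first exact: T_op_at0.
by move=> w Dw; rewrite T_op_bloch// le.
Qed.

Lemma T_op_norm_ge beta : exponent_I mu beta -> exists2 C : R, 0 < C &
  forall f (M : R), analytic_on_disk f -> analytic_on_disk (T_op g phi f) ->
  (forall z, disk z -> mu z * rnorm (T_op g phi f z) <= M) ->
  forall z, disk z -> density z * rnorm (f (phi z)) <= C * M.
Proof.
move=> /bloch_cauchy[C C0 hC]; exists C => // f M af aT le z Dz.
by rewrite -T_op_bloch//; exact: hC.
Qed.

Lemma T_op_H0 gamma f (B : R) : exponent_II mu gamma ->
  little_bloch (fun z => (1 - rnorm z ^+ 2) * mu z) g ->
  analytic_on_disk f -> holomorphic (T_op g phi f) ->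
  (forall z, disk z -> rnorm (f z) <= B) -> H0_set mu (T_op g phi f).
Proof.
move=> eII [_ vg] af hT fB; split=> //; apply: (vanishing_growth eII hT) => e e0.
have B0 : 0 <= B by apply: le_trans (fB 0 disk0); exact: rnorm_ge0.
have B1 : 0 < B + 1 by rewrite ltr_wpDl.
have [r r1 hr] := vg _ (divr_gt0 e0 B1); exists r => // z /[dup] rz /andP[_ z1].
have Dz : disk z by rewrite diskE.
rewrite (T_op_bloch af hT.1 Dz).
rewrite normrM [X in _ * X]ger0_norm ?rnorm_ge0//.
apply: (@le_lt_trans _ _ (`|density z| * (B + 1))).
  rewrite ler_wpM2l// (le_trans (fB _ (phi_self.2 _ Dz)))// lerDl//.
by rewrite -ltr_pdivlMr//; exact: hr.
Qed.

End operator.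

Section bounded_operator.
Context {R : realType} (nu mu : radial_weight R) (g phi : R[i] -> R[i]).
Context (T_bounded : bounded_between (@Hinf_val R nu) (@Hinf_val R mu) (T_op g phi)).
Implicit Types (f : R[i] -> R[i]) (z w : R[i]).

(** This supplies the analyticity of [T_op g phi f] that the derivative formula takes as a
    hypothesis. *)
Lemma T_op_Hinf f : Hinf_set nu f -> Hinf_set mu (T_op g phi f).
Proof.
move=> hf; have [T hT _] := T_bounded.
rewrite -(hT (MkHinf (mem_set hf : f \in Hinf_pred nu))); exact: HinfP.
Qed.

Lemma T_op_linear (a : R[i]) f h : Hinf_set nu f -> Hinf_set nu h ->
  T_op g phi (a *: f + h) = a *: T_op g phi f + T_op g phi h.
Proof.
move=> hf hh; have [T hT _] := T_bounded.
pose f' := MkHinf (mem_set hf : f \in Hinf_pred nu).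
pose h' := MkHinf (mem_set hh : h \in Hinf_pred nu).
by rewrite -(hT f') -(hT h') -[a *: f + h]/(Hinf_val (a *: f' + h')) -hT linearP.
Qed.

End bounded_operator.

(** * Kernel functions in the weighted spaces *)

Section kernel_functions.
Context {R : realType}.
Implicit Types (nu : radial_weight R) (z w : R[i]).

Definition kernel_fun z (n m : nat) w : R[i] :=
  if w \in disk then w ^+ m / kden w z ^+ n else 0.

Lemma kernel_funE z n m w : disk w -> kernel_fun z n m w = w ^+ m / kden w z ^+ n.
Proof. by move=> Dw; rewrite /kernel_fun mem_set. Qed.

Lemma wdiff_kernel z n m w : disk z -> disk w ->
  exists a, wdiff (fun w => w ^+ m / kden w z ^+ n) w a 0.
Proof.
move=> Dz Dw; have k0 : kden w z ^+ n != 0 by rewrite expf_neq0// kden_neq0.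
have dk : wdiff (fun w => kden w z) w (- conjc z) 0.
  have h := wdiffB (wdiff_cst w 1) (wdiffM (wdiff_cst w (conjc z)) (wdiff_id w)).
  by apply: wdiff_eq h _ _; [rewrite mul0r mulr1 !add0r|rewrite !mulr0 mul0r addr0 subr0].
have h := wdiffM (wdiffX m (wdiff_id w)) (wdiffV (u := fun w => kden w z ^+ n) k0 (wdiffX n dk)).
eexists; apply: wdiff_eq h _ _; first reflexivity.
by rewrite !(mulr0, mul0r, oppr0, addr0).
Qed.

Lemma kernel_fun_le z n m w : disk z -> disk w ->
  rnorm (kernel_fun z n m w) <= ((1 - rnorm z) ^+ n)^-1.
Proof.
move=> Dz Dw; rewrite kernel_funE// rnormM rnormX rnormV rnormX.
have z1 : 0 < 1 - rnorm z by rewrite subr_gt0 -diskE.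
have le : rnorm w ^+ m <= 1 by rewrite exprn_ile1// ?rnorm_ge0// ltW// -diskE.
rewrite -[leRHS]mul1r ler_pM ?exprn_ge0 ?invr_ge0 ?exprn_ge0 ?rnorm_ge0//.
rewrite lef_pV2 ?posrE ?exprn_gt0 ?kden_gt0//.
by rewrite lerXn2r ?nnegrE ?rnorm_ge0 ?(ltW z1) ?kden_ge_r.
Qed.

Lemma kernel_fun_holomorphic z n m : disk z -> holomorphic (kernel_fun z n m).
Proof.
move=> Dz; split=> [w Dw|w Dw]; last by rewrite /kernel_fun memNset.
have [a ha] := wdiff_kernel n m Dz Dw.
have h : wdiff (kernel_fun z n m) w a 0.
  apply: (wdiff_near _ ha); exists (1 - rnorm w); first by rewrite subr_gt0 -diskE.
  move=> y yw; rewrite kernel_funE// diskE; have := rnorm_sub y w; lra.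
have h' := wdiff_derivable h; exact: ex_derive.
Qed.

Lemma bounded_Hinf nu f (B : R) : holomorphic f -> (forall z, disk z -> rnorm (f z) <= B) ->
  Hinf_set nu f.
Proof.
move=> hf fB; split=> //; apply: (@le_lt_trans _ _ (nu 0 * B)%:E); last exact: ltry.
apply: ge_ereal_sup => _ [z Dz <-]; rewrite lee_fin.
apply: ler_pM; rewrite ?rnorm_ge0 ?fB//; first by rewrite ltW// weight_gt0.
by apply: weight_le => //; [exact: disk0|rewrite rnorm0 rnorm_ge0].
Qed.

Lemma weight_vanishes nu gamma : exponent_II nu gamma -> vanishes_at_boundary nu.
Proof.
move=> eII e e0; have g0 := eII.1; have [C C0 hC] := weight_ratio_II eII.
have n0 := weight_gt0 nu (disk0 (R := R)).
have k0 : 0 < C * nu 0 by rewrite mulr_gt0.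
pose d := (e / (C * nu 0)) `^ gamma^-1.
have d0 : 0 < d by rewrite powR_gt0// divr_gt0.
exists (Num.max 0 (1 - d / 2)); first by rewrite gt_max ltr01 gtrBl divr_gt0.
move=> z; rewrite gt_max => /andP[/andP[z0 dz] z1].
have Dz : disk z by rewrite diskE.
have dz0 := jac_real_gt0 Dz.
rewrite gtr0_norm ?weight_gt0//.
have := hC _ _ (disk0 (R := R)) Dz; rewrite rnorm0 expr0n subr0 divr1 => /(_ (ltW z0)) h.
have dzd : 1 - rnorm z ^+ 2 < d.
  by move: dz z1 z0; move: (rnorm z) => r h1 h2 h3; nra.
have : (1 - rnorm z ^+ 2) `^ gamma < d `^ gamma.
  by apply: gt0_ltr_powR; rewrite ?nnegrE ?(ltW dz0) ?(ltW d0).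
rewrite -powRrM mulVf ?gt_eqF// powRr1; last by rewrite ltW// divr_gt0.
by rewrite ltr_pdivlMr// mulrC; exact: le_lt_trans.
Qed.

Lemma bounded_H0 nu gamma f (B : R) : exponent_II nu gamma -> holomorphic f ->
  (forall z, disk z -> rnorm (f z) <= B) -> H0_set nu f.
Proof.
move=> eII hf fB; split=> // e e0.
have B0 : 0 <= B by apply: le_trans (fB 0 disk0); exact: rnorm_ge0.
have B1 : 0 < B + 1 by rewrite ltr_wpDl.
have [r r1 hr] := weight_vanishes eII (divr_gt0 e0 B1); exists r => // z /[dup] rz /andP[_ z1].
have Dz : disk z by rewrite diskE.
rewrite normrM [X in _ * X]ger0_norm ?rnorm_ge0//.
apply: (@le_lt_trans _ _ (`|nu z| * (B + 1))).
  by rewrite ler_wpM2l// (le_trans (fB _ Dz))// lerDl.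
by rewrite -ltr_pdivlMr//; exact: hr.
Qed.

End kernel_functions.

(** * Hyperbolic cells *)

Section cells.
Context {R : realType}.
Local Notation leb := (@lebesgue_measure R).
Local Notation leb2 := (leb \x leb)%E.
Implicit Types (nu : radial_weight R) (z w : R[i]).

Definition rational_point (n : nat) : R[i] :=
  if unpickle n is Some (a, b) then ratr (a : rat) +i* ratr (b : rat) else 0.

(** Rational points outside the disk are replaced by 0. A repeated center only produces an empty
    cell, since [seqDU] removes the earlier balls. *)
Definition cell_center (n : nat) : R[i] :=
  if rnorm (rational_point n) < 1 then rational_point n else 0.

(** The factor 1/4 bounds the relative variation of [kden w] over a cell by 1/4, uniformly in [w];
    it is also the radius within which the kernel will be expanded in a power series. *)
Definition close_to z0 z := rnorm (z - z0) <= (1 - rnorm z0) / 4.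

Definition cell_ball n : set (R * R) :=
  [set p | rnorm (mkC p - cell_center n) < (1 - rnorm (cell_center n)) / 4].

Definition cell : nat -> set (R * R) := seqDU cell_ball.

Lemma cell_center_disk n : disk (cell_center n).
Proof. by rewrite /cell_center diskE; case: ifP => // _; rewrite rnorm0. Qed.

Lemma close_to_cmp z0 z : disk z0 -> close_to z0 z ->
  3 * (1 - rnorm z0) <= 4 * (1 - rnorm z) /\ 4 * (1 - rnorm z) <= 5 * (1 - rnorm z0).
Proof.
rewrite diskE /close_to => D0 h; have := rnorm_sub z z0; have := rnorm_sub z0 z.
by rewrite (rnormBC z0); lra.
Qed.

Lemma close_to_disk z0 z : disk z0 -> close_to z0 z -> disk z.
Proof. by move=> D0 h; have [+ _] := close_to_cmp D0 h; move: D0; rewrite !diskE; lra. Qed.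

(** The two values differ by at most [|z - z0| <= (1 - |z0|) / 4], and [1 - |z0|] is at most the
    modulus of [kden w z0]. *)
Lemma kden_close w z0 z : disk w -> disk z0 -> close_to z0 z ->
  3 * rnorm (kden w z0) <= 4 * rnorm (kden w z) /\
  4 * rnorm (kden w z) <= 5 * rnorm (kden w z0).
Proof.
move=> Dw D0 h; have := kden_ge_r z0 Dw.
have e : kden w z0 - kden w z = conjc (z - z0) * w by rewrite /kden conjcB; ring.
have : rnorm (kden w z0 - kden w z) <= rnorm (z - z0).
  by rewrite e rnormM rnorm_conj ler_piMr ?rnorm_ge0// ltW// -diskE.
have := rnorm_sub (kden w z0) (kden w z); have := rnorm_sub (kden w z) (kden w z0).
by rewrite (rnormBC (kden w z)); move: h; rewrite /close_to; lra.
Qed.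

Lemma cell_ball_measurable n : measurable (cell_ball n).
Proof.
apply: open2_measurable => p; rewrite /cell_ball /= => hp.
exists ((1 - rnorm (cell_center n)) / 4 - rnorm (mkC p - cell_center n)); first by rewrite subr_gt0.
move=> q; rewrite ltrBrDr; apply: le_lt_trans.
by rewrite (le_trans _ (rnormD _ _))// addrA subrK.
Qed.

Lemma cell_measurable n : measurable (cell n).
Proof.
apply: measurableD; first exact: cell_ball_measurable.
by apply: bigsetU_measurable => k _; exact: cell_ball_measurable.
Qed.

Lemma cell_close n p : cell n p -> close_to (cell_center n) (mkC p).
Proof. by move=> [h _]; exact: ltW. Qed.

Lemma cell_disk n : cell n `<=` disk2.
Proof. by move=> p /cell_close; apply: close_to_disk; exact: cell_center_disk. Qed.

Lemma cell_trivIset : trivIset setT cell.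
Proof. exact: trivIset_seqDU. Qed.

Lemma rational_dense z (e : R) : 0 < e -> exists n, rnorm (rational_point n - z) < e.
Proof.
move=> e0; have e4 : 0 < e / 4 by rewrite divr_gt0.
have rat_near (x : R) : exists a : rat, `|ratr a - x| < e / 4.
  have : x - e / 4 < x + e / 4 by lra.
  move=> /rat_in_itvoo[a]; rewrite in_itv/= => /andP[h1 h2]; exists a.
  by rewrite distrC ltr_distlC h1 h2.
have [a ha] := rat_near (complex.Re z); have [b hb] := rat_near (complex.Im z).
exists (pickle (a, b)); rewrite /rational_point pickleK.
rewrite (le_lt_trans (rnorm_le_ReIm _))//.
by case: z ha hb => x y /= ha hb; lra.
Qed.

Lemma cell_cover : \bigcup_n cell n = disk2.
Proof.
apply/seteqP; split=> [p [n _ /cell_disk]//|p Dp].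
rewrite -seqDU_bigcup_eq.
have p1 : rnorm (mkC p) < 1 by rewrite -diskE.
(* A rational point this close to [p] keeps 7/8 of the distance to the circle, so [p] lies well
   within a quarter of that distance from it. *)
have e0 : 0 < (1 - rnorm (mkC p)) / 8 by rewrite divr_gt0// subr_gt0.
have [n hn] := rational_dense (mkC p) e0; exists n => //.
have := rnorm_sub (rational_point n) (mkC p) => h.
rewrite /cell_ball/= /cell_center ifT; last by lra.
by rewrite rnormBC; lra.
Qed.

Lemma cell_integral (F : R * R -> \bar R) : measurable_fun disk2 F ->
  (forall p, disk2 p -> (0 <= F p)%E) ->
  (\int[leb2]_(p in disk2) F p = \sum_(i <oo) \int[leb2]_(p in cell i) F p)%E.
Proof.
move=> mF F0; rewrite -cell_cover; apply: ge0_integral_bigcup => //.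
- exact: cell_measurable.
- by rewrite cell_cover.
- by rewrite cell_cover.
- exact: cell_trivIset.
Qed.

Definition mass_density nu (N : nat) (p : R * R) : R :=
  (1 - rnorm (mkC p) ^+ 2) ^+ N / nu (mkC p).

Definition cell_mass nu N i : R := \int[leb2]_(p in cell i) mass_density nu N p.

Lemma mass_densityE nu N p : disk2 p -> mass_density nu N p = rnorm (bergman N 0 (mkC p)) / nu (mkC p).
Proof.
move=> Dp; rewrite /mass_density rnorm_bergman// /kden mulr0 subr0 rnorm1 expr1n.
by rewrite divr1.
Qed.

Lemma mass_density_ge0 nu N p : disk2 p -> 0 <= mass_density nu N p.
Proof.
move=> Dp; rewrite mass_densityE// divr_ge0 ?rnorm_ge0// ltW// weight_gt0//.
Qed.

Lemma mass_density_measurable nu N : measurable_fun disk2 (mass_density nu N).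
Proof.
apply: measurable_funM; last exact: weight_V_measurable.
by apply: measurable_funX; apply: measurable_funTS; exact: jac_measurable.
Qed.

Lemma mass_density_integrable nu N : bergman_integrable nu N 0 ->
  leb2.-integrable disk2 (EFin \o mass_density nu N).
Proof.
move=> h; apply: eq_integrable h; first exact: disk2_measurable.
by move=> p; rewrite inE => Dp /=; rewrite mass_densityE.
Qed.

Lemma cell_mass_ge0 nu N i : 0 <= cell_mass nu N i.
Proof. by apply: Rintegral_ge0 => p /cell_disk; exact: mass_density_ge0. Qed.

Lemma cell_massE nu N i : bergman_integrable nu N 0 ->
  (cell_mass nu N i)%:E = (\int[leb2]_(p in cell i) (mass_density nu N p)%:E)%E.
Proof.
move=> /mass_density_integrable iB; rewrite /cell_mass /Rintegral fineK//.
apply: integrable_fin_num; first exact: cell_measurable.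
apply: integrableS iB; [exact: disk2_measurable|exact: cell_measurable|exact: cell_disk].
Qed.

(** The Bergman integral is split over the cells, and on each of them [kden w] is replaced by its
    value at the center at the cost [(5 / 4) ^+ N.+2]. The bound is the weak summability of the
    masses times kernel functions in the norm of [nu]. *)
Lemma mass_kernel_sum nu (alpha : R) N : alpha <= N%:R ->
  (exists2 beta, exponent_I nu beta & beta - 1 < alpha) ->
  (exists gamma, exponent_II nu gamma) ->
  exists2 C : R, 0 < C & forall w n, disk w ->
  nu w * \sum_(i < n) cell_mass nu N i / rnorm (kden w (cell_center i)) ^+ N.+2 <= C.
Proof.
move=> aN eI eII; have [C C0 hC] := weighted_bergman_integral aN eI eII.
have iB := weighted_bergman_integrable aN eI eII (disk0 (R := R)).
pose k : R := (5 / 4) ^+ N.+2; have k0 : 0 < k by rewrite exprn_gt0.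
exists (k * C); first by rewrite mulr_gt0.
move=> w n Dw; have nw := weight_gt0 nu Dw.
rewrite -ler_pdivlMl// mulrC -lee_fin -mulrA EFinM.
apply: le_trans (lee_wpmul2l _ (hC w Dw)); last by rewrite lee_fin ltW.
have m1 := bergman_measurable nu N Dw.
have B0 p : disk2 p -> (0 <= (rnorm (bergman N w (mkC p)) / nu (mkC p))%:E)%E.
  by move=> Dp; rewrite lee_fin divr_ge0 ?rnorm_ge0// ltW// weight_gt0.
rewrite [X in (_ * X)%E]cell_integral//; last exact/measurable_EFinP.
apply: le_trans (lee_wpmul2l _ (nneseries_lim_ge (P := xpredT) n _)); last 2 first.
- by rewrite lee_fin ltW.
- by move=> i _ _; apply: integral_ge0 => p /cell_disk; exact: B0.
rewrite big_mkord ge0_sume_distrr; last first.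
  by move=> i _; apply: integral_ge0 => p /cell_disk; exact: B0.
rewrite -sumEFin; apply: lee_sum => i _.
rewrite mulrC EFinM cell_massE// -ge0_integralZl_EFin//; last 4 first.
- exact: cell_measurable.
- by move=> p /cell_disk Dp; rewrite lee_fin mass_density_ge0.
- apply/measurable_EFinP; apply: measurable_funS (mass_density_measurable nu N) => //.
    exact: disk2_measurable.
  exact: cell_disk.
- by rewrite invr_ge0 exprn_ge0 ?rnorm_ge0.
rewrite -ge0_integralZl_EFin//; last 4 first.
- exact: cell_measurable.
- by move=> p /cell_disk; exact: B0.
- apply/measurable_EFinP; apply: measurable_funS m1 => //.
    exact: disk2_measurable.
  exact: cell_disk.
- exact: ltW.
apply: ge0_le_integral_nonmeasurable => p cp; have Dp := cell_disk cp.
  by rewrite -EFinM lee_fin mulr_ge0 ?invr_ge0 ?exprn_ge0 ?rnorm_ge0// mass_density_ge0.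
rewrite -!EFinM lee_fin rnorm_bergman// /mass_density.
have K1 := kden_gt0 Dw Dp; have K0 := kden_gt0 Dw (cell_center_disk i).
rewrite mulrCA [leRHS]mulrA mulrA ler_wpM2r//.
  by rewrite invr_ge0 ltW// weight_gt0.
rewrite mulrCA ler_wpM2l//; first by rewrite exprn_ge0// ltW// jac_real_gt0.
rewrite /k -exprVn -[X in _ <= _ * X]exprVn -exprMn lerXn2r ?nnegrE ?mulr_ge0 ?invr_ge0 ?(ltW K1) ?(ltW K0)//.
have [_ h] := kden_close Dw (cell_center_disk i) (cell_close cp).
rewrite ler_pdivlMr// ler_pdivrMl//; lra.
Qed.

End cells.

Section spaces_norms.
Context {R : realType} (nu : radial_weight R).
Implicit Types z : R[i].

Lemma fine_weighted_norm_le f (C : R) : Hinf_set nu f -> 0 <= C ->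
  (forall z, disk z -> nu z * rnorm (f z) <= C) -> fine (weighted_norm nu f) <= C.
Proof.
move=> [_ /fin_weighted_norm h] C0 fC; rewrite -lee_fin fineK//.
by apply: ge_ereal_sup => _ [z Dz <-]; rewrite lee_fin fC.
Qed.

Lemma le_fine_weighted_norm f z : Hinf_set nu f -> disk z ->
  nu z * rnorm (f z) <= fine (weighted_norm nu f).
Proof.
by move=> hf Dz; rewrite mulrC -ler_pdivlMr ?weight_gt0//; exact: Hinf_bound.
Qed.

Lemma Hinf_le_rnorm (f : Hinf nu) z : disk z -> nu z * rnorm (Hinf_val f z) <= rnorm f.
Proof. by move=> Dz; apply: le_fine_weighted_norm => //; exact: HinfP. Qed.

Lemma H0_rnorm_le (f : H0 nu) (C : R) : 0 <= C ->
  (forall z, disk z -> nu z * rnorm (H0_val f z) <= C) -> rnorm f <= C.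
Proof.
by move=> C0 fC; apply: fine_weighted_norm_le => //; apply: H0_sub_Hinf; exact: H0P.
Qed.

End spaces_norms.

(** * Nuclearity implies the integral condition *)

Section nuclear_sums.
Context {R : realType} {X Y : normedModType R[i]}.

Lemma linear_scale (x' : {linear X -> R[i]}) (a : R[i]) (x : X) : x' (a *: x) = a * x' x.
Proof. by rewrite linearZ. Qed.

Lemma le_dual_norm (x' : {linear X -> R[i]}) (x : X) (C : R) : 0 < C -> rnorm x <= C ->
  ((rnorm (x' x))%:E <= C%:E * dual_norm x')%E.
Proof.
move=> C0 xC; pose y := (C^-1)%:C *: x.
have y1 : rnorm y <= 1.
  by rewrite rnormZ rnorm_real gtr0_norm ?invr_gt0// mulrC ler_pdivrMr// mul1r.
have -> : rnorm (x' x) = C * rnorm (x' y).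
  rewrite linear_scale rnormM rnorm_real gtr0_norm ?invr_gt0//.
  by rewrite mulVKf// gt_eqF.
rewrite EFinM; apply: lee_wpmul2l; first by rewrite lee_fin ltW.
by apply: ereal_sup_ubound; exists y.
Qed.

Lemma dual_norm_ge0 (x' : X -> R[i]) : (0 <= dual_norm x')%E.
Proof.
apply: le_trans (_ : (rnorm (x' 0))%:E <= _)%E; first by rewrite lee_fin rnorm_ge0.
by apply: ereal_sup_ubound; exists 0 => //=; rewrite rnorm0.
Qed.

Lemma rnorm_cvg_series_le (u : nat -> Y) (y : Y) : series u @ \oo --> y ->
  ((rnorm y)%:E <= \sum_(k <oo) (rnorm (u k))%:E)%E.
Proof.
move=> cu.
have h n : ((rnorm (series u n))%:E <= \sum_(k <oo) (rnorm (u k))%:E)%E.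
  apply: le_trans (nneseries_lim_ge (P := xpredT) n _); last by move=> k _ _; rewrite lee_fin rnorm_ge0.
  rewrite sumEFin lee_fin /series/=; elim: n => [|n IH]; first by rewrite !big_geq// rnorm0.
  by rewrite !big_nat_recr//= (le_trans (rnormD _ _))// lerD2r.
move: h; case: (\sum_(k <oo) _)%E => [s| |] h; last 2 first.
- by rewrite leey.
- by have := h 0%N.
rewrite lee_fin.
have cn : rnorm (series u n) @[n --> \oo] --> rnorm y.
  by apply: (@continuous_cvg _ _ _ _ _ _ (@rnorm R Y)) => //; exact: rnorm_continuous.
rewrite -(cvg_lim _ cn)//; apply: limr_le; first by apply/cvg_ex; eexists; exact: cn.
by near=> n; have := h n; rewrite lee_fin.
Unshelve. all: by end_near. Qed.

(* Weakly summable sequences are mapped to absolutely summable ones: for each [k], a choice of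
   the phases [theta] bounds [\sum_i W i * rnorm (x' k (x i))] by [C * dual_norm (x' k)]. *)
Lemma nuclear_weak_sum (T : {linear X -> Y}) (x : nat -> X) (W : nat -> R) (C : R) :
  nuclear T -> 0 < C -> (forall i, 0 <= W i) ->
  (forall n (theta : nat -> R[i]), (forall i, rnorm (theta i) <= 1) ->
    rnorm (\sum_(i < n) (theta i * (W i)%:C) *: x i) <= C) ->
  (\sum_(i <oo) (W i * rnorm (T (x i)))%:E < +oo)%E.
Proof.
move=> [x' [y [_ fin_sum cT]]] C0 W0 xC.
have weak k : (\sum_(i <oo) (W i * rnorm (x' k (x i)))%:E <= C%:E * dual_norm (x' k))%E.
  apply: lime_le; first by apply: is_cvg_nneseries => i _ _; rewrite lee_fin mulr_ge0 ?rnorm_ge0.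
  apply: nearW => n; rewrite sumEFin big_mkord.
  pose theta i := conjc (x' k (x i)) * ((rnorm (x' k (x i)))^-1)%:C.
  have theta1 i : rnorm (theta i) <= 1.
    rewrite rnormM rnorm_conj rnorm_real normfV ger0_norm ?rnorm_ge0//.
    by have [->|D0] := eqVneq (rnorm (x' k (x i))) 0; [rewrite mul0r|rewrite mulfV].
  apply: le_trans (le_dual_norm (x' k) C0 (xC n theta theta1)); rewrite lee_fin.
  rewrite linear_sum /=.
  have -> : \sum_(i < n) x' k ((theta i * (W i)%:C) *: x i) =
      (\sum_(i < n) W i * rnorm (x' k (x i)))%:C.
    rewrite rmorph_sum; apply: eq_bigr => i _; rewrite linear_scale rmorphM.
    rewrite mulrAC mulrC; congr (_ * _); rewrite /theta mulrAC rnorm_conjM -rmorphM/= expr2.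
    by have [->|D0] := eqVneq (rnorm (x' k (x i))) 0; [rewrite !mul0r|rewrite mulfK].
  by rewrite rnorm_real ler_norm.
have Tx i : ((W i * rnorm (T (x i)))%:E <=
    \sum_(k <oo) (W i * rnorm (x' k (x i)) * rnorm (y k))%:E)%E.
  have -> : (\sum_(k <oo) (W i * rnorm (x' k (x i)) * rnorm (y k))%:E =
      (W i)%:E * \sum_(k <oo) (rnorm (x' k (x i) *: y k))%:E)%E.
    rewrite -nneseriesZl; last by move=> k _; rewrite lee_fin rnorm_ge0.
    by apply: eq_eseriesr => k _; rewrite rnormZ -EFinM mulrA.
  rewrite EFinM; apply: lee_wpmul2l; first by rewrite lee_fin.
  exact: rnorm_cvg_series_le.
apply: (@le_lt_trans _ _ (\sum_(i <oo) \sum_(k <oo) (W i * rnorm (x' k (x i)) * rnorm (y k))%:E)%E).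
  by apply: lee_nneseries => // i _ _; rewrite lee_fin mulr_ge0 ?rnorm_ge0.
(* All terms are nonnegative, so the sums may be exchanged; the inner sum over [i] is then covered
   by the weak estimate for the single functional [x' k]. *)
rewrite nneseries_interchange; last by move=> i k; rewrite lee_fin !mulr_ge0 ?rnorm_ge0.
apply: (@le_lt_trans _ _ (C%:E * \sum_(k <oo) (dual_norm (x' k) * (rnorm (y k))%:E))%E); last first.
  by apply: lte_mul_pinfty => //; rewrite lee_fin ltW.
rewrite -nneseriesZl; last by move=> k _; rewrite mule_ge0 ?dual_norm_ge0 ?lee_fin ?rnorm_ge0.
apply: lee_nneseries => [k _ _|k _].
  by apply: nneseries_ge0 => i _ _; rewrite lee_fin !mulr_ge0 ?rnorm_ge0.
under eq_eseriesr do rewrite mulrC EFinM.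
rewrite nneseriesZl; last by move=> i _; rewrite lee_fin mulr_ge0 ?rnorm_ge0.
rewrite muleA muleC; apply: lee_wpmul2r; first by rewrite lee_fin rnorm_ge0.
exact: weak.
Qed.

End nuclear_sums.

Section necessity.
Context {R : realType} (nu mu : radial_weight R) (g phi : R[i] -> R[i]).
Context (aG : analytic_on_disk g) (phi_self : analytic_self_map phi).
Context (nu_II : exists gamma, exponent_II nu gamma).
Context (mu_I : exists beta, exponent_I mu beta).
Context (alpha : R) (nu_I : exists2 beta, exponent_I nu beta & beta - 1 < alpha).
Context (T_bounded : bounded_between (@Hinf_val R nu) (@Hinf_val R mu) (T_op g phi)).
Context (N : nat) (alphaN : alpha <= N%:R).

Lemma kernel_H0 z n m : disk z -> H0_set nu (kernel_fun z n m).
Proof.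
move=> Dz; have [gamma eII] := nu_II.
apply: (bounded_H0 (B := ((1 - rnorm z) ^+ n)^-1) eII) => [|w]; last exact: kernel_fun_le.
exact: kernel_fun_holomorphic.
Qed.

(** The witness is a multiple of the norm of the image of the [i]-th kernel function. The lower
    estimate of the norm of an image turns it into a bound for [density] times the kernel at
    [phi z], uniform in [z]. *)
Lemma nuclear_kernel_masses :
  nuclear_between (@H0_val R nu) (@Hinf_val R mu) (T_op g phi) ->
  exists2 b : nat -> R, (forall i, 0 <= b i) /\
    (\sum_(i <oo) (cell_mass nu N i * b i)%:E < +oo)%E &
    forall i z, disk z -> density mu g z / rnorm (kden (phi z) (cell_center i)) ^+ N.+2 <= b i.
Proof.
move=> [T hT nT]; have [C C0 hC] := mass_kernel_sum alphaN nu_I nu_II.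
have [beta eI] := mu_I; have [K K0 hK] := T_op_norm_ge aG phi_self eI.
pose k i : H0 nu := MkH0 (mem_set (@kernel_H0 (cell_center i) N.+2 0 (cell_center_disk i)) : _ \in H0_pred nu).
exists (fun i => K * rnorm (T (k i))).
  split=> [i|]; first by rewrite mulr_ge0 ?rnorm_ge0// ltW.
  under eq_eseriesr do rewrite mulrCA EFinM.
  rewrite nneseriesZl; last by move=> i _; rewrite lee_fin mulr_ge0 ?rnorm_ge0 ?cell_mass_ge0.
  apply: lte_mul_pinfty => //; first by rewrite lee_fin ltW.
  apply: (nuclear_weak_sum nT C0); first by move=> i; exact: cell_mass_ge0.
  move=> n theta theta1; apply: H0_rnorm_le; first exact: ltW.
  move=> w Dw; have nw := weight_gt0 nu Dw; apply: le_trans (hC w n Dw).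
  rewrite ler_wpM2l ?(ltW nw)//.
  apply: (big_ind2 (fun (f : H0 nu) (r : R) => rnorm (H0_val f w) <= r)) => [|f r f' r' hf hf'|i _].
  - by rewrite (_ : H0_val 0 w = 0)// rnorm0.
  - by rewrite (_ : H0_val (f + f') w = H0_val f w + H0_val f' w)// (le_trans (rnormD _ _))// lerD.
  rewrite [X in rnorm X](_ : _ = (theta i * (cell_mass nu N i)%:C) * kernel_fun (cell_center i) N.+2 0 w)//.
  rewrite kernel_funE// expr0 mul1r !rnormM rnormV rnormX rnorm_real ger0_norm ?cell_mass_ge0//.
  rewrite ler_wpM2r ?invr_ge0 ?exprn_ge0 ?rnorm_ge0// ler_piMl ?cell_mass_ge0//.
move=> i z Dz.
have hk := kernel_H0 N.+2 0 (cell_center_disk i).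
have hki := H0_sub_Hinf hk.
have := hK _ (rnorm (T (k i))) hki.1.1 (T_op_Hinf T_bounded hki).1.1.
move=> /(_ _ z Dz); rewrite kernel_funE; last exact: phi_self.2.
rewrite expr0 mul1r rnormV rnormX; apply => w Dw.
by rewrite -[T_op g phi _](hT (k i)); exact: Hinf_le_rnorm.
Qed.

End necessity.

(** * From cell masses to the integral *)

Section integral_condition.
Context {R : realType} (nu mu : radial_weight R) (g phi : R[i] -> R[i]).
Local Notation leb := (@lebesgue_measure R).
Local Notation leb2 := (leb \x leb)%E.
Context (phi_self : analytic_self_map phi).
Context (nu_II : exists gamma, exponent_II nu gamma).
Context (alpha : R) (nu_I : exists2 beta, exponent_I nu beta & beta - 1 < alpha).
Context (N : nat) (alphaN : alpha <= N%:R).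
Implicit Types (w z zeta : R[i]).

Lemma alpha2_gt0 : 0 < alpha + 2.
Proof. by have [beta [b0 _] ba] := nu_I; lra. Qed.

(* A cell meeting the square of half-side (1 - |w|) / 16 around [w] has its center within
   (1 - |w|) / 2 of [w]. *)
Lemma cell_near w i p : disk w -> cell i p -> rnorm (mkC p - w) <= (1 - rnorm w) / 8 ->
  [/\ 1 - rnorm w <= 2 * (1 - rnorm (cell_center i)),
      rnorm (kden w (cell_center i)) <= 4 * (1 - rnorm w) &
      forall zeta, disk zeta -> rnorm (kden (cell_center i) zeta) <= 2 * rnorm (kden w zeta)].
Proof.
move=> Dw cp pw; set c : R[i] := cell_center i.
have Dc : disk c := @cell_center_disk R i.
have h := cell_close cp; have [h1 h2] := close_to_cmp Dc h.
rewrite /close_to -/c in h h1 h2.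
have := rnorm_sub w (mkC p); have := rnorm_sub (mkC p) w; rewrite (rnormBC w) => k1 k2.
have w1 : rnorm w < 1 by rewrite -diskE.
have c1 : rnorm c < 1 by rewrite -diskE.
have c0 := rnorm_ge0 c.
have wc : rnorm (w - c) <= (1 - rnorm w) / 2.
  have := rnormB (mkC p - c) (mkC p - w).
  by rewrite opprB addrC subrKA; lra.
split.
- lra.
- have -> : kden w c = (1 - rnorm c ^+ 2)%:C - conjc c * (w - c).
    by rewrite -jacE /jac /kden; ring.
  apply: le_trans (rnormB _ _) _; rewrite rnorm_real rnormM rnorm_conj ger0_norm; last first.
    by rewrite ltW// jac_real_gt0.
  move: c0 c1 wc (rnorm_ge0 (w - c)) h1 k1 k2 pw w1.
  by move: (rnorm c) (rnorm w) (rnorm (w - c)) (rnorm (mkC p)) (rnorm (mkC p - w)) => x y t u v *; nra.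
- move=> zeta Dz; have Kw := kden_ge_l w Dz.
  have -> : kden c zeta = kden w zeta + conjc zeta * (w - c) by rewrite /kden; ring.
  rewrite (le_trans (rnormD _ _))// rnormM rnorm_conj.
  have : rnorm zeta * rnorm (w - c) <= rnorm (w - c).
    by rewrite ler_piMl ?rnorm_ge0// ltW// -diskE.
  by lra.
Qed.

Lemma square_near w (p : R * R) (h : R) :
  (`](complex.Re w - h), (complex.Re w - h + 2 * h)] `*`
   `](complex.Im w - h), (complex.Im w - h + 2 * h)])%classic p -> rnorm (mkC p - w) <= 2 * h.
Proof.
move=> [] /=; rewrite !in_itv/= => /andP[a1 a2] /andP[b1 b2].
apply: le_trans (rnorm_le_ReIm _) _; case: w a1 a2 b1 b2 => x y /= a1 a2 b1 b2.
have : `|p.1 - x| <= h by rewrite ler_norml; apply/andP; split; lra.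
have : `|p.2 - y| <= h by rewrite ler_norml; apply/andP; split; lra.
lra.
Qed.

(** Put [d = 1 - |w|]. Cells meeting a square [Q] of side comparable to [d] around [w] carry
    together at least the mass of [Q], of order [d^(N+2) / nu w]. For such a cell [b i] is at least
    [D / (4 d)^(N+2)], and [nu w] and [1 / |kden w zeta|] are controlled by their counterparts at
    the center. The powers of [d] cancel, so [N] disappears and the exponent [alpha + 2] is free. *)
Lemma cell_average : exists2 C : R, 0 < C & forall w zeta (D : R) (b : nat -> R),
  disk w -> disk zeta -> 0 <= D -> (forall i, 0 <= b i) ->
  (forall i, D / rnorm (kden w (cell_center i)) ^+ N.+2 <= b i) ->
  ((D / rnorm (kden w zeta) `^ (alpha + 2))%:E <=
   \sum_(i <oo) (C * (cell_mass nu N i * b i) * nu (cell_center i) *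
      rnorm (kden (cell_center i) zeta) `^ (- (alpha + 2)))%:E)%E.
Proof.
have [beta eI _] := nu_I; have [C C0 hC] := weight_comparable eI.
have a2 := alpha2_gt0.
have iB := weighted_bergman_integrable alphaN nu_I nu_II (disk0 (R := R)).
(* [K] undoes the constants lost in the mass of the square: 64 from its area [(d / 8)^2], [2 ^+ N]
   and [C] from the lower bound [m] of the mass density. *)
pose K : R := 64 * C * 2 ^+ N; have K0 : 0 < K by rewrite !mulr_gt0// exprn_gt0.
pose L : R := 4 ^+ N.+2 * 2 `^ (alpha + 2) * C.
have L0 : 0 < L.
  by apply: mulr_gt0 => //; rewrite mulr_gt0 ?powR_gt0 ?exprn_gt0.
exists (K * L); first by rewrite mulr_gt0.
move=> w zeta D b Dw Dz D0 b0 Db.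
have w1 : rnorm w < 1 by rewrite -diskE.
pose d := 1 - rnorm w; have d0 : 0 < d by rewrite subr_gt0.
have nw := weight_gt0 nu Dw; have kz := kden_gt0 Dw Dz.
pose h := d / 16; have h0 : 0 < h by rewrite divr_gt0.
pose Q : set (R * R) := (`](complex.Re w - h), (complex.Re w - h + 2 * h)] `*`
   `](complex.Im w - h), (complex.Im w - h + 2 * h)])%classic.
have mQ : measurable Q by apply: measurableX; exact: measurable_itv.
have Qnear p : Q p -> rnorm (mkC p - w) <= d / 8.
  by move=> /square_near; rewrite (_ : 2 * h = d / 8)// /h; field.
have Qd p : Q p -> 1 - rnorm (mkC p) <= 2 * d /\ d / 2 <= 1 - rnorm (mkC p).
  move=> /Qnear; have := rnorm_sub w (mkC p); have := rnorm_sub (mkC p) w.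
  by rewrite (rnormBC w) /d; lra.
have Qdisk : Q `<=` disk2 by move=> p /Qd[_ ?]; rewrite /disk2/= diskE; lra.
(* [X] bounds [c i] from below for every cell meeting the square, and [m] bounds the mass density on
   the square; integrating [X * m] over it yields the lower bound for the series. *)
pose X := D / rnorm (kden w zeta) `^ (alpha + 2) * nu w / d ^+ N.+2.
have X0 : 0 <= X by rewrite !mulr_ge0 ?invr_ge0 ?powR_ge0 ?(ltW nw) ?exprn_ge0 ?(ltW d0).
pose m := (d / 2) ^+ N / (C * nu w).
have m0 : 0 < m by rewrite divr_gt0 ?exprn_gt0 ?mulr_gt0 ?divr_gt0.
pose c i := L * b i * nu (cell_center i) * rnorm (kden (cell_center i) zeta) `^ (- (alpha + 2)).
have c0 i : 0 <= c i.
  have nc := weight_gt0 nu (@cell_center_disk R i).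
  by rewrite /c; do 3 (apply: mulr_ge0; last by rewrite ?powR_ge0 ?(ltW nc) ?b0); exact: ltW.
have Xc i p : cell i p -> Q p -> X <= c i.
  move=> cp /Qnear pw; have [h1 h2 h3] := cell_near Dw cp pw.
  have Dc := @cell_center_disk R i.
  have nc := hC w _ Dw Dc h1; have kc := kden_gt0 Dw Dc; have kcz := kden_gt0 Dc Dz.
  have D4 : D <= b i * (4 * d) ^+ N.+2.
    have := Db i; rewrite ler_pdivrMr ?exprn_gt0// => le; apply: le_trans le _.
    by rewrite ler_wpM2l// lerXn2r ?nnegrE ?rnorm_ge0// mulr_ge0// ltW.
  have kk : (rnorm (kden w zeta) `^ (alpha + 2))^-1 <=
      2 `^ (alpha + 2) * rnorm (kden (cell_center i) zeta) `^ (- (alpha + 2)).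
    rewrite powRN ler_pdivlMr ?powR_gt0// mulrC ler_pdivrMr ?powR_gt0//.
    rewrite -powRM ?(ltW kz)//; apply: ge0_ler_powR; rewrite ?nnegrE ?rnorm_ge0 ?(ltW a2)//.
      by rewrite mulr_ge0 ?rnorm_ge0.
    exact: h3.
  rewrite /X ler_pdivrMr ?exprn_gt0//.
  apply: (@le_trans _ _ (b i * (4 * d) ^+ N.+2 * (2 `^ (alpha + 2) *
      rnorm (kden (cell_center i) zeta) `^ (- (alpha + 2))) * (C * nu (cell_center i)))).
    apply: ler_pM => //; first by rewrite mulr_ge0 ?invr_ge0 ?powR_ge0.
      exact: ltW.
    by apply: ler_pM => //; rewrite invr_ge0 powR_ge0.
  rewrite le_eqVlt; apply/orP; left; apply/eqP; rewrite /c /L exprMn.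
  move: (4 ^+ _) (d ^+ _) (_ `^ _) (2 `^ _) (b i) (nu _) => x1 x2 x3 x4 x5 x6; ring.
have mQd p : Q p -> m <= mass_density nu N p.
  move=> Qp; have [q1 q2] := Qd p Qp; have Dp := Qdisk p Qp.
  have np := weight_gt0 nu Dp.
  rewrite /m /mass_density ler_pM ?exprn_ge0 ?invr_ge0 ?(ltW d0)//.
  - by rewrite divr_ge0// ltW.
  - by rewrite ltW// mulr_gt0.
  - have p1 : rnorm (mkC p) < 1 by rewrite -diskE.
    apply: lerXn2r; rewrite ?nnegrE ?divr_ge0 ?(ltW d0) ?(ltW (jac_real_gt0 Dp))//.
    by move: (rnorm_ge0 (mkC p)) p1 q2; move: (rnorm (mkC p)) => x *; nra.
  - by rewrite lef_pV2 ?posrE ?mulr_gt0// hC.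
have areaQ : leb2 Q = (2 * h * (2 * h))%:E.
  by apply: leb2_box; rewrite mulr_ge0// ltW.
have int_Q : ((X * m * (d / 8) ^+ 2)%:E <= \sum_(i <oo) (cell_mass nu N i * c i)%:E)%E.
  have -> : (X * m * (d / 8) ^+ 2)%:E = (\int[leb2]_(p in disk2) (((cst (X * m)%:E) \_ Q) p))%E.
    rewrite -integral_mkcondr (setIidr Qdisk) integral_cst//.
    rewrite [X in (_ * X)%E](_ : _ = (2 * h * (2 * h))%:E); last exact: areaQ.
    rewrite -EFinM.
    by congr (_%:E); congr (_ * _); rewrite /h; field.
  rewrite cell_integral; last 2 first.
  - apply: measurable_funTS.
    by apply: (measurable_restrictT (cst (X * m)%:E) mQ).1; exact: measurable_cst.
  - by move=> p _; apply: erestrict_ge0 => q _; rewrite lee_fin mulr_ge0 ?(ltW m0).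
  apply: lee_nneseries => [i _ _|i _].
    by apply: integral_ge0 => p _; apply: erestrict_ge0 => q _; rewrite lee_fin mulr_ge0 ?(ltW m0).
  rewrite (_ : (cell_mass nu N i * c i)%:E = ((c i)%:E * (cell_mass nu N i)%:E)%E); last first.
    by rewrite -EFinM mulrC.
  rewrite cell_massE// -ge0_integralZl_EFin//; last 3 first.
  - exact: cell_measurable.
  - by move=> p /cell_disk Dp; rewrite lee_fin mass_density_ge0.
  - apply/measurable_EFinP; apply: measurable_funS (mass_density_measurable nu N) => //.
      exact: disk2_measurable.
    exact: cell_disk.
  apply: ge0_le_integral_nonmeasurable => p cp.
    by apply: erestrict_ge0 => q _; rewrite lee_fin mulr_ge0 ?(ltW m0).
  rewrite patchE; case: ifPn => [|_]; last first.
    by rewrite mule_ge0 ?lee_fin ?mass_density_ge0//; exact: cell_disk cp.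
  rewrite inE => Qp; rewrite -EFinM lee_fin /cst.
  by apply: ler_pM; rewrite ?(ltW m0)//; [exact: Xc cp Qp|exact: mQd].
have XE : D / rnorm (kden w zeta) `^ (alpha + 2) = K * (X * m * (d / 8) ^+ 2).
  rewrite /K /X /m !exprMn exprVn; move: (powR_gt0 (alpha + 2) kz).
  move: (_ `^ _) => y y0; rewrite !exprS.
  have dn : d ^+ N != 0 by rewrite expf_neq0// gt_eqF.
  have e2 : (2 ^+ N : R) != 0 by rewrite expf_neq0// pnatr_eq0.
  move: (d ^+ N) (2 ^+ N) dn e2 => u v u0 v0.
  by field; rewrite v0 u0 !gt_eqF.
rewrite XE EFinM; apply: le_trans (lee_wpmul2l _ int_Q) _; first by rewrite lee_fin ltW.
rewrite -nneseriesZl; last by move=> i _; rewrite lee_fin mulr_ge0 ?cell_mass_ge0.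
rewrite le_eqVlt; apply/orP; left; apply/eqP; apply: eq_eseriesr => i _.
rewrite -EFinM; congr (_%:E); rewrite /c.
move: (cell_mass nu N i) (b i) (nu _) (_ `^ _) => x1 x2 x3 x4; ring.
Qed.

(** The cell average is applied at [w = phi z] with [D = density mu g z]. Its right-hand side no
    longer depends on [z], so it bounds the supremum. Integrated termwise, the kernel at a center
    contributes [K / nu] there, which cancels the weight in the average. *)
Lemma masses_integral (b : nat -> R) : (forall i, 0 <= b i) ->
  (\sum_(i <oo) (cell_mass nu N i * b i)%:E < +oo)%E ->
  (forall i z, disk z -> density mu g z / rnorm (kden (phi z) (cell_center i)) ^+ N.+2 <= b i) ->
  (area_integral (fun zeta =>
    ereal_sup [set (density mu g z / rnorm (kden (phi z) zeta) `^ (alpha + 2))%:E | z in disk]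
    * ((1 - rnorm zeta ^+ 2) `^ alpha / nu zeta)%:E) < +oo)%E.
Proof.
move=> b0 sum_b hb; have [C C0 hC] := cell_average.
have [K K0 hK] := weighted_forelli_rudin nu_I nu_II.
pose wt zeta : R := (1 - rnorm zeta ^+ 2) `^ alpha / nu zeta.
have wt0 zeta : disk zeta -> 0 <= wt zeta.
  by move=> Dz; rewrite divr_ge0 ?powR_ge0// ltW// weight_gt0.
pose S zeta := ereal_sup [set (density mu g z / rnorm (kden (phi z) zeta) `^ (alpha + 2))%:E | z in disk].
have S0 zeta : disk zeta -> (0 <= S zeta)%E.
  move=> Dz; apply: ereal_sup_ge; exists (density mu g 0 / rnorm (kden (phi 0) zeta) `^ (alpha + 2))%:E.
    by exists 0 => //; exact: disk0.
  by rewrite lee_fin divr_ge0 ?powR_ge0 ?density_ge0//; exact: disk0.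
pose a i := C * (cell_mass nu N i * b i) * nu (cell_center i).
have a0 i : 0 <= a i.
  have nc := weight_gt0 nu (@cell_center_disk R i).
  by rewrite !mulr_ge0 ?cell_mass_ge0 ?(ltW C0) ?(ltW nc) ?b0.
pose F i (p : R * R) := wt (mkC p) * rnorm (kden (cell_center i) (mkC p)) `^ (- (alpha + 2)).
have F0 i p : disk2 p -> 0 <= F i p by move=> Dp; rewrite mulr_ge0 ?powR_ge0// wt0.
have mF i : measurable_fun disk2 (F i) by exact: forelli_rudin_measurable.
rewrite /area_integral; apply: lte_mul_pinfty => //.
  by rewrite lee_fin invr_ge0 pi_ge0.
apply: (@le_lt_trans _ _ (\int[leb2]_(p in disk2) (\sum_(i <oo) (a i * F i p)%:E))%E).
  apply: ge0_le_integral_nonmeasurable => p Dp.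
    by apply: mule_ge0; [exact: S0|rewrite lee_fin wt0].
  apply: (@le_trans _ _ ((wt (mkC p))%:E * \sum_(i <oo) (a i *
      rnorm (kden (cell_center i) (mkC p)) `^ (- (alpha + 2)))%:E)%E).
    rewrite muleC; apply: lee_wpmul2l; first by rewrite lee_fin wt0.
    apply: ge_ereal_sup => _ [z Dz <-]; apply: hC => //.
    - exact: phi_self.2.
    - exact: density_ge0.
    - by move=> i; exact: hb.
  rewrite -nneseriesZl; last by move=> i _; rewrite lee_fin mulr_ge0 ?powR_ge0.
  rewrite le_eqVlt; apply/orP; left; apply/eqP; apply: eq_eseriesr => i _.
  by rewrite -EFinM mulrCA.
rewrite integral_nneseries; last 3 first.
- exact: disk2_measurable.
- by move=> i; apply/measurable_EFinP; apply: measurable_funM => //; exact: mF.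
- by move=> i p Dp; rewrite lee_fin mulr_ge0// F0.
apply: (@le_lt_trans _ _ (\sum_(i <oo) ((C * K)%:E * (cell_mass nu N i * b i)%:E))%E); last first.
  rewrite nneseriesZl; last by move=> i _; rewrite lee_fin mulr_ge0 ?cell_mass_ge0.
  by apply: lte_mul_pinfty => //; rewrite lee_fin mulr_ge0// ltW.
apply: lee_nneseries => [i _ _|i _].
  by apply: integral_ge0 => p Dp; rewrite lee_fin mulr_ge0// F0.
under eq_integral do rewrite EFinM.
rewrite ge0_integralZl_EFin//; last 3 first.
- exact: disk2_measurable.
- by move=> p Dp; rewrite lee_fin F0.
- by apply/measurable_EFinP; exact: mF.
have Dc := @cell_center_disk R i; have nc := weight_gt0 nu Dc.
apply: (@le_trans _ _ ((a i)%:E * (K / nu (cell_center i))%:E)%E).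
  by apply: lee_wpmul2l; [rewrite lee_fin|exact: hK].
rewrite -!EFinM lee_fin le_eqVlt; apply/orP; left; apply/eqP; rewrite /a.
by field; rewrite gt_eqF.
Qed.

End integral_condition.

(** * From the integral to cell masses *)

Section sufficiency_masses.
Context {R : realType} (nu mu : radial_weight R) (g phi : R[i] -> R[i]).
Local Notation leb := (@lebesgue_measure R).
Local Notation leb2 := (leb \x leb)%E.
Context (aG : analytic_on_disk g) (phi_self : analytic_self_map phi).
Context (nu_II : exists gamma, exponent_II nu gamma).
Context (mu_I : exists beta, exponent_I mu beta).
Context (alpha : R) (nu_I : exists2 beta, exponent_I nu beta & beta - 1 < alpha).
Context (T_bounded : bounded_between (@Hinf_val R nu) (@Hinf_val R mu) (T_op g phi)).
Context (N : nat) (alphaN : alpha <= N%:R).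
Implicit Types (w z zeta : R[i]).

(** [kernel_fun 0 0 0] is the constant 1 on the disk, and the norm of its image controls
    [density]. *)
Lemma density_bounded : exists2 M : R, 0 <= M & forall z, disk z -> density mu g z <= M.
Proof.
have [beta eI] := mu_I; have [K K0 hK] := T_op_norm_ge aG phi_self eI.
have h1 : Hinf_set nu (kernel_fun 0 0 0).
  apply: (bounded_Hinf nu (B := ((1 - rnorm (0 : R[i])) ^+ 0)^-1)).
    by apply: kernel_fun_holomorphic; exact: disk0.
  by move=> w; apply: kernel_fun_le; exact: disk0.
have hT := T_op_Hinf T_bounded h1.
exists (K * fine (weighted_norm mu (T_op g phi (kernel_fun 0 0 0)))).
  by rewrite mulr_ge0 ?(ltW K0) ?fine_ge0 ?weighted_norm_ge0.
move=> z Dz.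
have := hK _ (fine (weighted_norm mu (T_op g phi (kernel_fun 0 0 0)))) h1.1.1 hT.1.1.
move=> /(_ _ z Dz); rewrite kernel_funE; last exact: phi_self.2.
rewrite !expr0 divr1 rnorm1 mulr1; apply => w Dw; exact: le_fine_weighted_norm.
Qed.

Definition cell_index (p : R * R) : nat := xget 0%N [set i | cell i p].

Lemma cell_indexE i p : cell i p -> cell_index p = i.
Proof.
move=> cp; apply: xget_unique => //= j cjp.
apply: contrapT => ij; have /trivIsetP/(_ i j I I) := @cell_trivIset R.
have ne : i != j by apply/eqP => e; apply: ij.
by move=> /(_ ne) e; have : (cell i `&` cell j) p by []; rewrite e.
Qed.

(** The witness [b i] is the supremum itself, finite because [density] is bounded and the center
    lies inside the disk. On a cell the kernel at the center is dominated by the kernel at any other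
    point, and the surplus power is turned into [(1 - |zeta|^2)^alpha] as in [rnorm_bergman_le]. *)
Lemma integral_masses :
  (area_integral (fun zeta =>
    ereal_sup [set (density mu g z / rnorm (kden (phi z) zeta) `^ (alpha + 2))%:E | z in disk]
    * ((1 - rnorm zeta ^+ 2) `^ alpha / nu zeta)%:E) < +oo)%E ->
  exists2 b : nat -> R, (forall i, 0 <= b i) /\
    (\sum_(i <oo) (cell_mass nu N i * b i)%:E < +oo)%E &
    forall i z, disk z -> density mu g z / rnorm (kden (phi z) (cell_center i)) ^+ N.+2 <= b i.
Proof.
have [M M0 hM] := density_bounded.
have iB := weighted_bergman_integrable alphaN nu_I nu_II (disk0 (R := R)).
pose S i := ereal_sup [set (density mu g z / rnorm (kden (phi z) (cell_center i)) ^+ N.+2)%:E | z in disk].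
pose G zeta := ereal_sup [set (density mu g z / rnorm (kden (phi z) zeta) `^ (alpha + 2))%:E | z in disk].
have S_ge0 i : (0 <= S i)%E.
  apply: ereal_sup_ge; exists (density mu g 0 / rnorm (kden (phi 0) (cell_center i)) ^+ N.+2)%:E.
    by exists 0 => //; exact: disk0.
  by rewrite lee_fin divr_ge0 ?exprn_ge0 ?rnorm_ge0 ?density_ge0//; exact: disk0.
have S_fin i : S i \is a fin_num.
  rewrite ge0_fin_numE//.
  apply: le_lt_trans (ltry (M / (1 - rnorm (cell_center i : R[i])) ^+ N.+2)).
  apply: ge_ereal_sup => _ [z Dz <-]; rewrite lee_fin.
  have c1 : 0 < 1 - rnorm (cell_center i : R[i]) by rewrite subr_gt0 -diskE; exact: cell_center_disk.
  apply: ler_pM; rewrite ?density_ge0 ?invr_ge0 ?exprn_ge0 ?rnorm_ge0 ?hM//.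
  have Dp := phi_self.2 _ Dz; have Dc := @cell_center_disk R i.
  rewrite lef_pV2 ?posrE ?exprn_gt0 ?kden_gt0// lerXn2r ?nnegrE ?rnorm_ge0 ?(ltW c1)//.
  exact: kden_ge_r.
pose b i := fine (S i).
have bS i : (b i)%:E = S i by rewrite fineK.
have b0 i : 0 <= b i by rewrite fine_ge0.
have b_ub i z : disk z -> density mu g z / rnorm (kden (phi z) (cell_center i)) ^+ N.+2 <= b i.
  by move=> Dz; rewrite -lee_fin bS; apply: ereal_sup_ubound; exists z.
move=> int_fin; exists b => //; split=> //.
pose K : R := (5 / 4) ^+ N.+2 * 2 `^ (N%:R - alpha).
have K0 : 0 < K by rewrite mulr_gt0 ?powR_gt0// exprn_gt0.
have pointwise i p : cell i p ->
    ((K^-1 * (b i * mass_density nu N p))%:E <=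
     G (mkC p) * ((1 - rnorm (mkC p) ^+ 2) `^ alpha / nu (mkC p))%:E)%E.
  move=> cp; have Dp := cell_disk cp; have np := weight_gt0 nu Dp.
  have dp := jac_real_gt0 Dp.
  (* [r] is the price of passing from exponent [N + 2] at the center to exponent [alpha + 2] at [p]:
     [(5 / 4) ^+ N.+2] for the move and [2^(N - alpha) (1 - |p|^2)^(alpha - N)] for the exponent. *)
  pose r := K * (1 - rnorm (mkC p) ^+ 2) `^ alpha / (1 - rnorm (mkC p) ^+ 2) ^+ N.
  have r0 : 0 <= r.
    apply: divr_ge0; last by rewrite exprn_ge0// ltW.
    by apply: mulr_ge0; [exact: ltW|exact: powR_ge0].
  have Sr : (S i <= r%:E * G (mkC p))%E.
    apply: ge_ereal_sup => _ [z Dz <-].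
    have Dw := phi_self.2 _ Dz; have Dc := @cell_center_disk R i.
    have kc := kden_gt0 Dw Dc; have kp := kden_gt0 Dw Dp.
    apply: (@le_trans _ _ (r%:E * (density mu g z / rnorm (kden (phi z) (mkC p)) `^ (alpha + 2))%:E)%E); last first.
      by apply: lee_wpmul2l; [rewrite lee_fin|apply: ereal_sup_ubound; exists z].
    rewrite -EFinM lee_fin mulrCA ler_wpM2l ?density_ge0//.
    have := rnorm_bergman_le alphaN Dw Dp; rewrite rnorm_bergman// ler_pdivrMr ?exprn_gt0// => h.
    have kk : (rnorm (kden (phi z) (cell_center i)) ^+ N.+2)^-1 <=
        (5 / 4) ^+ N.+2 / rnorm (kden (phi z) (mkC p)) ^+ N.+2.
      rewrite -!exprVn -exprMn lerXn2r ?nnegrE ?mulr_ge0 ?invr_ge0 ?(ltW kc) ?(ltW kp)//.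
      have [_ h'] := kden_close Dw Dc (cell_close cp).
      by rewrite ler_pdivlMr// ler_pdivrMl//; lra.
    apply: le_trans kk _; rewrite /r /K -powRN ler_pdivrMr ?exprn_gt0//.
    have dN : 0 < (1 - rnorm (mkC p) ^+ 2) ^+ N by rewrite exprn_gt0.
    have c0 : 0 <= (5 / 4) ^+ N.+2 :> R by rewrite exprn_ge0.
    rewrite -[X in X <= _](mul1r ((1 - rnorm (mkC p) ^+ 2) ^+ N)) -ler_pdivlMr// in h.
    rewrite -[leLHS]mulr1; apply: le_trans (ler_wpM2l c0 h) _.
    rewrite le_eqVlt; apply/orP; left; apply/eqP.
    move: (_ ^+ N)^-1 (_ `^ _) (2 `^ _) (_ `^ alpha) (_ ^+ N.+2) ((5 / 4) ^+ _) => x1 x2 x3 x4 x5 x6; ring.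
  have -> : K^-1 * (b i * mass_density nu N p) =
     b i * ((1 - rnorm (mkC p) ^+ 2) ^+ N / (K * nu (mkC p))).
    by rewrite /mass_density (invfM K (nu _)); move: K^-1 (nu _)^-1 (_ ^+ N) => x1 x2 x3; ring.
  rewrite EFinM bS; apply: le_trans (lee_wpmul2r _ Sr) _.
    by rewrite lee_fin; apply: divr_ge0; [exact: exprn_ge0 (ltW dp)|rewrite ltW// mulr_gt0].
  rewrite [(r%:E * _)%E]muleC -muleA -EFinM.
  rewrite (_ : r * _ = (1 - rnorm (mkC p) ^+ 2) `^ alpha / nu (mkC p))//.
  have dN : (1 - rnorm (mkC p) ^+ 2) ^+ N != 0 by rewrite expf_neq0// gt_eqF.
  rewrite /r; clear Sr r0 r; move: (_ ^+ N) (_ `^ alpha) dN K K0 => x1 x2 x10 K' K'0.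
  by field; rewrite x10 !gt_eqF.
(* On each cell [F] is a constant multiple of the mass density; it is therefore measurable, and its
   integral splits over the cells. *)
pose F p : \bar R := (K^-1 * (b (cell_index p) * mass_density nu N p))%:E.
have F0 p : disk2 p -> (0 <= F p)%E.
  move=> Dp; rewrite lee_fin; apply: mulr_ge0; first by rewrite invr_ge0 ltW.
  by apply: mulr_ge0 => //; exact: mass_density_ge0.
have mF : measurable_fun disk2 F.
  rewrite -cell_cover; apply/measurable_fun_bigcup; first exact: cell_measurable.
  move=> i; apply: (eq_measurable_fun (fun p => (K^-1 * (b i * mass_density nu N p))%:E)).
    by move=> p; rewrite inE => cp; rewrite /F (cell_indexE cp).
  apply/measurable_EFinP; apply: measurable_funM => //; apply: measurable_funM => //.
  apply: measurable_funS (mass_density_measurable nu N) => //; first exact: disk2_measurable.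
  exact: cell_disk.
have intF : (\int[leb2]_(p in disk2) F p = (K^-1)%:E * \sum_(i <oo) (cell_mass nu N i * b i)%:E)%E.
  rewrite cell_integral// -nneseriesZl; last by move=> i _; rewrite lee_fin mulr_ge0 ?cell_mass_ge0.
  apply: eq_eseriesr => i _.
  rewrite (_ : (cell_mass nu N i * b i)%:E = ((b i)%:E * (cell_mass nu N i)%:E)%E); last first.
    by rewrite -EFinM mulrC.
  rewrite cell_massE// muleA -EFinM -ge0_integralZl_EFin//; last 4 first.
  - exact: cell_measurable.
  - by move=> p /cell_disk Dp; rewrite lee_fin mass_density_ge0.
  - apply/measurable_EFinP; apply: measurable_funS (mass_density_measurable nu N) => //.
      exact: disk2_measurable.
    exact: cell_disk.
  - by apply: mulr_ge0 => //; rewrite invr_ge0 ltW.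
  by apply: eq_integral => p; rewrite inE => cp; rewrite /F (cell_indexE cp) -EFinM mulrA.
have : ((K^-1)%:E * \sum_(i <oo) (cell_mass nu N i * b i)%:E < +oo)%E.
  rewrite -intF; apply: (@le_lt_trans _ _ (\int[leb2]_(p in disk2)
     (G (mkC p) * ((1 - rnorm (mkC p) ^+ 2) `^ alpha / nu (mkC p))%:E))%E).
    apply: ge0_le_integral_nonmeasurable => [//|p]; rewrite -cell_cover => -[i _ cp].
    by rewrite /F (cell_indexE cp); exact: pointwise.
  move: int_fin; rewrite /area_integral -/(G _).
  case: (\int[leb2]_(p in disk2) _)%E => [s| |].
  - by move=> _; rewrite ltry.
  - by rewrite gt0_muley ?ltxx// lte_fin invr_gt0 pi_gt0.
  - by [].
case: (\sum_(i <oo) _)%E => [s| |]; [by move=> _; rewrite ltry| |by []].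
by rewrite gt0_muley ?ltxx// lte_fin invr_gt0.
Qed.

End sufficiency_masses.

(** * The integral condition implies nuclearity *)

Section negative_binomial.
Context {R : realType}.

(* The power series coefficients of [(1 - t) ^- n.+1] *)
Fixpoint nbin (n m : nat) : nat :=
  if n is n'.+1 then \sum_(j < m.+1) nbin n' j else 1.

(** [nbin n m] is the binomial coefficient of [n + m] over [n]. Growth like [2 ^ m] is beaten by the
    ratio 1/4 of the expansion on a cell. *)
Lemma nbin_le n m : (nbin n m <= 2 ^ (n + m))%N.
Proof.
elim: n m => [m|n IH m] /=; first by rewrite expn_gt0.
apply: (@leq_trans (\sum_(j < m.+1) 2 ^ (n + j))); first by apply: leq_sum => j _; exact: IH.
elim: m => [|m IHm]; first by rewrite big_ord1 !addn0 leq_exp2l.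
rewrite big_ord_recr/= addSn expnS mul2n -addnn leq_add//.
by rewrite -addSnnS.
Qed.

Definition nbin_sum (n M : nat) (t : R[i]) : R[i] := \sum_(m < M) (nbin n m)%:R * t ^+ m.

Lemma nbin_sum0 M t : (1 - t) * nbin_sum 0 M t = 1 - t ^+ M.
Proof.
elim: M => [|M IH]; first by rewrite /nbin_sum big_ord0 mulr0 expr0 subrr.
by rewrite /nbin_sum big_ord_recr/= mulrDr -/(nbin_sum 0 M t) IH mul1r exprS; ring.
Qed.

(** Multiplication by [1 - t] undoes the partial summation that defines row [n.+1] from row [n], up
    to a term at the truncation point. *)
Lemma nbin_sumS n M t :
  (1 - t) * nbin_sum n.+1 M.+1 t = nbin_sum n M.+1 t - (nbin n.+1 M)%:R * t ^+ M.+1.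
Proof.
elim: M => [|M IH].
  by rewrite /nbin_sum !big_ord1 /= big_ord1 expr0 expr1; ring.
rewrite [nbin_sum n.+1 _ t]/nbin_sum big_ord_recr -/(nbin_sum n.+1 M.+1 t) mulrDr IH.
rewrite [nbin_sum n M.+2 t]/nbin_sum big_ord_recr -/(nbin_sum n M.+1 t).
have -> : nbin n.+1 M.+1 = (nbin n.+1 M + nbin n M.+1)%N by rewrite /= [LHS]big_ord_recr.
rewrite natrD; move: (nbin_sum n M.+1 t) (nbin n.+1 M) => x y /=.
by move: (nbin n M.+1) => u; rewrite !exprS; ring.
Qed.

(** By induction on [n], multiplying the error by [1 - t], whose modulus is at least 3/4, reduces to
    the previous row. The truncation term is at most [2^(n+1+M) / 4^(M+1)], which decays like
    [2^-M]. *)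
Lemma nbin_sum_approx n : exists2 K : R, 0 <= K & forall M t, rnorm t <= 4^-1 ->
  rnorm (nbin_sum n M t - (1 - t) ^- n.+1) <= K / 2 ^+ M.
Proof.
have t1 (t : R[i]) : rnorm t <= 4^-1 -> 3 / 4 <= rnorm (1 - t).
  by move=> ht; have := rnorm_sub (1 : R[i]) t; rewrite rnorm1; lra.
have t0 (t : R[i]) : rnorm t <= 4^-1 -> 1 - t != 0.
  by move=> /t1 ht; rewrite -rnorm_gt0; lra.
have tV (t : R[i]) k : rnorm t <= 4^-1 -> rnorm ((1 - t) ^- k) <= 2 ^+ k.
  move=> /t1 ht; rewrite rnormV rnormX -[X in _ <= X ^+ _]invrK exprVn.
  rewrite lef_pV2 ?posrE ?exprn_gt0 ?invr_gt0//; last by lra.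
  by apply: lerXn2r; rewrite ?nnegrE ?invr_ge0 ?rnorm_ge0//; lra.
have tM (t : R[i]) M : rnorm t <= 4^-1 -> rnorm (t ^+ M) <= (4 ^+ M)^-1.
  by move=> ht; rewrite rnormX -exprVn lerXn2r ?nnegrE ?invr_ge0 ?rnorm_ge0.
have e42 M : (4 ^+ M)^-1 = (2 ^+ M)^-1 / 2 ^+ M :> R.
  by rewrite -invfM -exprMn; congr (_ ^+ _)^-1; ring.
have p2 M : 0 < 2 ^+ M :> R by rewrite exprn_gt0.
elim: n => [|n [K K0 IH]].
  exists 2 => // M t ht.
  have e : nbin_sum 0 M t - (1 - t) ^- 1 = - (t ^+ M / (1 - t)).
    apply: (mulfI (t0 t ht)); rewrite mulrBr nbin_sum0 expr1 mulrN mulrCA mulfV ?t0//.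
    by rewrite mulr1; ring.
  rewrite e rnormN rnormM mulrC; apply: ler_pM; rewrite ?rnorm_ge0//.
    by have := tV t 1 ht; rewrite !expr1.
  apply: le_trans (tM t M ht) _; rewrite e42 ler_piMr ?invr_ge0 ?(ltW (p2 M))//.
  by rewrite invf_le1// exprn_ege1// ler1n.
(* The summand [2 ^+ n.+2] covers the empty sum; the factor 2 on [K] exceeds the 4/3 lost in the
   division by [1 - t]. *)
exists (2 * K + 2 ^+ n.+2); first by apply: addr_ge0; [exact: mulr_ge0|exact: exprn_ge0].
move=> [|M] t ht.
  rewrite /nbin_sum big_ord0 sub0r rnormN expr0 divr1.
  by apply: le_trans (tV t n.+2 ht) _; rewrite lerDr mulr_ge0.
have e : (1 - t) * (nbin_sum n.+1 M.+1 t - (1 - t) ^- n.+2) =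
    (nbin_sum n M.+1 t - (1 - t) ^- n.+1) - (nbin n.+1 M)%:R * t ^+ M.+1.
  rewrite mulrBr nbin_sumS [(1 - t) ^+ n.+2]exprS invfM mulrA mulfV ?t0// mul1r.
  by rewrite addrAC.
have h1 : rnorm (1 - t) * rnorm (nbin_sum n.+1 M.+1 t - (1 - t) ^- n.+2) <=
    (K + 2 ^+ n) / 2 ^+ M.+1.
  rewrite -rnormM e (le_trans (rnormB _ _))// mulrDl lerD ?IH//.
  rewrite rnormM rnorm_nat; apply: (@le_trans _ _ (2 ^+ (n.+1 + M) * (4 ^+ M.+1)^-1)).
    apply: ler_pM; rewrite ?ler0n ?rnorm_ge0 ?tM//.
    by rewrite -natrX ler_nat nbin_le.
  rewrite e42 addSnnS exprD -mulrA mulVKf ?gt_eqF//.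
have h2 : 3 / 4 * rnorm (nbin_sum n.+1 M.+1 t - (1 - t) ^- n.+2) <= (K + 2 ^+ n) / 2 ^+ M.+1.
  by apply: le_trans h1; rewrite ler_wpM2r ?rnorm_ge0 ?t1.
have h3 : (K + 2 ^+ n) / 2 ^+ M.+1 * 2 <= (2 * K + 2 ^+ n.+2) / 2 ^+ M.+1.
  rewrite mulrAC ler_wpM2r ?invr_ge0 ?(ltW (p2 _))// !exprS.
  by have := p2 n; move: (2 ^+ n) => x x0; lra.
by move: h2 h3 (rnorm_ge0 (nbin_sum n.+1 M.+1 t - (1 - t) ^- n.+2)); lra.
Qed.

Lemma nbin_quarter_sum n M : \sum_(m < M) (nbin n m)%:R / 4 ^+ m <= 2 ^+ n.+1 :> R.
Proof.
suff : \sum_(m < M) (nbin n m)%:R / 4 ^+ m <= 2 ^+ n * (2 - 2 / 2 ^+ M) :> R.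
  move=> /le_trans; apply; rewrite exprSr ler_pM2l ?exprn_gt0//.
  by rewrite gerBl divr_ge0 ?exprn_ge0.
elim: M => [|M IH]; first by rewrite big_ord0 expr0 divr1 subrr mulr0.
rewrite big_ord_recr/=.
have h : (nbin n M)%:R / 4 ^+ M <= 2 ^+ n / 2 ^+ M :> R.
  apply: (@le_trans _ _ (2 ^+ (n + M) / 4 ^+ M)).
    by rewrite ler_wpM2r ?invr_ge0 ?exprn_ge0// -natrX ler_nat nbin_le.
  have -> : 4 ^+ M = 2 ^+ M * 2 ^+ M :> R by rewrite -exprMn; congr (_ ^+ _); ring.
  have p : (2 ^+ M : R) != 0 by rewrite expf_neq0 ?pnatr_eq0.
  rewrite exprD le_eqVlt; apply/orP; left; apply/eqP; move: (2 ^+ M) p => x x0.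
  by field.
apply: le_trans (lerD IH h) _; rewrite exprS.
have p : 0 < (2 ^+ M : R) by rewrite exprn_gt0.
rewrite le_eqVlt; apply/orP; left; apply/eqP; move: (2 ^+ M) p (2 ^+ n) => x x0 y.
by field; rewrite gt_eqF.
Qed.

End negative_binomial.

Section enumeration.

(* The sequence [pair_row] takes every value infinitely often; [pair_row k], together with the
   number [pair_col k] of earlier occurrences of that value, enumerates all pairs of numbers. *)
Definition pair_row (k : nat) : nat := logn 2 k.+1.

Fixpoint occurrences (n i : nat) : nat :=
  if n is n'.+1 then occurrences n' i + (pair_row n' == i) else 0.

Definition pair_col (k : nat) : nat := occurrences k (pair_row k).

Lemma pair_row_le k : (pair_row k <= k)%N.
Proof.
by rewrite -ltnS; apply: (@leq_trans (2 ^ pair_row k)); [exact: ltn_expl|exact: dvdn_leq (pfactor_dvdnn _ _)].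
Qed.

Lemma occurrences_mono n n' i : (n <= n')%N -> (occurrences n i <= occurrences n' i)%N.
Proof.
by move=> /subnK <-; elim: (n' - n)%N => // d IH; rewrite addSn /= (leq_trans IH)// leq_addr.
Qed.

Lemma occurrences_unbounded i J : exists n, (J <= occurrences n i)%N.
Proof.
elim: J => [|J [n hn]]; first by exists 0%N.
have k0 : (0 < 2 ^ i * n.*2.+1)%N by rewrite muln_gt0 expn_gt0.
(* The odd factor leaves the 2-adic valuation equal to [i], and it makes the index at least [n], so
   the next occurrence comes after the ones already counted. *)
pose k := (2 ^ i * n.*2.+1).-1.
have rk : pair_row k = i.
  rewrite /pair_row /k prednK// lognM ?expn_gt0// pfactorK// logn_coprime ?addn0//.
  by rewrite prime_coprime// dvdn2/= odd_double.
have nk : (n <= k)%N.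
  rewrite -ltnS /k prednK// (@leq_trans n.*2.+1)//; last by rewrite leq_pmull// expn_gt0.
  by rewrite ltnS -addnn leq_addr.
exists k.+1; rewrite /= rk eqxx addn1 ltnS (leq_trans hn)//; exact: occurrences_mono.
Qed.

(** At every stage the enumeration has visited an initial segment of each row, so its partial sums
    are sums of truncated rows. The rows from [n] on are still empty, which is why any [L] with
    [n <= L] will do. *)
Lemma enumeration_sum (V : nmodType) (a : nat -> nat -> V) n L : (n <= L)%N ->
  \sum_(k < n) a (pair_row k) (pair_col k) = \sum_(i < L) \sum_(m < occurrences n i) a i m.
Proof.
elim: n => [_|n IH nL].
  by rewrite big_ord0 big1// => i _; rewrite big_ord0.
rewrite big_ord_recr/= IH ?(ltnW nL)//.
have rL : (pair_row n < L)%N by exact: leq_ltn_trans (pair_row_le n) nL.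
rewrite (bigD1 (Ordinal rL))//= [RHS](bigD1 (Ordinal rL))//= eqxx addn1 big_ord_recr/=.
rewrite addrAC; congr (_ + _).
by apply: eq_bigr => i ir; rewrite -val_eqE/= eq_sym in ir; rewrite (negbTE ir) addn0.
Qed.

End enumeration.

Section complex_integral_restriction.
Context d (T : measurableType d) (R : realType) (mu : {measure set T -> \bar R}).
Implicit Types (A D : set T) (F G : T -> R[i]).

Lemma cintegrableD A F G : measurable A -> cintegrable mu A F -> cintegrable mu A G ->
  cintegrable mu A (fun x => F x + G x).
Proof.
move=> mA iF iG; have h := cintegrableB mA iF (cintegrableZ (-1) mA iG).
by rewrite (_ : (fun x => _) = (fun x => F x - -1 * G x))//; apply/funext => x; rewrite mulN1r opprK.
Qed.

Lemma cintD A F G : measurable A -> cintegrable mu A F -> cintegrable mu A G ->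
  cint mu A (fun x => F x + G x) = cint mu A F + cint mu A G.
Proof.
move=> mA iF iG; have h := cintB mA iF (cintegrableZ (-1) mA iG).
rewrite cintZ// mulN1r opprK in h; rewrite -h.
by apply: eq_cint => x _; rewrite mulN1r opprK.
Qed.

Definition crestrict A F x : R[i] := if x \in A then F x else 0.

Lemma Re_crestrict A F : (fun x => complex.Re (crestrict A F x)) = (fun x => complex.Re (F x)) \_ A.
Proof. by apply/funext => x; rewrite patchE /crestrict; case: ifP. Qed.

Lemma Im_crestrict A F : (fun x => complex.Im (crestrict A F x)) = (fun x => complex.Im (F x)) \_ A.
Proof. by apply/funext => x; rewrite patchE /crestrict; case: ifP. Qed.

Lemma cint_restrict A D F : A `<=` D -> cint mu D (crestrict A F) = cint mu A F.
Proof.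
move=> AD; rewrite /cint; congr (_ +i* _).
  rewrite -[in RHS](setIidr AD) Rintegral_mkcondr -Re_crestrict//.
by rewrite -[in RHS](setIidr AD) Rintegral_mkcondr -Im_crestrict.
Qed.

Lemma cintegrable_restrict A D F : measurable A -> measurable D -> A `<=` D ->
  cintegrable mu A F -> cintegrable mu D (crestrict A F).
Proof.
move=> mA mD AD [F1 F2]; split.
  rewrite Re_crestrict -restrict_EFin; apply/integrable_restrict => //.
  by rewrite (setIidr AD).
rewrite Im_crestrict -restrict_EFin; apply/integrable_restrict => //.
by rewrite (setIidr AD).
Qed.

Lemma cintegrable_cmeasurable A F : cintegrable mu A F -> cmeasurable A F.
Proof.
by move=> [/integrableP[/measurable_EFinP m1 _] /integrableP[/measurable_EFinP m2 _]].
Qed.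

End complex_integral_restriction.

(** * Expansion into kernel functions *)

Section moments.
Context {R : realType} (nu : radial_weight R) (N : nat).
Local Notation leb := (@lebesgue_measure R).
Local Notation leb2 := (leb \x leb)%E.
Context (iB : bergman_integrable nu N 0).
Implicit Types (f h : R[i] -> R[i]) (w z : R[i]).

Definition moment_fun i m f (p : R * R) : R[i] :=
  f (mkC p) * (jac (mkC p) ^+ N * conjc (mkC p - cell_center i) ^+ m).

Definition moment i m f : R[i] := cint leb2 (cell i) (moment_fun i m f).

Definition moment_bound f i m (p : R * R) : R :=
  fine (weighted_norm nu f) * ((1 - rnorm (cell_center i : R[i])) / 4) ^+ m * mass_density nu N p.

Lemma moment_fun_measurable i m f : Hinf_set nu f -> cmeasurable (cell i) (moment_fun i m f).
Proof.
move=> hf; apply: cmeasurableS (@cmeasurable_disk _ (fun z => f z *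
  (jac z ^+ N * conjc (z - cell_center i) ^+ m)) _); first exact: disk2_measurable.
  exact: cell_disk.
move=> z Dz; apply: ccontM.
  by have [a /wdiff_cont] := Hinf_analytic hf Dz.
apply: ccontM; first exact: wdiff_cont (wdiffX N (wdiff_jac z)).
exact: wdiff_cont (wdiffX m (wdiff_conj (wdiffB (wdiff_id z) (wdiff_cst z (cell_center i))))).
Qed.

Lemma moment_fun_le i m f p : Hinf_set nu f -> cell i p ->
  rnorm (moment_fun i m f p) <= moment_bound f i m p.
Proof.
move=> hf cp; have Dp := cell_disk cp; have np := weight_gt0 nu Dp.
rewrite !rnormM !rnormX rnorm_conj rnorm_jac// /moment_bound /mass_density.
have h := Hinf_bound hf Dp; have cl := cell_close cp; rewrite /close_to in cl.
have d0 : 0 <= (1 - rnorm (mkC p) ^+ 2) ^+ N by rewrite exprn_ge0// ltW// jac_real_gt0.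
have k0 : rnorm (mkC p - cell_center i) ^+ m <= ((1 - rnorm (cell_center i : R[i])) / 4) ^+ m.
  by rewrite lerXn2r ?nnegrE ?rnorm_ge0// (le_trans _ cl)// rnorm_ge0.
apply: le_trans (ler_wpM2r _ h) _; first by rewrite mulr_ge0// exprn_ge0 ?rnorm_ge0.
have n0 : 0 <= fine (weighted_norm nu f) / nu (mkC p) * (1 - rnorm (mkC p) ^+ 2) ^+ N.
  by rewrite !mulr_ge0 ?invr_ge0 ?fine_ge0 ?weighted_norm_ge0// ltW.
rewrite mulrA; apply: le_trans (ler_wpM2l n0 k0) _.
rewrite le_eqVlt; apply/orP; left; apply/eqP.
move: (fine _) (nu _)^-1 (_ ^+ N) (_ ^+ m) => x1 x2 x3 x4; ring.
Qed.

Lemma moment_bound_integrable f i m : leb2.-integrable (cell i) (EFin \o moment_bound f i m).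
Proof.
apply: integrableZ_EFin; first exact: cell_measurable.
apply: integrableS (mass_density_integrable iB); [exact: disk2_measurable|exact: cell_measurable|exact: cell_disk].
Qed.

Lemma moment_fun_integrable i m f : Hinf_set nu f -> cintegrable leb2 (cell i) (moment_fun i m f).
Proof.
move=> hf; apply: (@cintegrable_dom _ _ _ leb2 _ _ (moment_bound f i m)).
- exact: cell_measurable.
- exact: moment_fun_measurable.
- exact: moment_bound_integrable.
- by move=> p; exact: moment_fun_le.
Qed.

Lemma moment_le i m f : Hinf_set nu f -> rnorm (moment i m f) <=
  2 * (fine (weighted_norm nu f) * ((1 - rnorm (cell_center i : R[i])) / 4) ^+ m * cell_mass nu N i).
Proof.
move=> hf.
apply: le_trans (@rnorm_cint_le _ _ _ leb2 _ _ (moment_bound f i m) _ _ _ _) _.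
- exact: cell_measurable.
- exact: moment_fun_measurable.
- exact: moment_bound_integrable.
- by move=> p; exact: moment_fun_le.
rewrite /moment_bound RintegralZl//; first exact: cell_measurable.
apply: integrableS (mass_density_integrable iB); [exact: disk2_measurable|exact: cell_measurable|exact: cell_disk].
Qed.

Lemma moment_linear i m (a : R[i]) f h : Hinf_set nu f -> Hinf_set nu h ->
  moment i m (a *: f + h) = a * moment i m f + moment i m h.
Proof.
move=> hf hh; have i1 := moment_fun_integrable i m hf; have i2 := moment_fun_integrable i m hh.
have e1 := @cintZ _ _ R leb2 _ _ a (cell_measurable i) i1.
have i3 := @cintegrableZ _ _ R leb2 _ _ a (cell_measurable i) i1.
have e2 := @cintD _ _ R leb2 _ _ _ (cell_measurable i) i3 i2.
rewrite /moment -e1 -e2; apply: eq_cint => p _; rewrite /moment_fun -[(a *: f + h) (mkC p)]/(a * f (mkC p) + h (mkC p)).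
by rewrite mulrDl -mulrA.
Qed.

Lemma nbin_sum_recr n M (t : R[i]) : nbin_sum n M.+1 t = nbin_sum n M t + (nbin n M)%:R * t ^+ M.
Proof. exact: big_ord_recr. Qed.

(* [kden w z] for [z] in the cell is [kden w (cell_center i) * (1 - cell_ratio w i z)]. *)
Definition cell_ratio w i z : R[i] := conjc (z - cell_center i) * w / kden w (cell_center i).

Lemma cell_ratioE w i z : disk w ->
  kden w z = kden w (cell_center i) * (1 - cell_ratio w i z).
Proof.
move=> Dw; have k0 := kden_neq0 Dw (@cell_center_disk R i).
by rewrite mulrBr mulr1 /cell_ratio mulrCA mulfV// mulr1 /kden (conjcB z); ring.
Qed.

Lemma cell_ratio_le w i p : disk w -> cell i p -> rnorm (cell_ratio w i (mkC p)) <= 4^-1.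
Proof.
move=> Dw cp; have Dc := @cell_center_disk R i.
have k0 := kden_gt0 Dw Dc; have cl := cell_close cp; rewrite /close_to in cl.
rewrite !rnormM rnormV rnorm_conj ler_pdivrMr//.
have h := kden_ge_r (cell_center i) Dw.
apply: (@le_trans _ _ (rnorm (mkC p - cell_center i))).
  by rewrite ler_piMr ?rnorm_ge0// ltW// -diskE.
by apply: le_trans cl _; rewrite mulrC ler_pM2l// invr_gt0.
Qed.

(** The integrand of the reproducing formula with the kernel replaced, on each cell, by its Taylor
    polynomial in [conj (z - cell_center i)], truncated after the terms of row [i] reached by the
    enumeration. *)
Definition partial_fun f w n (p : R * R) : R[i] := let i := cell_index p in
  f (mkC p) * jac (mkC p) ^+ N / kden w (cell_center i) ^+ N.+2 *
  nbin_sum N.+1 (occurrences n i) (cell_ratio w i (mkC p)).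

Definition expansion_term f w k : R[i] :=
  (nbin N.+1 (pair_col k))%:R * moment (pair_row k) (pair_col k) f *
  kernel_fun (cell_center (pair_row k)) (N.+2 + pair_col k) (pair_col k) w.

(** Passing from [n] to [n.+1] adds a single monomial on the single cell [pair_row n]; its integral
    is a moment of [f] times a kernel function of [w]. *)
Lemma partial_fun_integral f w n : Hinf_set nu f -> disk w ->
  cintegrable leb2 disk2 (partial_fun f w n) /\
  cint leb2 disk2 (partial_fun f w n) = \sum_(k < n) expansion_term f w k.
Proof.
move=> hf Dw; have mD := disk2_measurable (R := R); elim: n => [|n [IHi IH]].
  have e p : partial_fun f w 0 p = 0 by rewrite /partial_fun /nbin_sum big_ord0 mulr0.
  split.
    apply: (@cintegrable_dom _ _ _ leb2 _ _ (fun=> 0)) => //.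
    - by rewrite (_ : partial_fun f w 0 = fun=> 0); [split; exact: measurable_cst|exact/funext].
    - exact: disk2_cst_integrable.
    - by move=> p _; rewrite e rnorm0.
  rewrite big_ord0 (@eq_cint _ _ _ leb2 _ _ (fun=> 0)); last by move=> p _; rewrite e.
  by rewrite /cint !Rintegral_cst// !mul0r.
pose i := pair_row n; pose m := pair_col n.
have Dc := @cell_center_disk R i.
pose c : R[i] := (nbin N.+1 m)%:R * (w ^+ m / kden w (cell_center i) ^+ (N.+2 + m)).
pose extra := crestrict (cell i) (fun p => c * moment_fun i m f p).
have i0 := moment_fun_integrable i m hf.
have i1 := @cintegrableZ _ _ R leb2 _ _ c (cell_measurable i) i0.
have iE := @cintegrable_restrict _ _ R leb2 _ _ _ (cell_measurable i) mD (@cell_disk R i) i1.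
rewrite -/extra in iE.
have E p : disk2 p -> partial_fun f w n.+1 p = partial_fun f w n p + extra p.
  rewrite -cell_cover => -[j _ cp]; rewrite /partial_fun (cell_indexE cp) /extra /crestrict /=.
  have [ij|ij] := eqVneq (pair_row n) j; last first.
    rewrite addn0 memNset ?addr0// => cip; case/eqP: ij.
    by rewrite -(cell_indexE cp) (cell_indexE cip).
  have cip : cell i p by rewrite /i ij.
  rewrite mem_set// addn1 nbin_sum_recr mulrDr; congr (_ + _).
  have em : occurrences n j = m by rewrite /m /pair_col ij.
  rewrite em /c /moment_fun /i ij /cell_ratio !exprMn exprD exprVn.
  move: (nbin _ _)%:R (f _) (_ ^+ N) (kden _ _) (conjc _) => x1 x2 x3 x4 x5.
  by rewrite (invfM (x4 ^+ N.+2) (x4 ^+ m)); move: (x4 ^+ N.+2)^-1 (x4 ^+ m)^-1 (x5 ^+ m) (w ^+ m) => y1 y2 y3 y4; ring.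
split.
  have h := @cintegrableD _ _ R leb2 _ _ _ mD IHi iE.
  split; [move: h => [h _]|move: h => [_ h]]; apply: eq_integrable h => //;
    by move=> p; rewrite inE => Dp /=; rewrite E.
transitivity (cint leb2 disk2 (fun p => partial_fun f w n p + extra p)).
  by apply: eq_cint => p; exact: E.
rewrite big_ord_recr/= -IH (@cintD _ _ R leb2 _ _ _ mD IHi iE); congr (_ + _).
rewrite (@cint_restrict _ _ R leb2 _ _ _ (@cell_disk R i)).
rewrite (@cintZ _ _ R leb2 _ _ c (cell_measurable i) i0).
by rewrite /expansion_term -/i -/m -/(moment i m f) kernel_funE// /c mulrAC.
Qed.

(** The truncated series are bounded independently of the truncation, which gives a dominating
    function that does not depend on [n]. *)
Lemma partial_fun_le : exists2 C : R, 0 < C & forall f w n p, Hinf_set nu f -> disk w -> disk2 p ->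
  rnorm (partial_fun f w n p) <=
  C * fine (weighted_norm nu f) * (rnorm (bergman N w (mkC p)) / nu (mkC p)).
Proof.
have [K K0 hK] := @nbin_sum_approx R N.+1.
pose L : R := (5 / 4) ^+ N.+2 * (K + 2 ^+ N.+2).
have K2 : 0 < K + 2 ^+ N.+2 by rewrite ltr_wpDl// exprn_gt0.
exists L; first by apply: mulr_gt0 => //; exact: exprn_gt0.
move=> f w n p hf Dw; rewrite -cell_cover => -[i _ cp].
have Dp := cell_disk cp; have np := weight_gt0 nu Dp; have Dc := @cell_center_disk R i.
have kc := kden_gt0 Dw Dc; have kp := kden_gt0 Dw Dp.
rewrite /partial_fun (cell_indexE cp); set t := cell_ratio w i (mkC p).
have ht : rnorm t <= 4^-1 by exact: cell_ratio_le.
have hs : rnorm (nbin_sum N.+1 (occurrences n i) t) <= K + 2 ^+ N.+2.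
  have h1 := hK (occurrences n i) t ht.
  have t1 : 2^-1 <= rnorm (1 - t) by have := rnorm_sub (1 : R[i]) t; rewrite rnorm1; lra.
  have h2 : rnorm ((1 - t) ^- N.+2) <= 2 ^+ N.+2.
    rewrite rnormV rnormX -[X in _ <= X ^+ _]invrK exprVn.
    have t0 : 0 < rnorm (1 - t) by apply: lt_le_trans t1; rewrite invr_gt0.
    rewrite lef_pV2 ?posrE ?exprn_gt0 ?invr_gt0//.
    by apply: lerXn2r; rewrite ?nnegrE ?invr_ge0 ?rnorm_ge0.
  have h3 : K / 2 ^+ occurrences n i <= K.
    by rewrite ler_piMr// invf_le1 ?exprn_gt0// exprn_ege1// ler1n.
  have := rnormD (nbin_sum N.+1 (occurrences n i) t - (1 - t) ^- N.+2) ((1 - t) ^- N.+2).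
  by rewrite subrK; lra.
have hk : (rnorm (kden w (cell_center i)) ^+ N.+2)^-1 <= (5 / 4) ^+ N.+2 / rnorm (kden w (mkC p)) ^+ N.+2.
  rewrite -!exprVn -exprMn lerXn2r ?nnegrE ?mulr_ge0 ?invr_ge0 ?(ltW kc) ?(ltW kp)//.
  have [_ h'] := kden_close Dw Dc (cell_close cp).
  by rewrite ler_pdivlMr// ler_pdivrMl//; lra.
have hfp := Hinf_bound hf Dp.
have d0 : 0 <= (1 - rnorm (mkC p) ^+ 2) ^+ N by rewrite exprn_ge0// ltW// jac_real_gt0.
rewrite rnorm_bergman// !rnormM rnormV !rnormX rnorm_jac//.
apply: (@le_trans _ _ (fine (weighted_norm nu f) / nu (mkC p) * (1 - rnorm (mkC p) ^+ 2) ^+ N *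
   ((5 / 4) ^+ N.+2 / rnorm (kden w (mkC p)) ^+ N.+2) * (K + 2 ^+ N.+2))).
  have a0 : 0 <= rnorm (f (mkC p)) * (1 - rnorm (mkC p) ^+ 2) ^+ N by rewrite mulr_ge0 ?rnorm_ge0.
  have a1 : 0 <= (rnorm (kden w (cell_center i)) ^+ N.+2)^-1 by rewrite invr_ge0 exprn_ge0 ?rnorm_ge0.
  have q := ler_pM a0 a1 (ler_wpM2r d0 hfp) hk.
  by apply: ler_pM q hs; [exact: mulr_ge0|exact: rnorm_ge0].
rewrite le_eqVlt; apply/orP; left; apply/eqP; rewrite /L.
move: (fine _) (nu _)^-1 (_ ^+ N) (5 / 4) (_ ^+ N.+2)^-1 (K + _) => x1 x2 x3 x4 x5 x6.
by move: (x4 ^+ N.+2) => x7; ring.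
Qed.

(** Every row is visited infinitely often, so on each cell the order of truncation tends to infinity
    and the error is at most a multiple of [2^-J]. *)
Lemma partial_fun_cvg f w p : disk w -> disk2 p ->
  rnorm (partial_fun f w n p - f (mkC p) * bergman N w (mkC p)) @[n --> \oo] --> (0 : R).
Proof.
move=> Dw; rewrite -cell_cover => -[i _ cp]; have Dp := cell_disk cp.
have [K K0 hK] := @nbin_sum_approx R N.+1.
have Dc := @cell_center_disk R i; have k0 := kden_neq0 Dw Dc.
set t := cell_ratio w i (mkC p).
have ht : rnorm t <= 4^-1 by exact: cell_ratio_le.
pose A := f (mkC p) * jac (mkC p) ^+ N / kden w (cell_center i) ^+ N.+2.
have e n : partial_fun f w n p - f (mkC p) * bergman N w (mkC p) =
    A * (nbin_sum N.+1 (occurrences n i) t - (1 - t) ^- N.+2).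
  rewrite /partial_fun (cell_indexE cp) -/t -/A mulrBr; congr (_ - _).
  by rewrite /bergman (cell_ratioE i (mkC p) Dw) -/t exprMn invfM /A !mulrA.
apply/cvgrPdist_lt => eps eps0.
have A1 : 0 < rnorm A * K + 1 by rewrite ltr_wpDl// mulr_ge0 ?rnorm_ge0.
have [J hJ] : exists J, (2 ^+ J)^-1 < eps / (rnorm A * K + 1).
  have [J _ /(_ J (leqnn J)) /= hJ] := near_infty_natSinv_lt (PosNum (divr_gt0 eps0 A1)).
  exists J; apply: le_lt_trans hJ; rewrite lef_pV2 ?posrE ?exprn_gt0//.
  by rewrite -natrX ler_nat ltn_expl.
have [n0 hn0] := occurrences_unbounded i J.
exists n0 => // n /= nn0; rewrite sub0r normrN ger0_norm ?rnorm_ge0// e rnormM.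
apply: le_lt_trans (_ : rnorm A * K * (2 ^+ J)^-1 < _); last first.
  apply: le_lt_trans (_ : (rnorm A * K + 1) * (2 ^+ J)^-1 < _).
    by rewrite ler_wpM2r ?invr_ge0 ?exprn_ge0// lerDl.
  by rewrite -ltr_pdivlMl// mulrC.
rewrite -mulrA ler_wpM2l ?rnorm_ge0//; apply: le_trans (hK _ t ht) _.
rewrite ler_wpM2l// lef_pV2 ?posrE ?exprn_gt0// ler_eXn2l ?ltr1n//.
by apply: leq_trans hn0 _; exact: occurrences_mono.
Qed.

Lemma expansion_cvg f w : (0 < N)%N -> bergman_integrable nu N w -> Hinf_set nu f -> disk w ->
  rnorm (\sum_(k < n) expansion_term f w k - (bergman_const N)%:C * f w) @[n --> \oo] --> (0 : R).
Proof.
move=> N0 iBw hf Dw; have [C C0 hC] := partial_fun_le.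
rewrite -(reproducing_Hinf N0 iBw hf Dw).
under eq_fun do rewrite -(partial_fun_integral _ hf Dw).2.
apply: (@cint_dominated _ _ R leb2 disk2 (partial_fun f w)
  (fun p => f (mkC p) * bergman N w (mkC p))
  (fun p => C * fine (weighted_norm nu f) * (rnorm (bergman N w (mkC p)) / nu (mkC p)))).
- exact: disk2_measurable.
- by move=> n; apply: cintegrable_cmeasurable; exact: (partial_fun_integral n hf Dw).1.
- by apply: integrableZ_EFin; [exact: disk2_measurable|exact: iBw].
- by move=> p Dp; exact: partial_fun_cvg.
- by move=> n p Dp; exact: hC.
Qed.

End moments.

Section linear_maps.
Context {R : realType}.
Implicit Types X Y : normedModType R[i].

Lemma packed_linear X Y (F : X -> Y) :
  (forall a x y, F (a *: x + y) = a *: F x + F y) -> exists G : {linear X -> Y}, G =1 F.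
Proof.
move=> hF; pose m := GRing.isLinear.Build R[i] X Y *:%R F hF.
by pose G : {linear X -> Y} := HB.pack F m; exists G.
Qed.

Lemma bounded_linear_continuous X Y (F : {linear X -> Y}) (K : R) :
  (forall x, rnorm (F x) <= K * rnorm x) -> continuous F.
Proof.
move=> FK x; apply/cvgrPdist_lt => e e0.
have eE : e = (complex.Re e)%:C by rewrite RRe_real// realE ltW.
have re0 : 0 < complex.Re e by rewrite -ltcR -eE.
have K1 : 0 < `|K| + 1 by rewrite ltr_wpDl.
have d0 : 0 < (complex.Re e / (`|K| + 1))%:C by rewrite ltcR divr_gt0.
have /cvgrPdist_lt/(_ _ d0) : (fun y : X => y) @ x --> x by exact: cvg_id.
apply: filterS => y; rewrite normE ltcR => h.
rewrite normE eE ltcR -linearB (le_lt_trans (FK _))//.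
apply: le_lt_trans (_ : (`|K| + 1) * rnorm (x - y) < _).
  by rewrite ler_wpM2r ?rnorm_ge0// (le_trans (ler_norm _))// lerDl.
by rewrite mulrC -ltr_pdivlMr.
Qed.

Lemma nuclear_comp X Y X' Y' (T : {linear X -> Y}) (I : {linear X' -> X}) (J : {linear Y -> Y'}) :
  (forall x, rnorm (I x) <= rnorm x) -> (forall y, rnorm (J y) <= rnorm y) ->
  nuclear T -> nuclear (J \o T \o I).
Proof.
move=> I1 J1 [x' [y [cx sum_fin cT]]].
have cI : continuous I by apply: (bounded_linear_continuous (K := 1)) => x; rewrite mul1r.
have cJ : continuous J by apply: (bounded_linear_continuous (K := 1)) => x; rewrite mul1r.
exists (fun k => x' k \o I), (fun k => J (y k)); split.
- by move=> k x; apply: continuous_comp; [exact: cI|exact: cx].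
- apply: le_lt_trans sum_fin; apply: lee_nneseries => [k _ _|k _].
    by rewrite mule_ge0 ?dual_norm_ge0 ?lee_fin ?rnorm_ge0.
  apply: lee_pmul; rewrite ?dual_norm_ge0 ?lee_fin ?rnorm_ge0//.
  apply: ge_ereal_sup => _ [x /= x1 <-]; apply: ereal_sup_ubound.
  by exists (I x) => //=; exact: le_trans (I1 x) x1.
- move=> x; rewrite /=.
  have -> : series (fun k => x' k (I x) *: J (y k)) = J \o series (fun k => x' k (I x) *: y k).
    by apply/funext => n; rewrite /series/= linear_sum; apply: eq_bigr => k _; rewrite linearZ.
  by apply: continuous_cvg; [exact: cJ|exact: cT].
Qed.

Lemma nuclear_between_comp X Y X' Y' (iX : X -> R[i] -> R[i]) (iY : Y -> R[i] -> R[i])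
    (iX' : X' -> R[i] -> R[i]) (iY' : Y' -> R[i] -> R[i]) S
    (I : {linear X' -> X}) (J : {linear Y -> Y'}) :
  (forall x, rnorm (I x) <= rnorm x) -> (forall y, rnorm (J y) <= rnorm y) ->
  (forall x, iX (I x) = iX' x) -> (forall y, iY' (J y) = iY y) ->
  nuclear_between iX iY S -> nuclear_between iX' iY' S.
Proof.
move=> I1 J1 iI iJ [T hT nT]; exists (J \o T \o I); last exact: nuclear_comp.
by move=> f; rewrite /= iJ hT iI.
Qed.

Lemma H0_inclusion (nu : radial_weight R) : exists I : {linear H0 nu -> Hinf nu},
  (forall f, rnorm (I f) <= rnorm f) /\ (forall f, Hinf_val (I f) = H0_val f).
Proof.
pose F (f : H0 nu) : Hinf nu := MkHinf (mem_set (H0_sub_Hinf (H0P f)) : _ \in Hinf_pred nu).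
have [|I hI] := @packed_linear (H0 nu) (Hinf nu) F.
  by move=> a x y; exact: val_inj.
by exists I; split=> f; rewrite hI.
Qed.

Lemma id_contraction X : exists I : {linear X -> X}, (forall x, rnorm (I x) <= rnorm x) /\ I =1 id.
Proof. by exists idfun. Qed.

Lemma Hinf_val_sum (nu : radial_weight R) n (a : nat -> R[i]) (x : nat -> Hinf nu) z :
  Hinf_val (\sum_(k < n) a k *: x k) z = \sum_(k < n) a k * Hinf_val (x k) z.
Proof. by elim: n => [|n IH]; rewrite ?big_ord0// !big_ord_recr/= -IH. Qed.

Lemma H0_val_sum (nu : radial_weight R) n (a : nat -> R[i]) (x : nat -> H0 nu) z :
  H0_val (\sum_(k < n) a k *: x k) z = \sum_(k < n) a k * H0_val (x k) z.
Proof. by elim: n => [|n IH]; rewrite ?big_ord0// !big_ord_recr/= -IH. Qed.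

End linear_maps.

(** * The nuclear representation *)

Section sufficiency.
Context {R : realType} (nu mu : radial_weight R) (g phi : R[i] -> R[i]).
Context (g_B0 : little_bloch (fun z => (1 - rnorm z ^+ 2) * mu z) g).
Context (phi_self : analytic_self_map phi).
Context (nu_II : exists gamma, exponent_II nu gamma) (mu_II : exists gamma, exponent_II mu gamma).
Context (alpha : R) (nu_I : exists2 beta, exponent_I nu beta & beta - 1 < alpha).
Context (T_bounded : bounded_between (@Hinf_val R nu) (@Hinf_val R mu) (T_op g phi)).
Context (N : nat) (N_gt0 : (0 < N)%N) (alphaN : alpha <= N%:R).
Context (b : nat -> R) (b_ge0 : forall i, 0 <= b i).
Context (sum_b : (\sum_(i <oo) (cell_mass nu N i * b i)%:E < +oo)%E).
Context (b_ub : forall i z, disk z ->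
  density mu g z / rnorm (kden (phi z) (cell_center i)) ^+ N.+2 <= b i).
Implicit Types (w z : R[i]).

Local Notation c0 := (bergman_const N : R).

Let aG : analytic_on_disk g := g_B0.1.
Let iB w : disk w -> bergman_integrable nu N w :=
  weighted_bergman_integrable alphaN nu_I nu_II (w := w).
Let c0_gt0 : 0 < c0 := @bergman_const_gt0 R N.

Definition center_gap k : R := 1 - rnorm (cell_center (pair_row k) : R[i]).

Definition expansion_kernel k :=
  kernel_fun (cell_center (pair_row k) : R[i]) (N.+2 + pair_col k) (pair_col k).

Definition expansion_coef k (f : R[i] -> R[i]) : R[i] :=
  c0^-1%:C * ((nbin N.+1 (pair_col k))%:R * moment N (pair_row k) (pair_col k) f).

Definition coef_bound k : R :=
  2 / c0 * (nbin N.+1 (pair_col k))%:R * (center_gap k / 4) ^+ pair_col k * cell_mass nu N (pair_row k).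

Definition kernel_bound k : R := b (pair_row k) / center_gap k ^+ pair_col k.

Definition term_bound k : R :=
  2 / c0 * (cell_mass nu N (pair_row k) * b (pair_row k)) *
  ((nbin N.+1 (pair_col k))%:R / 4 ^+ pair_col k).

Lemma center_gap_gt0 k : 0 < center_gap k.
Proof. by rewrite subr_gt0 -diskE; exact: cell_center_disk. Qed.

Lemma expansion_kernel_bounded k z : disk z ->
  rnorm (expansion_kernel k z) <= (center_gap k ^+ (N.+2 + pair_col k))^-1.
Proof. by apply: kernel_fun_le; exact: cell_center_disk. Qed.

Lemma expansion_kernel_holomorphic k : holomorphic (expansion_kernel k).
Proof. by apply: kernel_fun_holomorphic; exact: cell_center_disk. Qed.

Lemma expansion_kernel_Hinf k : Hinf_set nu (expansion_kernel k).
Proof. exact: bounded_Hinf (expansion_kernel_holomorphic k) (expansion_kernel_bounded k). Qed.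

Lemma coef_bound_ge0 k : 0 <= coef_bound k.
Proof.
have g0 := center_gap_gt0 k.
by rewrite !mulr_ge0 ?cell_mass_ge0 ?exprn_ge0 ?divr_ge0 ?invr_ge0 ?(ltW c0_gt0) ?(ltW g0).
Qed.

Lemma kernel_bound_ge0 k : 0 <= kernel_bound k.
Proof. by apply: divr_ge0 => //; exact: exprn_ge0 (ltW (center_gap_gt0 k)). Qed.

(** With [m = pair_col k], the coefficient decays like the [m]-th power of a quarter of the gap,
    while the kernel grows like the inverse [m]-th power of the gap. The gaps cancel and leave
    [4^-m]. *)
Lemma term_boundE k : coef_bound k * kernel_bound k = term_bound k.
Proof.
rewrite /coef_bound /kernel_bound /term_bound exprMn exprVn.
have g0 : center_gap k ^+ pair_col k != 0 by rewrite expf_neq0// gt_eqF// center_gap_gt0.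
have e4 : (4 ^+ pair_col k : R) != 0 by rewrite expf_neq0.
move: (center_gap k ^+ _) (4 ^+ _) (nbin _ _)%:R (cell_mass _ _ _) (b _) g0 e4 => x1 x2 x3 x4 x5 x10 x20.
by field; rewrite x10 x20 gt_eqF.
Qed.

Lemma term_bound_ge0 k : 0 <= term_bound k.
Proof. by rewrite -term_boundE; apply: mulr_ge0; [exact: coef_bound_ge0|exact: kernel_bound_ge0]. Qed.

Lemma expansion_coef_le k f : Hinf_set nu f ->
  rnorm (expansion_coef k f) <= coef_bound k * fine (weighted_norm nu f).
Proof.
move=> hf; rewrite !rnormM rnorm_real rnorm_nat gtr0_norm ?invr_gt0//.
have := moment_le (iB disk0) (pair_row k) (pair_col k) hf; rewrite -/(center_gap k) => h.
have n0 : 0 <= c0^-1 * (nbin N.+1 (pair_col k))%:R by rewrite mulr_ge0// invr_ge0 ltW.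
rewrite mulrA; apply: le_trans (ler_wpM2l n0 h) _; rewrite le_eqVlt; apply/orP; left; apply/eqP.
rewrite /coef_bound; move: c0^-1 (nbin _ _)%:R (_ ^+ _) (cell_mass _ _ _) (fine _).
by move=> x1 x2 x3 x4 x5; ring.
Qed.

Lemma expansion_kernel_le k z : disk z ->
  density mu g z * rnorm (expansion_kernel k (phi z)) <= kernel_bound k.
Proof.
move=> Dz; have Dw := phi_self.2 _ Dz; have Dc := @cell_center_disk R (pair_row k).
have k0 := kden_gt0 Dw Dc; have g0 := center_gap_gt0 k.
rewrite /expansion_kernel kernel_funE// rnormM rnormV !rnormX exprD invfM.
have le1 : rnorm (phi z) ^+ pair_col k <= 1 by rewrite exprn_ile1 ?rnorm_ge0// ltW// -diskE.
have le2 : (rnorm (kden (phi z) (cell_center (pair_row k))) ^+ pair_col k)^-1 <= (center_gap k ^+ pair_col k)^-1.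
  rewrite lef_pV2 ?posrE ?exprn_gt0// lerXn2r ?nnegrE ?rnorm_ge0 ?(ltW g0)//; exact: kden_ge_r.
have d0 := density_ge0 mu g Dz.
have K0 n : 0 <= (rnorm (kden (phi z) (cell_center (pair_row k))) ^+ n)^-1.
  by rewrite invr_ge0 exprn_ge0 ?rnorm_ge0.
apply: le_trans (ler_pM (mulr_ge0 d0 (K0 N.+2)) (K0 _) (b_ub _ Dz) le2).
rewrite mulrA mulrC mulrA [leLHS]mulrC [leLHS]mulrA.
have p0 : 0 <= density mu g z * (rnorm (kden (phi z) (cell_center (pair_row k))) ^+ N.+2)^-1 *
    (rnorm (kden (phi z) (cell_center (pair_row k))) ^+ pair_col k)^-1.
  exact: mulr_ge0 (mulr_ge0 d0 (K0 _)) (K0 _).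
have := ler_wpM2r p0 le1; rewrite mul1r; apply: le_trans.
rewrite -mulrA ler_wpM2l ?exprn_ge0 ?rnorm_ge0//.
by rewrite [leLHS]mulrC mulrA.
Qed.

(** Row by row: the sum over [m] is at most [2 ^+ N.+2] times the common factor of the row, and
    these factors are summable by [sum_b]. *)
Lemma term_bound_sum : exists S : R, forall n, \sum_(k < n) term_bound k <= S.
Proof.
have [s hs] : exists s : R, forall n, \sum_(i < n) cell_mass nu N i * b i <= s.
  have h n : (\sum_(0 <= i < n) (cell_mass nu N i * b i)%:E <=
      \sum_(i <oo) (cell_mass nu N i * b i)%:E)%E.
    by apply: nneseries_lim_ge => i _ _; rewrite lee_fin mulr_ge0 ?cell_mass_ge0.
  move: sum_b h; case: (\sum_(i <oo) _)%E => [s _ h|//|_ h].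
    by exists s => n; have := h n; rewrite sumEFin big_mkord lee_fin.
  by have := h 0%N; rewrite big_geq.
exists (2 / c0 * 2 ^+ N.+2 * s) => n.
pose a i m : R := 2 / c0 * (cell_mass nu N i * b i) * ((nbin N.+1 m)%:R / 4 ^+ m).
rewrite (@enumeration_sum R a n n)//.
have cc : 0 <= 2 / c0 by rewrite divr_ge0// ltW.
apply: (@le_trans _ _ (\sum_(i < n) 2 / c0 * 2 ^+ N.+2 * (cell_mass nu N i * b i))).
  apply: ler_sum => i _; rewrite /a -mulr_sumr [leRHS]mulrAC ler_wpM2l//.
    by apply: mulr_ge0 => //; rewrite mulr_ge0 ?cell_mass_ge0.
  exact: nbin_quarter_sum.
by rewrite -mulr_sumr ler_wpM2l// mulr_ge0// exprn_ge0.
Qed.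

(** The expansion of [f] converges only pointwise, but [density] times each term composed with [phi]
    is at most the norm of [f] times [term_bound]. This bounds the differences of partial sums
    uniformly in [z], and the pointwise limit identifies the remainder. *)
Lemma expansion_approx f z n (S : R) : (forall n, \sum_(k < n) term_bound k <= S) -> Hinf_set nu f -> disk z ->
  density mu g z * rnorm (f (phi z) - \sum_(k < n) expansion_coef k f * expansion_kernel k (phi z)) <=
  fine (weighted_norm nu f) * (S - \sum_(k < n) term_bound k).
Proof.
move=> hS hf Dz.
have Dw := phi_self.2 _ Dz; set w := phi z in Dw *.
have F0 : 0 <= fine (weighted_norm nu f) by rewrite fine_ge0// weighted_norm_ge0.
have d0 := density_ge0 mu g Dz.
pose F n := \sum_(k < n) expansion_coef k f * expansion_kernel k w.
have FE m : c0%:C * F m = \sum_(k < m) expansion_term N f w k.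
  rewrite mulr_sumr; apply: eq_bigr => k _; rewrite /expansion_coef /expansion_term !mulrA.
  by rewrite -rmorphM mulfV ?gt_eqF// rmorph1 mul1r.
have cF := expansion_cvg (iB disk0) N_gt0 (iB Dw) hf Dw.
have step m : density mu g z * rnorm (F (n + m)%N - F n) <=
    fine (weighted_norm nu f) * (\sum_(k < n + m) term_bound k - \sum_(k < n) term_bound k).
  elim: m => [|m IH]; first by rewrite addn0 !subrr rnorm0 !mulr0.
  rewrite addnS /F !big_ord_recr/= -/(F _) -/(F _).
  rewrite addrAC [X in _ <= _ * X]addrAC mulrDr.
  apply: le_trans (ler_wpM2l d0 (rnormD _ _)) _; rewrite mulrDr lerD//.
  rewrite rnormM mulrCA -term_boundE [leRHS]mulrA [X in _ <= X * _]mulrC.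
  exact: (ler_pM (rnorm_ge0 _) (mulr_ge0 d0 (rnorm_ge0 _)) (expansion_coef_le _ hf) (expansion_kernel_le _ Dz)).
have bound m : density mu g z * rnorm (F (n + m)%N - F n) <=
    fine (weighted_norm nu f) * (S - \sum_(k < n) term_bound k).
  by apply: le_trans (step m) _; rewrite ler_wpM2l// lerB.
apply/ler_addgt0Pr => e e0.
have d1 : 0 < density mu g z + 1 by rewrite ltr_wpDl.
have e1 : 0 < e / (density mu g z + 1) * c0 by rewrite mulr_gt0 ?divr_gt0.
move/cvgrPdist_lt : cF => /(_ _ e1)[m _ hm].
have := hm (n + m)%N (leq_addl n m); rewrite sub0r normrN ger0_norm ?rnorm_ge0// -FE -mulrBr.
rewrite rnormM rnorm_real gtr0_norm// [ltLHS]mulrC ltr_pM2r// => close.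
rewrite -/(F n) (_ : f w - F n = (F (n + m)%N - F n) - (F (n + m)%N - f w)); last by ring.
apply: le_trans (ler_wpM2l d0 (rnormB _ _)) _; rewrite mulrDr lerD ?bound//.
apply: le_trans (_ : (density mu g z + 1) * (e / (density mu g z + 1)) <= _).
  by apply: ler_pM; rewrite ?rnorm_ge0 ?lerDl// ltW.
by rewrite mulrC divfK// gt_eqF.
Qed.

Lemma term_bound_limit : exists2 S : R, (forall n, \sum_(k < n) term_bound k <= S) &
  forall e : R, 0 < e -> exists n0, forall n, (n0 <= n)%N -> S - \sum_(k < n) term_bound k < e.
Proof.
pose u n : R := \sum_(k < n) term_bound k; have [s hs] := term_bound_sum.
have u_nd : nondecreasing_seq u.
  by apply/nondecreasing_seqP => n; rewrite /u big_ord_recr/= lerDl term_bound_ge0.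
have cu : cvgn u.
  by apply: nondecreasing_is_cvgn => //; exists s => _ [n _ <-]; exact: hs.
exists (limn u) => [n|e e0]; first exact: (nondecreasing_cvgn_le u_nd cu n).
move/cvgrPdist_lt : cu => /(_ _ e0)[n0 _ h]; exists n0 => n n0n.
exact: le_lt_trans (ler_norm _) (h _ n0n).
Qed.

Lemma T_op_kernel_H0 k : H0_set mu (T_op g phi (expansion_kernel k)).
Proof.
have [gamma eII] := mu_II.
apply: (T_op_H0 aG phi_self eII g_B0 _ _ (@expansion_kernel_bounded k)).
  exact: (expansion_kernel_holomorphic k).1.
exact: (T_op_Hinf T_bounded (expansion_kernel_Hinf k)).1.
Qed.

(** The remainder [h] of the expansion is itself an element of H^infty_nu, so the linear operator
    behind [T_bounded] applies to it, and the estimate of [density] times [h] composed with [phi]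
    becomes one for the norm of its image. *)
Lemma T_op_approx : exists2 C : R, 0 < C &
  (forall k, fine (weighted_norm mu (T_op g phi (expansion_kernel k))) <= C * kernel_bound k) /\
  forall f n S, (forall n, \sum_(k < n) term_bound k <= S) -> Hinf_set nu f ->
  forall z, disk z ->
  mu z * rnorm (T_op g phi f z - \sum_(k < n) expansion_coef k f * T_op g phi (expansion_kernel k) z) <=
  C * (fine (weighted_norm nu f) * (S - \sum_(k < n) term_bound k)).
Proof.
have [gamma eII] := mu_II; have [C C0 hC] := T_op_norm_le aG phi_self eII; exists C => //; split.
  move=> k; have hk := expansion_kernel_Hinf k; have hT := T_op_Hinf T_bounded hk.
  apply: fine_weighted_norm_le => // [|z Dz]; first exact: mulr_ge0 (ltW C0) (kernel_bound_ge0 k).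
  exact: (hC _ _ (kernel_bound_ge0 k) hk.1.1 hT.1.1 (fun w => @expansion_kernel_le k w) z Dz).
move=> f n S hS hf; have [T hT _] := T_bounded.
pose e k : Hinf nu := MkHinf (mem_set (expansion_kernel_Hinf k) : _ \in Hinf_pred nu).
pose f' : Hinf nu := MkHinf (mem_set hf : _ \in Hinf_pred nu).
pose h := f' - \sum_(k < n) expansion_coef k f *: e k.
have hE w : Hinf_val h w = f w - \sum_(k < n) expansion_coef k f * expansion_kernel k w.
  by rewrite -(Hinf_val_sum n (fun k => expansion_coef k f) e).
have TE w : T_op g phi (Hinf_val h) w =
    T_op g phi f w - \sum_(k < n) expansion_coef k f * T_op g phi (expansion_kernel k) w.
  rewrite -hT linearB linear_sum/= -(hT f').
  have -> : \sum_(k < n) T (expansion_coef k f *: e k) = \sum_(k < n) expansion_coef k f *: T (e k).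
    by apply: eq_bigr => k _; rewrite linearZ.
  rewrite [LHS](_ : _ = Hinf_val (T f') w - Hinf_val (\sum_(k < n) expansion_coef k f *: T (e k)) w)//.
  rewrite (Hinf_val_sum n (fun k => expansion_coef k f) (fun k => T (e k))).
  by congr (_ - _); apply: eq_bigr => k _; rewrite hT.
move=> z Dz; rewrite -TE; have hh := HinfP h.
have K0 : 0 <= fine (weighted_norm nu f) * (S - \sum_(k < n) term_bound k).
  by apply: mulr_ge0; [rewrite fine_ge0// weighted_norm_ge0|rewrite subr_ge0].
have le w : disk w -> density mu g w * rnorm (Hinf_val h (phi w)) <=
    fine (weighted_norm nu f) * (S - \sum_(k < n) term_bound k).
  by move=> Dw; rewrite hE; exact: expansion_approx.
exact: (hC _ _ K0 hh.1.1 (T_op_Hinf T_bounded hh).1.1 le z Dz).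
Qed.

(** The partial sums have images in H^0_mu and approximate the image of [f] in the norm of [mu];
    vanishing at the boundary is preserved by such limits. *)
Lemma T_op_Hinf_H0 f : Hinf_set nu f -> H0_set mu (T_op g phi f).
Proof.
move=> hf; have [C C0 [_ hC]] := T_op_approx; have [S hS cS] := term_bound_limit.
split; first exact: (T_op_Hinf T_bounded hf).1.
move=> e e0; set F := fine (weighted_norm nu f).
have F0 : 0 <= F by rewrite fine_ge0// weighted_norm_ge0.
have d0 : 0 < e / 2 / (C * (F + 1)) by rewrite !divr_gt0// mulr_gt0// ltr_wpDl.
have [n /(_ n (leqnn n)) hn] := cS _ d0.
pose y k : H0 mu := MkH0 (mem_set (T_op_kernel_H0 k) : _ \in H0_pred mu).
have [_ /(_ (e / 2))[]] := H0P (\sum_(k < n) expansion_coef k f *: y k); first by rewrite divr_gt0.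
move=> r r1 hr; exists r => // z /[dup] rz /andP[_ z1].
have Dz : disk z by apply/disk_rnorm.
have m0 := weight_gt0 mu Dz.
have := hr z rz; rewrite !ger0_norm ?mulr_ge0 ?rnorm_ge0 ?(ltW m0)//.
rewrite (H0_val_sum n (fun k => expansion_coef k f) y) /= => small.
have := hC f n S hS hf z Dz; rewrite -/F => near.
rewrite -[T_op g phi f z](subrK (\sum_(k < n) expansion_coef k f * T_op g phi (expansion_kernel k) z)).
apply: le_lt_trans (ler_wpM2l (ltW m0) (rnormD _ _)) _.
rewrite mulrDr [e]splitr; apply: ler_ltD small; apply: le_trans near _.
have CF : 0 < C * (F + 1) by rewrite mulr_gt0// ltr_wpDl.
move: hn; rewrite ltr_pdivlMr// => /ltW; apply: le_trans.
rewrite mulrA [leRHS]mulrC; apply: ler_wpM2r; first by rewrite subr_ge0.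
by rewrite ler_wpM2l ?(ltW C0)// lerDl.
Qed.

Lemma expansion_functional k : exists x' : {linear Hinf nu -> R[i]},
  forall f, x' f = expansion_coef k (Hinf_val f).
Proof.
have [|G hG] := @packed_linear R (Hinf nu) R[i] (fun f : Hinf nu => expansion_coef k (Hinf_val f)).
  move=> a x y; rewrite /expansion_coef.
  rewrite [Hinf_val (a *: x + y)](_ : _ = a *: Hinf_val x + Hinf_val y)//.
  rewrite (moment_linear (iB disk0) _ _ a (HinfP x) (HinfP y)).
  rewrite -[_ *: _]/(_ * _).
  move: (_%:C) (_%:R) (moment _ _ _ _) (moment _ _ _ _) => x1 x2 x3 x4; ring.
by exists G => f; rewrite hG.
Qed.

Lemma expansion_nuclear : nuclear_between (@Hinf_val R nu) (@H0_val R mu) (T_op g phi).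
Proof.
have [C C0 [yC hC]] := T_op_approx; have [S hS cS] := term_bound_limit.
have [x' hx'] := choice expansion_functional.
have [|T hT] := @packed_linear R (Hinf nu) (H0 mu) (fun f =>
    MkH0 (mem_set (T_op_Hinf_H0 (HinfP f)) : _ \in H0_pred mu)).
  move=> a f h; apply: val_inj => /=.
  by rewrite -(T_op_linear T_bounded a (HinfP f) (HinfP h)).
pose y k : H0 mu := MkH0 (mem_set (T_op_kernel_H0 k) : _ \in H0_pred mu).
exists T; first by move=> f; rewrite hT.
exists x', y; split.
- move=> k; apply: (bounded_linear_continuous (K := coef_bound k)) => f; rewrite hx'.
  by apply: expansion_coef_le; exact: HinfP.
- apply: le_lt_trans (ltry (C * S)).
  apply: lime_le.
    by apply: is_cvg_nneseries => k _ _; rewrite mule_ge0 ?dual_norm_ge0 ?lee_fin ?rnorm_ge0.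
  apply: nearW => n.
  apply: (@le_trans _ _ (\sum_(0 <= k < n) (C * term_bound k)%:E)%E).
    apply: lee_sum => k _; rewrite -term_boundE mulrCA EFinM.
    apply: lee_pmul; rewrite ?dual_norm_ge0 ?lee_fin ?rnorm_ge0//; last exact: yC.
    apply: ge_ereal_sup => _ [f /= f1 <-]; rewrite lee_fin hx'.
    apply: le_trans (expansion_coef_le k (HinfP f)) _.
    by rewrite -[leRHS]mulr1; apply: ler_wpM2l f1; exact: coef_bound_ge0.
  by rewrite sumEFin lee_fin big_mkord -mulr_sumr; apply: ler_wpM2l (hS n); exact: ltW.
- move=> f; apply/cvgrPdist_lt => e e0.
  have eE : e = (complex.Re e)%:C by rewrite RRe_real// realE ltW.
  have re0 : 0 < complex.Re e by rewrite -ltcR -eE.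
  set F := fine (weighted_norm nu (Hinf_val f)).
  have F0 : 0 <= F by rewrite fine_ge0// weighted_norm_ge0.
  have CF : 0 < C * (F + 1) by rewrite mulr_gt0// ltr_wpDl.
  have [n0 hn0] := cS _ (divr_gt0 re0 CF).
  exists n0 => // n /hn0 hn; rewrite normE eE ltcR.
  apply: le_lt_trans (_ : C * (F * (S - \sum_(k < n) term_bound k)) < _); last first.
    move: hn; rewrite ltr_pdivlMr//; apply: le_lt_trans.
    rewrite mulrA [leRHS]mulrC; apply: ler_wpM2r; first by rewrite subr_ge0.
    by rewrite ler_wpM2l ?(ltW C0)// lerDl.
  apply: H0_rnorm_le => [|z Dz].
    by apply: mulr_ge0 (ltW C0) (mulr_ge0 F0 _); rewrite subr_ge0.
  apply: le_trans (hC _ n S hS (HinfP f) z Dz); rewrite le_eqVlt; apply/orP; left; apply/eqP.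
  congr (_ * rnorm _); rewrite /series/= big_mkord hT.
  rewrite [LHS](_ : _ = T_op g phi (Hinf_val f) z - H0_val (\sum_(k < n) x' k f *: y k) z)//.
  rewrite (H0_val_sum n (fun k => x' k f) y); congr (_ - _).
  by apply: eq_bigr => k _; rewrite hx'.
Qed.

End sufficiency.

Section inclusions.
Context {R : realType} (nu mu : radial_weight R) (S : (R[i] -> R[i]) -> R[i] -> R[i]).

Lemma nuclear_restrict_H0 (Y : normedModType R[i]) (iY : Y -> R[i] -> R[i]) :
  nuclear_between (@Hinf_val R nu) iY S -> nuclear_between (@H0_val R nu) iY S.
Proof.
have [I [I1 iI]] := H0_inclusion nu; have [J [J1 iJ]] := @id_contraction R Y.
by apply: (nuclear_between_comp I1 J1 iI) => y; rewrite iJ.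
Qed.

Lemma nuclear_into_Hinf (X : normedModType R[i]) (iX : X -> R[i] -> R[i]) :
  nuclear_between iX (@H0_val R mu) S -> nuclear_between iX (@Hinf_val R mu) S.
Proof.
have [I [I1 iI]] := @id_contraction R X; have [J [J1 iJ]] := H0_inclusion mu.
by apply: (nuclear_between_comp I1 J1 _ iJ) => x; rewrite iI.
Qed.

End inclusions.

Theorem theorem6 (R : realType) (nu mu : radial_weight R)
    (nu_normal : normal_weight nu) (mu_normal : normal_weight mu)
    (alpha : R) (alpha_gt : -1 < alpha)
    (omega : R[i] -> R) (nu_omega : normal_pair nu omega alpha)
    (g : R[i] -> R[i])
    (g_B0 : little_bloch (fun z => (1 - rnorm z ^+ 2) * mu z) g)
    (phi : R[i] -> R[i]) (phi_self : analytic_self_map phi)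
    (T_bounded : bounded_between (@Hinf_val R nu) (@Hinf_val R mu) (T_op g phi)) :
  [<-> nuclear_between (@H0_val R nu) (@Hinf_val R mu) (T_op g phi);
       nuclear_between (@Hinf_val R nu) (@Hinf_val R mu) (T_op g phi);
       nuclear_between (@H0_val R nu) (@H0_val R mu) (T_op g phi);
       nuclear_between (@Hinf_val R nu) (@H0_val R mu) (T_op g phi);
       (area_integral (fun zeta =>
          ereal_sup [set ((1 - rnorm z ^+ 2) * mu z * rnorm (derive1 g z) /
                     rnorm (1 - conjc zeta * phi z) `^ (alpha + 2))%:E | z in disk]
          * ((1 - rnorm zeta ^+ 2) `^ alpha / nu zeta)%:E) < +oo)%E].
Proof.
have [_ nu_II] := nu_normal; have [mu_I mu_II] := mu_normal; have [_ _ _ _ nu_I] := nu_omega.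
(* The successor ensures [0 < N], on which the extension by 0 across the unit circle relies. *)
pose N := (Num.bound `|alpha|).+1.
have alphaN : alpha <= N%:R.
  rewrite (le_trans (ler_norm _))// (le_trans (ltW (archi_boundP (normr_ge0 _))))//.
  by rewrite ler_nat.
have ae : nuclear_between (@H0_val R nu) (@Hinf_val R mu) (T_op g phi) ->
    (area_integral (fun zeta =>
      ereal_sup [set (density mu g z / rnorm (kden (phi z) zeta) `^ (alpha + 2))%:E | z in disk]
      * ((1 - rnorm zeta ^+ 2) `^ alpha / nu zeta)%:E) < +oo)%E.
  move=> /(nuclear_kernel_masses g_B0.1 phi_self nu_II mu_I nu_I T_bounded alphaN)[b [b0 sb] hb].
  exact: (masses_integral phi_self nu_II nu_I alphaN b0 sb hb).
have ed : (area_integral (fun zeta =>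
      ereal_sup [set (density mu g z / rnorm (kden (phi z) zeta) `^ (alpha + 2))%:E | z in disk]
      * ((1 - rnorm zeta ^+ 2) `^ alpha / nu zeta)%:E) < +oo)%E ->
    nuclear_between (@Hinf_val R nu) (@H0_val R mu) (T_op g phi).
  move=> /(integral_masses g_B0.1 phi_self nu_II mu_I nu_I T_bounded alphaN)[b [b0 sb] hb].
  exact: (expansion_nuclear g_B0 phi_self nu_II mu_II nu_I T_bounded _ alphaN b0 sb hb).
tfae.
- by move=> /ae/ed/nuclear_into_Hinf.
- by move=> /nuclear_restrict_H0/ae/ed/nuclear_restrict_H0.
- by move=> /nuclear_into_Hinf/ae/ed.
- by move=> /nuclear_into_Hinf/nuclear_restrict_H0/ae.
- by move=> /ed/nuclear_into_Hinf/nuclear_restrict_H0.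
Qed.
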